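(* (1) For every integer $n\ge1$, the twist knot $T_{4n+1}$ is the Fourier-$(1,1,2)$ knot with $n_x=2$, $\phi_x=0$, $n_y=8n+3$, $\phi_y=1/2$, $n_{z,1}=2$, $\phi_{z,1}=\pi/4$, $n_{z,2}=8n+1$, $\phi_{z,2}=\frac{8n+1+(8n+5)\pi}{2(8n+3)}$, and $A_{z,2}=1$. (2) For every integer $n\ge1$, the twist knot $T_{2n}$ is the Fourier-$(1,1,2)$ knot with $n_x=2$, $\phi_x=0$, $n_y=2n+1$, $\phi_y=1/2$, $n_{z,1}=2$, $\phi_{z,1}=\pi/4$, $n_{z,2}=2n+3$, $\phi_{z,2}=\frac{2n+3-3\pi}{2(2n+1)}$, and $A_{z,2}=1$.
   Context: The Fourier-$(1,1,2)$ knot with these data is the curve $x(t)=\cos(n_xt+\phi_x)$, $y(t)=\cos(n_yt+\phi_y)$, $z(t)=\cos(n_{z,1}t+\phi_{z,1})+A_{z,2}\cos(n_{z,2}t+\phi_{z,2})$, $0\le t\le 2\pi$. For an integer $m$, the twist knot $T_m$ is the 2-bridge knot $K_{(2m+1)/2}$, i.e. the 2-bridge knot with classifying fraction $p/q=(2m+1)/2$ (a clasp together with $m$ half-twists). Knots are considered up to mirror image. *)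

(* Defs.v *)
From Stdlib Require Import Reals Lra Arith.
Open Scope R_scope.

Definition R3 := (R * R * R)%type.

Definition dist3 (p q : R3) : R :=
  let '(x1, y1, z1) := p in let '(x2, y2, z2) := q in
  sqrt ((x1 - x2) ^ 2 + (y1 - y2) ^ 2 + (z1 - z2) ^ 2).

Definition cont3 (f : R3 -> R3) : Prop :=
  forall p eps, 0 < eps -> exists del, 0 < del /\
    forall q, dist3 p q < del -> dist3 (f p) (f q) < eps.

Definition homeo3 (f : R3 -> R3) : Prop :=
  exists g : R3 -> R3, (forall p, g (f p) = p) /\ (forall p, f (g p) = p)
    /\ cont3 f /\ cont3 g.

Definition ambient_isotopy (H : R -> R3 -> R3) : Prop :=
  (forall t p eps, 0 <= t <= 1 -> 0 < eps -> exists del, 0 < del /\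
      forall s q, 0 <= s <= 1 -> Rabs (s - t) < del -> dist3 p q < del ->
        dist3 (H t p) (H s q) < eps)
  /\ (forall t, 0 <= t <= 1 -> homeo3 (H t))
  /\ (forall p, H 0 p = p).

Definition ambient_isotopic (K1 K2 : R3 -> Prop) : Prop :=
  exists H, ambient_isotopy H /\
    forall p, K2 p <-> exists q, K1 q /\ p = H 1 q.

Definition mirror3 (p : R3) : R3 := let '(x, y, z) := p in (x, y, - z).
Definition mirror_set (K : R3 -> Prop) : R3 -> Prop := fun p => K (mirror3 p).

Definition same_knot_type_up_to_mirror (K1 K2 : R3 -> Prop) : Prop :=
  ambient_isotopic K1 K2 \/ ambient_isotopic K1 (mirror_set K2).

Definition seg (a b p : R3) : Prop :=
  let '(xa, ya, za) := a in let '(xb, yb, zb) := b in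
  exists s, 0 <= s <= 1 /\
    p = ((1 - s) * xa + s * xb, (1 - s) * ya + s * yb, (1 - s) * za + s * zb).

Definition fourier112 (nx phx ny phy nz1 phz1 nz2 phz2 Az2 : R) (t : R) : R3 :=
  (cos (nx * t + phx), cos (ny * t + phy),
   cos (nz1 * t + phz1) + Az2 * cos (nz2 * t + phz2)).

Definition is_fourier_knot_of_type (c : R -> R3) (K : R3 -> Prop) : Prop :=
  (forall t1 t2, 0 <= t1 < 2 * PI -> 0 <= t2 < 2 * PI -> c t1 = c t2 -> t1 = t2)
  /\ same_knot_type_up_to_mirror (fun p => exists t, 0 <= t <= 2 * PI /\ p = c t) K.

(** * A polygonal model of the twist knot T_m = K_{(2m+1)/2}, m >= 0.
    It is the 4-plat (plat closure of a 4-strand braid) of the word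
      sigma_2^m  sigma_1^{-1}  sigma_2      (continued fraction [m,1,1] = (2m+1)/2),
    i.e. m half-twists (sigma_2^m) followed by a clasp.
    Strands sit at heights y = 1,2,3,4 in the plane z = 0 at integer abscissae
    x = 0, ..., m+2; step k (between x = k-1 and x = k) performs the generator
    (i, e): the strand going from position i to i+1 passes through
    (k-1/2, i+1/2, e) and the strand going from i+1 to i through
    (k-1/2, i+1/2, -e) (e = 1: the upward strand is over; e = -1: under).
    Left and right caps join positions 1-2 and 3-4. *)
Definition twist_step_gen (m k : nat) : nat * R :=
  if (k <=? m)%nat then (2%nat, 1) else if (k =? m + 1)%nat then (1%nat, -1)
  else (2%nat, 1).

Definition strand_piece (k i : nat) (e : R) (j : nat) (p : R3) : Prop :=
  let x0 := INR k - 1 in let x1 := INR k in let xm := INR k - / 2 in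
  let ym := INR i + / 2 in
  if (j =? i)%nat then
    seg (x0, INR j, 0) (xm, ym, e) p \/ seg (xm, ym, e) (x1, INR i + 1, 0) p
  else if (j =? i + 1)%nat then
    seg (x0, INR j, 0) (xm, ym, - e) p \/ seg (xm, ym, - e) (x1, INR i, 0) p
  else seg (x0, INR j, 0) (x1, INR j, 0) p.

Definition TwistKnot (m : nat) (p : R3) : Prop :=
  let L := INR (m + 2) in
  seg (0, 1, 0) (0, 2, 0) p \/ seg (0, 3, 0) (0, 4, 0) p \/
  seg (L, 1, 0) (L, 2, 0) p \/ seg (L, 3, 0) (L, 4, 0) p \/
  exists k j, (1 <= k <= m + 2)%nat /\ (1 <= j <= 4)%nat /\
    strand_piece k (fst (twist_step_gen m k)) (snd (twist_step_gen m k)) j p.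

(* Main.v *)
(* In terms of u = arccos x the Fourier curve consists of four arcs over
   0 <= u <= PI that meet in pairs at the two ends, so it is a 4-plat read along
   the first coordinate.  All crossings of the (x, y)-projection occur when
   alpha = ny u / 2 is in (PI/2) Z or (PI/2) Z +- 1/2, and since nz2 = ny +- 2 the
   height differences there are explicit multiples of sin u or sines of slowly
   varying phases; this gives the braid word of the plat.

   Isotopies of R^3 come from one principle: if c, c' are maps into R^3 such that
   c' - c is Lipschitz with a small constant relative to the distances
   |c s - c t|, then c' - c extends to a contraction D of R^3 (McShane) and
   id + D is a homeomorphism carrying the image of c to that of c'.  Iterating
   along straight-line homotopies yields the braid relations, the moves at the
   caps of a plat, and the passage from the smooth curve to the braid word.

   The normal closure of s1 s3^-1 in the braid group B_4 fixes the caps, so every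
   s3 may be replaced by s1 (flypes).  In the resulting quotient B_3 the Fourier
   words become s2^-2 s1^(4n+2) s2 and, up to full twists, s2^2 s1^(2n) s2^-1,
   and these reduce to the plat words s2^m s1^-1 s2 of the twist knots. *)
Require Import Defs.
From Stdlib Require Import Reals Lra Lia Psatz List ClassicalEpsilon Setoid Morphisms.
Import ListNotations.
Open Scope R_scope.

(** * Ambient isotopies *)

(** No diagram calculus is assumed: every move has to be a family of homeomorphisms. The criterion,
    that differences of displacements are dominated by the distances during a straight-line
    homotopy, is scale invariant. Hence it survives at a cap, where two strands meet, as soon as
    they separate linearly there; this is why caps are wedges and why linear lower bounds at tips
    recur. Braid moves are made uniform by heights: if one order of the strands decides every
    crossing, the strands can be lifted to disjoint levels, moved freely in y and lowered again, so
    a relation becomes a finite check on an order. In one cap move the order interleaves the legs of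
    the two arcs, so heights cannot free their tips; it needs its own geometric argument, and it is
    what makes s2 s1 s3^-1 s2^-1 trivial at the caps. The curve itself needs a single straight-line
    homotopy: the change of variable [gph] makes each pair of arcs cross at the abscissa where the
    plat strands cross, so only the signs of the heights there have to be compared. *)

Definition px (p : R3) : R := fst (fst p).
Definition py (p : R3) : R := snd (fst p).
Definition pz (p : R3) : R := snd p.

(** The l1 distance keeps Lipschitz estimates coordinatewise and linear. It is equivalent to
    [dist3], so continuity transfers. *)
Definition n1 (p q : R3) : R :=
  Rabs (px p - px q) + Rabs (py p - py q) + Rabs (pz p - pz q).

Ltac coords := unfold px, py, pz; cbn [fst snd].
Ltac abs_lra := first [rewrite Rabs_right by lra; lra | rewrite Rabs_left1 by lra; lra].

Lemma R3_ext (p q : R3) : px p = px q -> py p = py q -> pz p = pz q -> p = q.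
Proof. destruct p as [[? ?] ?], q as [[? ?] ?]; unfold px, py, pz; simpl; congruence. Qed.

Lemma n1_nonneg p q : 0 <= n1 p q.
Proof. unfold n1; pose proof (Rabs_pos (px p - px q)); pose proof (Rabs_pos (py p - py q));
  pose proof (Rabs_pos (pz p - pz q)); lra. Qed.

Lemma n1_sym p q : n1 p q = n1 q p.
Proof. unfold n1; now rewrite (Rabs_minus_sym (px p)), (Rabs_minus_sym (py p)), (Rabs_minus_sym (pz p)). Qed.

Lemma n1_refl p : n1 p p = 0.
Proof. unfold n1; rewrite !Rminus_diag, Rabs_R0; lra. Qed.

Lemma Rabs_tri3 x y z : Rabs (x - z) <= Rabs (x - y) + Rabs (y - z).
Proof. replace (x - z) with ((x - y) + (y - z)) by ring; apply Rabs_triang. Qed.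

Lemma n1_tri p q r : n1 p r <= n1 p q + n1 q r.
Proof.
  unfold n1; pose proof (Rabs_tri3 (px p) (px q) (px r));
  pose proof (Rabs_tri3 (py p) (py q) (py r)); pose proof (Rabs_tri3 (pz p) (pz q) (pz r)); lra.
Qed.

Lemma n1_eq0 p q : n1 p q <= 0 -> p = q.
Proof.
  unfold n1; intros H; pose proof (Rabs_pos (px p - px q)); pose proof (Rabs_pos (py p - py q));
  pose proof (Rabs_pos (pz p - pz q)).
  assert (forall a, Rabs a <= 0 -> a = 0) as Z
    by (intros a Ha; destruct (Req_dec a 0) as [|N]; auto; apply Rabs_pos_lt in N; lra).
  apply R3_ext; apply Rminus_diag_uniq, Z; lra.
Qed.

Lemma n1_coord p q : Rabs (px p - px q) <= n1 p q /\ Rabs (py p - py q) <= n1 p q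
  /\ Rabs (pz p - pz q) <= n1 p q.
Proof.
  unfold n1; pose proof (Rabs_pos (px p - px q)); pose proof (Rabs_pos (py p - py q));
  pose proof (Rabs_pos (pz p - pz q)); lra.
Qed.

Lemma dist3_le_n1 p q : dist3 p q <= n1 p q.
Proof.
  destruct p as [[x1 y1] z1], q as [[x2 y2] z2]; unfold n1, dist3, px, py, pz; simpl.
  pose proof (Rabs_pos (x1 - x2)); pose proof (Rabs_pos (y1 - y2)); pose proof (Rabs_pos (z1 - z2)).
  rewrite <- (sqrt_pow2 (Rabs (x1 - x2) + Rabs (y1 - y2) + Rabs (z1 - z2))) by lra.
  apply sqrt_le_1_alt. rewrite !Rmult_1_r.
  pose proof (Rsqr_abs (x1 - x2)) as A; pose proof (Rsqr_abs (y1 - y2)) as B;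
  pose proof (Rsqr_abs (z1 - z2)) as C; unfold Rsqr in *. rewrite A, B, C. nra.
Qed.

Lemma n1_le_dist3 p q : n1 p q <= 3 * dist3 p q.
Proof.
  destruct p as [[x1 y1] z1], q as [[x2 y2] z2]; unfold n1, dist3, px, py, pz; simpl.
  rewrite !Rmult_1_r.
  assert (forall a b, 0 <= b -> Rabs a <= sqrt (a * a + b)) as E.
  { intros a b Hb. rewrite <- sqrt_Rsqr_abs. apply sqrt_le_1_alt; unfold Rsqr; lra. }
  set (a := x1 - x2); set (b := y1 - y2); set (c := z1 - z2).
  assert (0 <= a * a /\ 0 <= b * b /\ 0 <= c * c) as [? [? ?]]
    by (repeat split; apply Rle_0_sqr).
  pose proof (E a (b * b + c * c) ltac:(lra)) as Ea.
  pose proof (E b (a * a + c * c) ltac:(lra)) as Eb.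
  pose proof (E c (a * a + b * b) ltac:(lra)) as Ec.
  replace (b * b + (a * a + c * c)) with (a * a + (b * b + c * c)) in Eb by ring.
  replace (c * c + (a * a + b * b)) with (a * a + (b * b + c * c)) in Ec by ring.
  replace (a * a + b * b + c * c) with (a * a + (b * b + c * c)) by ring. lra.
Qed.

Definition cont_n1 (f : R3 -> R3) : Prop :=
  forall p eps, 0 < eps -> exists del, 0 < del /\ forall q, n1 p q < del -> n1 (f p) (f q) < eps.

Lemma cont3_iff f : cont3 f <-> cont_n1 f.
Proof.
  split; intros H p eps He.
  - destruct (H p (eps / 3)) as [d [Hd D]]; [lra|]. exists d; split; auto; intros q Hq.
    pose proof (n1_le_dist3 (f p) (f q)); pose proof (dist3_le_n1 p q).
    specialize (D q ltac:(lra)); lra.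
  - destruct (H p eps He) as [d [Hd D]]. exists (d / 3); split; [lra|]; intros q Hq.
    pose proof (dist3_le_n1 (f p) (f q)); pose proof (n1_le_dist3 p q).
    specialize (D q ltac:(lra)); lra.
Qed.

Lemma cont_n1_lip f L : (forall p q, n1 (f p) (f q) <= L * n1 p q) -> cont3 f.
Proof.
  intros H; apply cont3_iff; intros p eps He.
  exists (eps / (Rabs L + 1)). pose proof (Rabs_pos L). split.
  - apply Rdiv_lt_0_compat; lra.
  - intros q Hq. specialize (H p q). pose proof (n1_nonneg p q). pose proof (Rle_abs L).
    apply (Rmult_lt_compat_l (Rabs L + 1)) in Hq; [|lra].
    replace ((Rabs L + 1) * (eps / (Rabs L + 1))) with eps in Hq by (field; lra). nra.
Qed.

Lemma cont3_comp f g : cont3 f -> cont3 g -> cont3 (fun p => g (f p)).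
Proof.
  intros F G p eps He. destruct (G (f p) eps He) as [d [Hd D]].
  destruct (F p d Hd) as [d' [Hd' D']]. exists d'; split; auto.
Qed.

Lemma homeo3_comp f g : homeo3 f -> homeo3 g -> homeo3 (fun p => g (f p)).
Proof.
  intros [f' [F1 [F2 [F3 F4]]]] [g' [G1 [G2 [G3 G4]]]].
  exists (fun p => f' (g' p)). repeat split; intros.
  - now rewrite G1, F1.
  - now rewrite F2, G2.
  - now apply cont3_comp.
  - now apply cont3_comp.
Qed.

Definition jcont (H : R -> R3 -> R3) : Prop :=
  forall t p eps, 0 <= t <= 1 -> 0 < eps -> exists del, 0 < del /\
    forall s q, 0 <= s <= 1 -> Rabs (s - t) < del -> n1 p q < del -> n1 (H t p) (H s q) < eps.

Lemma ambient_isotopy_intro H : jcont H -> (forall t, 0 <= t <= 1 -> homeo3 (H t)) ->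
  (forall p, H 0 p = p) -> ambient_isotopy H.
Proof.
  intros J A B; split; [|split]; auto.
  intros t p eps Ht He. destruct (J t p eps Ht He) as [d [Hd D]].
  exists (d / 3); split; [lra|]. intros s q Hs Hst Hpq.
  eapply Rle_lt_trans; [apply dist3_le_n1|]. apply D; auto; try lra.
  pose proof (n1_le_dist3 p q); lra.
Qed.

Lemma ambient_isotopy_jcont H : ambient_isotopy H -> jcont H.
Proof.
  intros [J _] t p eps Ht He. destruct (J t p (eps / 3) Ht ltac:(lra)) as [d [Hd D]].
  exists d; split; auto. intros s q Hs Hst Hpq.
  pose proof (dist3_le_n1 p q); pose proof (n1_le_dist3 (H t p) (H s q)).
  specialize (D s q Hs Hst ltac:(lra)); lra.
Qed.

Lemma isotopic_iff K1 K1' K2 K2' : (forall p, K1 p <-> K1' p) -> (forall p, K2 p <-> K2' p) ->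
  ambient_isotopic K1 K2 -> ambient_isotopic K1' K2'.
Proof.
  intros A B [H [HI HK]]; exists H; split; auto. intros p. rewrite <- B, HK.
  split; intros [q [Q E]]; exists q; split; auto; now apply A.
Qed.

Lemma homeo3_id : homeo3 (fun p => p).
Proof.
  exists (fun p => p). repeat split; auto; apply (cont_n1_lip _ 1); intros; lra.
Qed.

Lemma isotopic_refl K : ambient_isotopic K K.
Proof.
  exists (fun _ p => p). split.
  - apply ambient_isotopy_intro; auto using homeo3_id.
    intros t p eps _ He; exists eps; auto.
  - intros p; split; [intros; exists p; auto | intros [q [Q E]]; subst; auto].
Qed.

Lemma isotopic_sym K1 K2 : ambient_isotopic K1 K2 -> ambient_isotopic K2 K1.
Proof.
  intros [H [HI HK]]. pose proof (ambient_isotopy_jcont H HI) as J.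
  destruct HI as [_ [Hh H0]].
  destruct (Hh 1 ltac:(lra)) as [g [G1 [G2 [G3 G4]]]].
  (* The isotopy is run backwards after the inverse of its end map, so that it starts at the
     identity. *)
  exists (fun t p => H (1 - t) (g p)). split.
  - apply ambient_isotopy_intro.
    + intros t p eps Ht He. destruct (J (1 - t) (g p) eps ltac:(lra) He) as [d [Hd D]].
      apply cont3_iff in G4. destruct (G4 p d Hd) as [d' [Hd' D']].
      exists (Rmin d d'). split; [now apply Rmin_pos|]. intros s q Hs Hst Hpq.
      pose proof (Rmin_l d d'); pose proof (Rmin_r d d').
      apply D; try lra.
      * replace (1 - s - (1 - t)) with (- (s - t)) by ring. rewrite Rabs_Ropp; lra.
      * apply D'; lra.
    + intros t Ht. apply (homeo3_comp g (H (1 - t))); [|apply Hh; lra].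
      exists (H 1); repeat split; auto.
    + intros p. now rewrite Rminus_0_r, G2.
  - intros p; rewrite Rminus_diag. split.
    + intros Kp. exists (H 1 p). rewrite G1, H0. split; auto. apply HK; eauto.
    + intros [q [Q E]]. rewrite H0 in E; subst. apply HK in Q. destruct Q as [r [Q E]].
      subst. now rewrite G1.
Qed.

Lemma isotopic_trans K1 K2 K3 :
  ambient_isotopic K1 K2 -> ambient_isotopic K2 K3 -> ambient_isotopic K1 K3.
Proof.
  intros [H [HI HK]] [G [GI GK]].
  pose proof (ambient_isotopy_jcont H HI) as JH. pose proof (ambient_isotopy_jcont G GI) as JG.
  destruct HI as [_ [Hh H0]], GI as [_ [Gh G0]].
  exists (fun t p => if Rle_dec t (1 / 2) then H (2 * t) p else G (2 * t - 1) (H 1 p)). split.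
  - apply ambient_isotopy_intro.
    + intros t p eps Ht He.
      assert (exists d, 0 < d /\ forall s q, 0 <= s <= 1 / 2 -> t <= 1 / 2 -> Rabs (s - t) < d ->
                n1 p q < d -> n1 (H (2 * t) p) (H (2 * s) q) < eps) as [d1 [Hd1 D1]].
      { destruct (Rle_dec t (1 / 2)) as [L|L].
        - destruct (JH (2 * t) p eps ltac:(lra) He) as [d [Hd D]].
          exists (d / 2); split; [lra|]. intros s q Hs _ Hst Hpq. apply D; try lra.
          replace (2 * s - 2 * t) with (2 * (s - t)) by ring.
          rewrite Rabs_mult, (Rabs_right 2); lra.
        - exists 1; split; [lra|]; intros; lra. }
      assert (exists d, 0 < d /\ forall s q, 1 / 2 <= s <= 1 -> 1 / 2 <= t -> Rabs (s - t) < d ->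
                n1 p q < d -> n1 (G (2 * t - 1) (H 1 p)) (G (2 * s - 1) (H 1 q)) < eps)
        as [d2 [Hd2 D2]].
      { destruct (Rle_dec (1 / 2) t) as [L|L].
        - destruct (JG (2 * t - 1) (H 1 p) eps ltac:(lra) He) as [d [Hd D]].
          destruct (Hh 1 ltac:(lra)) as [_ [_ [_ [C _]]]].
          apply cont3_iff in C. destruct (C p d Hd) as [d' [Hd' D']].
          exists (Rmin (d / 2) d'); split; [apply Rmin_pos; lra|]. intros s q Hs _ Hst Hpq.
          pose proof (Rmin_l (d / 2) d'); pose proof (Rmin_r (d / 2) d').
          apply D; try lra.
          + replace (2 * s - 1 - (2 * t - 1)) with (2 * (s - t)) by ring.
            rewrite Rabs_mult, (Rabs_right 2); lra.
          + apply D'; lra.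
        - exists 1; split; [lra|]; intros; lra. }
      (* Away from the junction time 1/2 a neighbourhood of [t] stays on one branch; at the junction
         both branches give [H 1 p]. *)
      assert (exists d, 0 < d /\ forall s, Rabs (s - t) < d -> (t < 1 / 2 -> s < 1 / 2) /\
                (1 / 2 < t -> 1 / 2 < s)) as [d3 [Hd3 D3]].
      { destruct (Req_dec t (1 / 2)) as [E|E].
        - exists 1; split; [lra|]; intros; lra.
        - exists (Rabs (t - 1 / 2)). split; [apply Rabs_pos_lt; lra|].
          intros s Hs. apply Rabs_def2 in Hs. unfold Rabs in Hs; destruct (Rcase_abs (t - 1 / 2)); lra. }
      exists (Rmin d1 (Rmin d2 d3)). split; [repeat apply Rmin_pos; auto|].
      intros s q Hs Hst Hpq.
      pose proof (Rmin_l d1 (Rmin d2 d3)); pose proof (Rmin_r d1 (Rmin d2 d3)).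
      pose proof (Rmin_l d2 d3); pose proof (Rmin_r d2 d3).
      destruct (D3 s ltac:(lra)) as [D31 D32].
      assert (forall r, G 0 (H 1 r) = H 1 r) as GH by (intros; apply G0).
      destruct (Rle_dec t (1 / 2)) as [L|L], (Rle_dec s (1 / 2)) as [L'|L'].
      * apply D1; lra.
      * assert (t = 1 / 2) as E by lra. subst t.
        replace (2 * (1 / 2)) with 1 by lra. rewrite <- (GH p).
        replace 0 with (2 * (1 / 2) - 1) at 1 by lra. apply D2; lra.
      * lra.
      * apply D2; lra.
    + intros t Ht. destruct (Rle_dec t (1 / 2)).
      * apply Hh; lra.
      * apply (homeo3_comp (H 1) (G (2 * t - 1))); [apply Hh | apply Gh]; lra.
    + intros p. destruct (Rle_dec 0 (1 / 2)); [|lra]. now rewrite Rmult_0_r.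
  - intros p. destruct (Rle_dec 1 (1 / 2)); [lra|]. replace (2 * 1 - 1) with 1 by lra.
    rewrite GK. split.
    + intros [q [Q E]]. apply HK in Q. destruct Q as [r [Q E']]. exists r; subst; auto.
    + intros [r [Q E]]. exists (H 1 r); split; auto. apply HK; eauto.
Qed.

Definition vmove (s : R) (p q : R3) : R3 :=
  ((1 - s) * px p + s * px q, (1 - s) * py p + s * py q, (1 - s) * pz p + s * pz q).

(** Joint continuity comes for free: time moves a point by at most |s - t| times its total
    displacement, and at a fixed time the map is a convex combination of the identity and [F]. *)
Lemma straight_isotopy (F : R3 -> R3) (K : R3 -> Prop) :
  cont3 F -> (forall s, 0 <= s <= 1 -> homeo3 (fun p => vmove s p (F p))) ->
  ambient_isotopic K (fun p => exists q, K q /\ p = F q).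
Proof.
  intros C Hh. exists (fun s p => vmove s p (F p)). split.
  - apply ambient_isotopy_intro; auto.
    + intros t p eps Ht He. apply cont3_iff in C.
      destruct (C p (eps / 4) ltac:(lra)) as [d [Hd D]].
      pose proof (n1_nonneg p (F p)) as N.
      assert (0 < eps / 4 / (n1 p (F p) + 1)) as Q by (apply Rdiv_lt_0_compat; lra).
      exists (Rmin d (Rmin (eps / 4) (eps / 4 / (n1 p (F p) + 1)))).
      split; [repeat apply Rmin_pos; lra|].
      intros s q Hs Hst Hpq.
      pose proof (Rmin_l d (Rmin (eps / 4) (eps / 4 / (n1 p (F p) + 1)))) as B1.
      pose proof (Rmin_r d (Rmin (eps / 4) (eps / 4 / (n1 p (F p) + 1)))) as B2.
      pose proof (Rmin_l (eps / 4) (eps / 4 / (n1 p (F p) + 1))) as B3.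
      pose proof (Rmin_r (eps / 4) (eps / 4 / (n1 p (F p) + 1))) as B4.
      specialize (D q ltac:(lra)).
      assert (Rabs (s - t) * n1 p (F p) <= eps / 4) as S.
      { pose proof (Rabs_pos (s - t)).
        assert (Rabs (s - t) * (n1 p (F p) + 1) <= eps / 4 / (n1 p (F p) + 1) * (n1 p (F p) + 1))
          by (apply Rmult_le_compat_r; lra).
        replace (eps / 4 / (n1 p (F p) + 1) * (n1 p (F p) + 1)) with (eps / 4) in * by (field; lra).
        nra. }
      assert (n1 (vmove t p (F p)) (vmove s p (F p)) <= Rabs (s - t) * n1 p (F p)) as S1.
      { unfold n1, vmove, px, py, pz; simpl. destruct p as [[x y] z]; simpl.
        destruct (F (x, y, z)) as [[x' y'] z']; simpl.
        replace ((1 - t) * x + t * x' - ((1 - s) * x + s * x')) with ((s - t) * (x - x')) by ring.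
        replace ((1 - t) * y + t * y' - ((1 - s) * y + s * y')) with ((s - t) * (y - y')) by ring.
        replace ((1 - t) * z + t * z' - ((1 - s) * z + s * z')) with ((s - t) * (z - z')) by ring.
        rewrite !Rabs_mult; lra. }
      assert (n1 (vmove s p (F p)) (vmove s q (F q)) <= n1 p q + n1 (F p) (F q)) as S2.
      { unfold n1, vmove; simpl. unfold px, py, pz; simpl.
        destruct p as [[x y] z], q as [[a b] c]; simpl.
        destruct (F (x, y, z)) as [[x' y'] z'], (F (a, b, c)) as [[a' b'] c']; simpl.
        assert (forall u v u' v', Rabs ((1 - s) * u + s * u' - ((1 - s) * v + s * v'))
                  <= Rabs (u - v) + Rabs (u' - v')) as G.
        { intros u v u' v'.
          replace ((1 - s) * u + s * u' - ((1 - s) * v + s * v'))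
            with ((1 - s) * (u - v) + s * (u' - v')) by ring.
          eapply Rle_trans; [apply Rabs_triang|]. rewrite !Rabs_mult, (Rabs_right s), (Rabs_right (1 - s)) by lra.
          pose proof (Rabs_pos (u - v)); pose proof (Rabs_pos (u' - v')); nra. }
        pose proof (G x a x' a'); pose proof (G y b y' b'); pose proof (G z c z' c'); lra. }
      pose proof (n1_tri (vmove t p (F p)) (vmove s p (F p)) (vmove s q (F q))). lra.
    + intros p. unfold vmove; apply R3_ext; unfold px, py, pz; simpl; ring.
  - intros p; split; intros [q [Q E]]; exists q; split; auto; subst;
      unfold vmove; apply R3_ext; unfold px, py, pz; simpl; ring.
Qed.

(** * Perturbations of the identity and Lipschitz extension *)

Definition vadd (p q : R3) : R3 := (px p + px q, py p + py q, pz p + pz q).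
Definition vsub (p q : R3) : R3 := (px p - px q, py p - py q, pz p - pz q).

Lemma cv_of_geometric (u : nat -> R) (C : R) :
  (forall k, Rabs (u (S k) - u k) <= C * (/ 2) ^ k) -> exists l, Un_cv u l.
Proof.
  intros H. assert (0 <= C) as HC.
  { specialize (H 0%nat); simpl in H; pose proof (Rabs_pos (u 1%nat - u 0%nat)); lra. }
  assert (forall k m, Rabs (u (k + m)%nat - u k) <= 2 * C * (/ 2) ^ k) as B.
  { intros k m. assert (Rabs (u (k + m)%nat - u k) <= 2 * C * ((/ 2) ^ k - (/ 2) ^ (k + m))).
    { induction m as [|m IH].
      - rewrite Nat.add_0_r, !Rminus_diag, Rabs_R0; lra.
      - rewrite Nat.add_succ_r. pose proof (Rabs_tri3 (u (S (k + m))) (u (k + m)%nat) (u k)).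
        specialize (H (k + m)%nat). simpl. lra. }
    assert (0 < (/ 2) ^ (k + m)) by (apply pow_lt; lra). nra. }
  destruct (R_complete u) as [l Hl]; [|now exists l]. intros eps He.
  destruct (pow_lt_1_zero (/ 2) ltac:(rewrite Rabs_right; lra) (eps / (4 * C + 1))) as [N HN].
  { apply Rdiv_lt_0_compat; lra. }
  exists N. intros n m Hn Hm. unfold Rdist.
  specialize (HN N (le_n N)). rewrite Rabs_right in HN by (apply Rle_ge, pow_le; lra).
  pose proof (B N (n - N)%nat) as Bn. pose proof (B N (m - N)%nat) as Bm.
  replace (N + (n - N))%nat with n in Bn by lia. replace (N + (m - N))%nat with m in Bm by lia.
  pose proof (Rabs_tri3 (u n) (u N) (u m)). rewrite (Rabs_minus_sym (u N) (u m)) in *.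
  apply (Rmult_lt_compat_l (4 * C + 1)) in HN; [|lra].
  replace ((4 * C + 1) * (eps / (4 * C + 1))) with eps in HN by (field; lra).
  assert (0 < (/ 2) ^ N) by (apply pow_lt; lra). nra.
Qed.

Lemma half_contraction_fixpoint (f : R3 -> R3) :
  (forall p q, n1 (f p) (f q) <= / 2 * n1 p q) -> exists p, f p = p.
Proof.
  intros H. set (u := fix u k := match k with O => (0, 0, 0) | S k => f (u k) end).
  set (C := n1 (u 1%nat) (u 0%nat)).
  assert (forall k, n1 (u (S k)) (u k) <= C * (/ 2) ^ k) as B.
  { induction k as [|k IH]; [change (C <= C * 1); rewrite Rmult_1_r; apply Rle_refl|].
    change (n1 (f (u (S k))) (f (u k)) <= C * (/ 2 * (/ 2) ^ k)).
    eapply Rle_trans; [apply H|].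
    apply (Rmult_le_compat_l (/ 2)) in IH; lra. }
  destruct (cv_of_geometric (fun k => px (u k)) C) as [lx Lx].
  { intros k; eapply Rle_trans; [apply (n1_coord (u (S k)) (u k)) | apply B]. }
  destruct (cv_of_geometric (fun k => py (u k)) C) as [ly Ly].
  { intros k; eapply Rle_trans; [apply (n1_coord (u (S k)) (u k)) | apply B]. }
  destruct (cv_of_geometric (fun k => pz (u k)) C) as [lz Lz].
  { intros k; eapply Rle_trans; [apply (n1_coord (u (S k)) (u k)) | apply B]. }
  exists (lx, ly, lz). apply n1_eq0. apply Rnot_lt_le; intros E.
  set (e := n1 (f (lx, ly, lz)) (lx, ly, lz)) in *.
  destruct (Lx (e / 12) ltac:(lra)) as [Nx Hx]. destruct (Ly (e / 12) ltac:(lra)) as [Ny Hy].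
  destruct (Lz (e / 12) ltac:(lra)) as [Nz Hz].
  assert (forall k, (k >= Nx + Ny + Nz)%nat -> n1 (u k) (lx, ly, lz) < e / 4) as D.
  { intros k Hk. specialize (Hx k ltac:(lia)). specialize (Hy k ltac:(lia)).
    specialize (Hz k ltac:(lia)). unfold Rdist in *. unfold n1; unfold px, py, pz in *; simpl in *; lra. }
  pose proof (D _ (le_n _)) as D0. pose proof (D (S (Nx + Ny + Nz)) ltac:(lia)) as D1.
  set (k := (Nx + Ny + Nz)%nat) in *. change (u (S k)) with (f (u k)) in D1.
  specialize (H (lx, ly, lz) (u k)). rewrite (n1_sym (lx, ly, lz) (u k)) in H.
  pose proof (n1_tri (f (lx, ly, lz)) (f (u k)) (lx, ly, lz)). unfold e in *. lra.
Qed.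

Lemma n1_vsub y a b : n1 (vsub y a) (vsub y b) = n1 a b.
Proof.
  unfold n1, vsub, px, py, pz; simpl. destruct y as [[? ?] ?], a as [[? ?] ?], b as [[? ?] ?]; simpl.
  repeat match goal with |- context [Rabs (?a - ?b - (?a - ?c))] =>
    replace (a - b - (a - c)) with (- (b - c)) by ring; rewrite Rabs_Ropp end. reflexivity.
Qed.

Lemma n1_vadd_le a b c d : n1 (vadd a b) (vadd c d) <= n1 a c + n1 b d.
Proof.
  unfold n1, vadd, px, py, pz; simpl.
  destruct a as [[? ?] ?], b as [[? ?] ?], c as [[? ?] ?], d as [[? ?] ?]; simpl.
  repeat match goal with |- context [Rabs (?a + ?b - (?c + ?d))] =>
    replace (a + b - (c + d)) with ((a - c) + (b - d)) by ring end.
  repeat match goal with |- context [Rabs (?a + ?b)] =>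
    lazymatch goal with H : Rabs (a + b) <= _ |- _ => fail | _ => pose proof (Rabs_triang a b) end end.
  lra.
Qed.

Lemma n1_vadd_ge a b c d : n1 a c <= n1 (vadd a b) (vadd c d) + n1 b d.
Proof.
  pose proof (n1_vadd_le (vadd a b) (vsub (0,0,0) b) (vadd c d) (vsub (0,0,0) d)) as H.
  rewrite n1_vsub in H.
  replace (vadd (vadd a b) (vsub (0,0,0) b)) with a in H
    by (apply R3_ext; unfold vadd, vsub, px, py, pz; simpl; ring).
  replace (vadd (vadd c d) (vsub (0,0,0) d)) with c in H
    by (apply R3_ext; unfold vadd, vsub, px, py, pz; simpl; ring).
  exact H.
Qed.

(** Solving p + D p = y means finding the fixed point of y - D p. The factor 1/2 yields both the
    fixed point and a 2-Lipschitz inverse. *)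
Lemma homeo3_perturbation (D : R3 -> R3) :
  (forall p q, n1 (D p) (D q) <= / 2 * n1 p q) -> homeo3 (fun p => vadd p (D p)).
Proof.
  intros H.
  assert (forall y, exists p, vadd p (D p) = y) as S.
  { intros y. destruct (half_contraction_fixpoint (fun p => vsub y (D p))) as [p Hp].
    - intros p q; rewrite n1_vsub; apply H.
    - exists p. rewrite <- Hp at 1. apply R3_ext; unfold vadd, vsub, px, py, pz; simpl; ring. }
  assert (forall p q, n1 p q <= 2 * n1 (vadd p (D p)) (vadd q (D q))) as I.
  { intros p q. pose proof (n1_vadd_ge p (D p) q (D q)). specialize (H p q). lra. }
  exists (fun y => proj1_sig (constructive_indefinite_description _ (S y))).
  assert (forall y, vadd (proj1_sig (constructive_indefinite_description _ (S y)))
            (D (proj1_sig (constructive_indefinite_description _ (S y)))) = y) as E.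
  { intros y; exact (proj2_sig (constructive_indefinite_description _ (S y))). }
  repeat split; auto.
  - intros p. apply n1_eq0. eapply Rle_trans; [apply I|]. rewrite E, n1_refl; lra.
  - apply (cont_n1_lip _ 2). intros p q. pose proof (n1_vadd_le p (D p) q (D q)).
    specialize (H p q). pose proof (n1_nonneg p q); lra.
  - apply (cont_n1_lip _ 2). intros p q. eapply Rle_trans; [apply I|]. rewrite !E; lra.
Qed.

(* McShane's extension. *)
Lemma lipschitz_extension {T} (A : T -> Prop) (c : T -> R3) (f : T -> R) (k : R) :
  0 <= k -> (forall s t, A s -> A t -> Rabs (f s - f t) <= k * n1 (c s) (c t)) ->
  exists F : R3 -> R, (forall p q, Rabs (F p - F q) <= k * n1 p q)
    /\ (forall t, A t -> F (c t) = f t).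
Proof.
  intros Hk H.
  destruct (classic (exists t, A t)) as [[t0 A0]|N].
  2:{ exists (fun _ => 0). split; [|intros t At; exfalso; eauto].
      intros p q; rewrite Rminus_diag, Rabs_R0; pose proof (n1_nonneg p q); nra. }
  (* The extension is the upper envelope of the downward cones of slope [k] with apex on the graph
     of [f]. *)
  set (S := fun p r => exists t, A t /\ r = f t - k * n1 p (c t)).
  assert (forall s t, A s -> A t -> f s - f t <= k * n1 (c s) (c t)) as H'.
  { intros; eapply Rle_trans; [apply Rle_abs | auto]. }
  assert (forall p, bound (S p)) as Bd.
  { intros p. exists (f t0 + k * n1 p (c t0)). intros r [t [At ->]].
    specialize (H' t t0 At A0). pose proof (n1_tri (c t) p (c t0)).
    rewrite (n1_sym (c t) p) in *. nra. }
  assert (forall p, exists r, S p r) as Ne by (intros p; do 2 eexists; split; eauto).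
  set (F := fun p => proj1_sig (completeness (S p) (Bd p) (Ne p))).
  assert (forall p, is_lub (S p) (F p)) as L
    by (intros p; exact (proj2_sig (completeness (S p) (Bd p) (Ne p)))).
  clearbody F. exists F. split.
  - assert (forall p q, F p <= F q + k * n1 p q) as G.
    { intros p q. apply (L p). intros r [t [At ->]].
      assert (f t - k * n1 q (c t) <= F q) by (apply (L q); exists t; auto).
      pose proof (n1_tri q p (c t)). rewrite (n1_sym q p) in *. nra. }
    intros p q. pose proof (G p q); pose proof (G q p). rewrite (n1_sym q p) in *.
    apply Rabs_le; lra.
  - intros t At. apply Rle_antisym.
    + apply (L (c t)). intros r [s [As ->]]. specialize (H' s t As At). rewrite (n1_sym (c t)); lra.
    + apply (L (c t)). exists t. rewrite n1_refl, Rmult_0_r; split; auto; lra.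
Qed.

Definition image {T} (A : T -> Prop) (c : T -> R3) (p : R3) : Prop := exists t, A t /\ p = c t.

(** The displacement is extended to all of space one coordinate at a time. Each extension has
    constant 1/6, and three of them add up in [n1] to the 1/2 that [homeo3_perturbation] asks
    for. *)
Lemma small_move_isotopic {T} (A : T -> Prop) (c c' : T -> R3) :
  (forall s t, A s -> A t ->
     n1 (vsub (c' s) (c s)) (vsub (c' t) (c t)) <= / 6 * n1 (c s) (c t)) ->
  ambient_isotopic (image A c) (image A c').
Proof.
  intros H. set (d := fun t => vsub (c' t) (c t)).
  assert (forall s t, A s -> A t -> Rabs (px (d s) - px (d t)) <= / 6 * n1 (c s) (c t)) as Hx.
  { intros s t As At; eapply Rle_trans; [apply (n1_coord (d s) (d t)) | apply H; auto]. }
  assert (forall s t, A s -> A t -> Rabs (py (d s) - py (d t)) <= / 6 * n1 (c s) (c t)) as Hy.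
  { intros s t As At; eapply Rle_trans; [apply (n1_coord (d s) (d t)) | apply H; auto]. }
  assert (forall s t, A s -> A t -> Rabs (pz (d s) - pz (d t)) <= / 6 * n1 (c s) (c t)) as Hz.
  { intros s t As At; eapply Rle_trans; [apply (n1_coord (d s) (d t)) | apply H; auto]. }
  destruct (lipschitz_extension A c _ (/ 6) ltac:(lra) Hx) as [X [X1 X2]].
  destruct (lipschitz_extension A c _ (/ 6) ltac:(lra) Hy) as [Y [Y1 Y2]].
  destruct (lipschitz_extension A c _ (/ 6) ltac:(lra) Hz) as [Z [Z1 Z2]].
  set (D := fun p : R3 => (X p, Y p, Z p) : R3).
  assert (forall p q, n1 (D p) (D q) <= / 2 * n1 p q) as HD.
  { intros p q; unfold n1 at 1, D, px, py, pz; simpl.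
    specialize (X1 p q); specialize (Y1 p q); specialize (Z1 p q); lra. }
  set (F := fun p => vadd p (D p)).
  apply (isotopic_iff (image A c) _ (fun p => exists q, image A c q /\ p = F q)).
  - intros; reflexivity.
  - assert (forall t, A t -> F (c t) = c' t) as E.
    { intros t At. unfold F, D, vadd. rewrite X2, Y2, Z2 by auto.
      apply R3_ext; unfold d, vsub, px, py, pz; simpl; ring. }
    intros p; split.
    + intros [q [[t [At ->]] ->]]. exists t; auto.
    + intros [t [At ->]]. exists (c t). split; [exists t; auto | now rewrite E].
  - apply straight_isotopy.
    + destruct (homeo3_perturbation D HD) as [_ [_ [_ [C _]]]]; exact C.
    + intros s Hs.
      assert (forall p, vadd p (s * X p, s * Y p, s * Z p) = vmove s p (F p)) as E.
      { intros p; unfold F, D, vadd, vmove; apply R3_ext; unfold px, py, pz; simpl; ring. }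
      assert (homeo3 (fun p => vadd p (s * X p, s * Y p, s * Z p))) as G.
      { apply homeo3_perturbation. intros p q. specialize (HD p q). revert HD.
        unfold n1 at 1 3, D, px, py, pz; simpl. rewrite <- !Rmult_minus_distr_l, !Rabs_mult.
        rewrite (Rabs_right s) by lra.
        pose proof (Rabs_pos (X p - X q)); pose proof (Rabs_pos (Y p - Y q));
        pose proof (Rabs_pos (Z p - Z q)). nra. }
      replace (fun p => vmove s p (F p)) with (fun p => vadd p (s * X p, s * Y p, s * Z p)); auto.
      apply FunctionalExtensionality.functional_extensionality; exact E.
Qed.

(** [M] may be large: cutting the homotopy into more than 6 |M| equal steps divides the
    displacements but not the distances at the current time, so every step is small. This is why the
    bound must hold at all intermediate times [r]. *)
Lemma straight_move_isotopic {T} (A : T -> Prop) (c c' : T -> R3) (M : R) :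
  (forall r s t, 0 <= r <= 1 -> A s -> A t ->
     n1 (vsub (c' s) (c s)) (vsub (c' t) (c t)) <= M * n1 (vmove r (c s) (c' s)) (vmove r (c t) (c' t))) ->
  ambient_isotopic (image A c) (image A c').
Proof.
  intros H. destruct (INR_unbounded (6 * Rabs M)) as [N HN].
  assert (0 < INR N) as HN0 by (pose proof (Rabs_pos M); lra).
  set (w := fun k t => vmove (INR k / INR N) (c t) (c' t)).
  assert (forall k, (k <= N)%nat -> ambient_isotopic (image A c) (image A (w k))) as G.
  { induction k as [|k IH]; intros Hk.
    - apply (isotopic_iff (image A c) _ (image A c)); [reflexivity| |apply isotopic_refl].
      assert (forall t, w 0%nat t = c t) as E.
      { intros t; unfold w, vmove; apply R3_ext; unfold px, py, pz; simpl; field; lra. }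
      intros p; split; intros [t [At ->]]; exists t; rewrite E; auto.
    - eapply isotopic_trans; [apply IH; lia|]. apply small_move_isotopic.
      intros s t As At.
      assert (INR k <= INR N) by (apply le_INR; lia). pose proof (pos_INR k).
      assert (0 <= INR k / INR N <= 1) as Hr.
      { split; [apply Rmult_le_pos; [lra|left; now apply Rinv_0_lt_compat]|].
        apply (Rmult_le_reg_r (INR N)); [lra|]. unfold Rdiv; rewrite Rmult_assoc, Rinv_l; lra. }
      specialize (H _ s t Hr As At). fold (w k s) in H; fold (w k t) in H.
      assert (n1 (vsub (w (S k) s) (w k s)) (vsub (w (S k) t) (w k t))
         = / INR N * n1 (vsub (c' s) (c s)) (vsub (c' t) (c t))) as E.
      { rewrite <- (Rabs_right (/ INR N)) at 1 by (left; now apply Rinv_0_lt_compat).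
        unfold n1; rewrite !Rmult_plus_distr_l, <- !Rabs_mult.
        unfold w; rewrite S_INR. unfold vsub, vmove, px, py, pz; cbn [fst snd].
        f_equal; [f_equal|]; f_equal; field; lra. }
      rewrite E. pose proof (n1_nonneg (w k s) (w k t)) as P. pose proof (Rle_abs M).
      apply (Rmult_le_reg_l (INR N)); [lra|]. rewrite <- Rmult_assoc, Rinv_r, Rmult_1_l by lra. nra. }
  specialize (G N (le_n N)). revert G. apply isotopic_iff; [reflexivity|].
  assert (forall t, w N t = c' t) as E.
  { intros t; unfold w, vmove; apply R3_ext; unfold px, py, pz; simpl; field; lra. }
  intros p; split; intros [t [At ->]]; exists t; rewrite E; auto.
Qed.

(** * Level-preserving isotopies *)

Definition graph {I} (a b : R) (Y Z : I -> R -> R) (p : R3) : Prop :=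
  exists i x, a <= x <= b /\ p = (x, Y i x, Z i x).

Definition union (E F : R3 -> Prop) (p : R3) : Prop := E p \/ F p.

Definition lip (a b L : R) (f : R -> R) : Prop :=
  forall x x', a <= x <= b -> a <= x' <= b -> Rabs (f x - f x') <= L * Rabs (x - x').

Definition mix (r u v : R) : R := (1 - r) * u + r * v.

Lemma mix_lip r L u u' v v' d : 0 <= r <= 1 -> Rabs (u - u') <= L * d -> Rabs (v - v') <= L * d ->
  Rabs (mix r u v - mix r u' v') <= L * d.
Proof.
  intros Hr Hu Hv. unfold mix.
  replace ((1 - r) * u + r * v - ((1 - r) * u' + r * v')) with ((1 - r) * (u - u') + r * (v - v')) by ring.
  eapply Rle_trans; [apply Rabs_triang|]. rewrite !Rabs_mult, (Rabs_right r), (Rabs_right (1 - r)) by lra.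
  nra.
Qed.

Lemma Rabs_diff_lip u u' v v' L d : Rabs (u - u') <= L * d -> Rabs (v - v') <= L * d ->
  Rabs ((v - u) - (v' - u')) <= 2 * L * d.
Proof.
  intros. replace (v - u - (v' - u')) with ((v - v') + (u' - u)) by ring.
  eapply Rle_trans; [apply Rabs_triang|]. rewrite (Rabs_minus_sym u'); lra.
Qed.

(** A motion that preserves x only has to be controlled between points of equal level: points at
    levels x and x' are compared at x', with an error proportional to |x - x'|, which the distance
    already contains. The fixed set [E] lies beyond an end where nothing moves, so a strand point at
    distance d in x from that end has moved by O(d). *)
Lemma level_isotopic {I} (a b : R) (E : R3 -> Prop) (Y0 Z0 Y1 Z1 : I -> R -> R) (L M : R) :
  0 <= L -> 0 <= M ->
  (forall i, lip a b L (Y0 i)) -> (forall i, lip a b L (Z0 i)) ->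
  (forall i, lip a b L (Y1 i)) -> (forall i, lip a b L (Z1 i)) ->
  (forall r i j x, 0 <= r <= 1 -> a <= x <= b ->
     Rabs ((Y1 i x - Y0 i x) - (Y1 j x - Y0 j x)) + Rabs ((Z1 i x - Z0 i x) - (Z1 j x - Z0 j x))
     <= M * (Rabs (mix r (Y0 i x) (Y1 i x) - mix r (Y0 j x) (Y1 j x))
             + Rabs (mix r (Z0 i x) (Z1 i x) - mix r (Z0 j x) (Z1 j x)))) ->
  (forall p, E p -> (px p <= a /\ forall i, Y0 i a = Y1 i a /\ Z0 i a = Z1 i a) \/
                    (b <= px p /\ forall i, Y0 i b = Y1 i b /\ Z0 i b = Z1 i b)) ->
  ambient_isotopic (union E (graph a b Y0 Z0)) (union E (graph a b Y1 Z1)).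
Proof.
  intros HL HM LY0 LZ0 LY1 LZ1 S HE.
  set (T := (R3 + I * R)%type).
  set (A := fun t : T => match t with inl p => E p | inr (i, x) => a <= x <= b end).
  set (c := fun (Y Z : I -> R -> R) (t : T) =>
        match t with inl p => p | inr (i, x) => (x, Y i x, Z i x) end).
  assert (forall Y Z p, image A (c Y Z) p <-> union E (graph a b Y Z) p) as Eq.
  { intros Y Z p; split.
    - intros [[q|[i x]] [At ->]]; [left; exact At | right; exists i, x; auto].
    - intros [Ep|[i [x [Hx ->]]]]; [exists (inl p); auto | exists (inr (i, x)); auto]. }
  apply (isotopic_iff _ _ _ _ (Eq Y0 Z0) (Eq Y1 Z1)).
  assert (0 <= M * L) as HML by (now apply Rmult_le_pos).
  assert (forall r i x p, 0 <= r <= 1 -> a <= x <= b -> E p ->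
     n1 (vsub (x, Y1 i x, Z1 i x) (x, Y0 i x, Z0 i x)) (vsub p p)
     <= (4 * L + M + 2 * (M * L)) * n1 (vmove r (x, Y0 i x, Z0 i x) (x, Y1 i x, Z1 i x)) (vmove r p p)) as EI.
  { intros r i x p Hr Hx Ep. destruct (n1_coord (vmove r (x, Y0 i x, Z0 i x) (x, Y1 i x, Z1 i x)) (vmove r p p)) as [N _].
    set (N1 := n1 (vmove r (x, Y0 i x, Z0 i x) (x, Y1 i x, Z1 i x)) (vmove r p p)) in *.
    assert (forall e, a <= e <= b -> (Y0 i e = Y1 i e /\ Z0 i e = Z1 i e) ->
      n1 (vsub (x, Y1 i x, Z1 i x) (x, Y0 i x, Z0 i x)) (vsub p p) <= 4 * L * Rabs (x - e)) as G.
    { intros e He [e1 e2].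
      pose proof (Rabs_diff_lip _ _ _ _ L _ (LY0 i x e Hx He) (LY1 i x e Hx He)) as B1.
      pose proof (Rabs_diff_lip _ _ _ _ L _ (LZ0 i x e Hx He) (LZ1 i x e Hx He)) as B2.
      rewrite e1, Rminus_diag, Rminus_0_r in B1. rewrite e2, Rminus_diag, Rminus_0_r in B2.
      unfold n1, vsub, px, py, pz; cbn [fst snd]. rewrite !Rminus_diag, Rabs_R0, !Rminus_0_r. lra. }
    replace (px (vmove r (x, Y0 i x, Z0 i x) (x, Y1 i x, Z1 i x)) - px (vmove r p p)) with (x - px p) in N
      by (unfold vmove, px, py, pz; simpl; ring).
    assert (forall e, Rabs (x - e) <= Rabs (x - px p) -> 4 * L * Rabs (x - e) <= (4 * L + M + 2 * (M * L)) * N1) as G2.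
    { intros e He. pose proof (Rabs_pos (x - e)). nra. }
    destruct (HE p Ep) as [[Hp Hi]|[Hp Hi]].
    - eapply Rle_trans; [apply (G a); [lra|apply Hi]|]. apply G2.
      rewrite !Rabs_right by lra; lra.
    - eapply Rle_trans; [apply (G b); [lra|apply Hi]|]. apply G2.
      rewrite !Rabs_left1 by lra; lra. }
  (* [4 * L] pays for moving the displacement to the other level, [2 * (M * L)] for moving the
     distance there, and [M] for the comparison within the level. *)
  apply (straight_move_isotopic A _ _ (4 * L + M + 2 * (M * L))).
  intros r [p|[i x]] [q|[j x']] Hr As At; cbn [A c] in *.
  - replace (vsub p p) with (vsub q q)
      by (apply R3_ext; unfold vsub, px, py, pz; simpl; ring).
    rewrite n1_refl. apply Rmult_le_pos; [lra | apply n1_nonneg].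
  - rewrite (n1_sym (vsub p p)), (n1_sym (vmove r p p)). apply EI; auto.
  - apply EI; auto.
  - specialize (S r i j x' Hr At).
    pose proof (Rabs_diff_lip _ _ _ _ L _ (LY0 i x x' As At) (LY1 i x x' As At)) as B1.
    pose proof (Rabs_diff_lip _ _ _ _ L _ (LZ0 i x x' As At) (LZ1 i x x' As At)) as B2.
    pose proof (mix_lip r L _ _ _ _ _ Hr (LY0 i x x' As At) (LY1 i x x' As At)) as B3.
    pose proof (mix_lip r L _ _ _ _ _ Hr (LZ0 i x x' As At) (LZ1 i x x' As At)) as B4.
    unfold n1, vsub, vmove, px, py, pz; cbn [fst snd].
    replace ((1 - r) * x + r * x - ((1 - r) * x' + r * x')) with (x - x') by ring.
    rewrite !Rminus_diag, Rabs_R0.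
    fold (mix r (Y0 i x) (Y1 i x)) (mix r (Z0 i x) (Z1 i x))
         (mix r (Y0 j x') (Y1 j x')) (mix r (Z0 j x') (Z1 j x')).
    pose proof (Rabs_tri3 (Y1 i x - Y0 i x) (Y1 i x' - Y0 i x') (Y1 j x' - Y0 j x')).
    pose proof (Rabs_tri3 (Z1 i x - Z0 i x) (Z1 i x' - Z0 i x') (Z1 j x' - Z0 j x')).
    pose proof (Rabs_tri3 (mix r (Y0 i x') (Y1 i x')) (mix r (Y0 i x) (Y1 i x)) (mix r (Y0 j x') (Y1 j x'))) as C1.
    pose proof (Rabs_tri3 (mix r (Z0 i x') (Z1 i x')) (mix r (Z0 i x) (Z1 i x)) (mix r (Z0 j x') (Z1 j x'))) as C2.
    rewrite (Rabs_minus_sym (mix r (Y0 i x') (Y1 i x')) (mix r (Y0 i x) (Y1 i x))) in C1.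
    rewrite (Rabs_minus_sym (mix r (Z0 i x') (Z1 i x')) (mix r (Z0 i x) (Z1 i x))) in C2.
    set (u := Rabs (mix r (Y0 i x) (Y1 i x) - mix r (Y0 j x') (Y1 j x'))) in *.
    set (v := Rabs (mix r (Z0 i x) (Z1 i x) - mix r (Z0 j x') (Z1 j x'))) in *.
    set (d := Rabs (x - x')) in *.
    assert (0 <= d) by apply Rabs_pos. assert (0 <= u) by apply Rabs_pos. assert (0 <= v) by apply Rabs_pos.
    assert (M * (Rabs (mix r (Y0 i x') (Y1 i x') - mix r (Y0 j x') (Y1 j x')) +
                 Rabs (mix r (Z0 i x') (Z1 i x') - mix r (Z0 j x') (Z1 j x'))) <= M * (u + v + 2 * L * d))
      by (apply Rmult_le_compat_l; lra).
    assert (0 <= L * u /\ 0 <= L * v /\ 0 <= M * d /\ 0 <= M * L * u /\ 0 <= M * L * v)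
      by (repeat split; repeat apply Rmult_le_pos; auto).
    nra.
Qed.

Lemma lip_mono a b L L' f : L <= L' -> lip a b L f -> lip a b L' f.
Proof. intros H F x x' Hx Hx'. specialize (F x x' Hx Hx'). pose proof (Rabs_pos (x - x')); nra. Qed.

Lemma lip_restrict a b a' b' L f : a <= a' -> b' <= b -> lip a b L f -> lip a' b' L f.
Proof. intros ? ? H x x' ? ?; apply H; lra. Qed.

Lemma Rabs_le_inv a b : Rabs a <= b -> - b <= a <= b.
Proof. unfold Rabs; destruct (Rcase_abs a); lra. Qed.

(** The factor [b - x] brings all strands back to height 0 on the right. On the left the height is
    proportional to [g], so strands with equal [g] may share a tip there, and [h] separates them to
    first order. *)
Definition height (a b g h x : R) : R := (b - x) * (g + h * (x - a)).

Lemma height_lip a b B g h : a <= b -> Rabs g <= B -> Rabs h <= B ->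
  lip a b (B + B * (b - a)) (height a b g h).
Proof.
  intros Hab Hg Hh x x' Hx Hx'. unfold height.
  replace ((b - x) * (g + h * (x - a)) - (b - x') * (g + h * (x' - a)))
    with ((- g) * (x - x') + h * ((a + b - x - x') * (x - x'))) by ring.
  eapply Rle_trans; [apply Rabs_triang|]. rewrite !Rabs_mult, Rabs_Ropp.
  assert (Rabs (a + b - x - x') <= b - a) by (apply Rabs_le; lra).
  pose proof (Rabs_pos g); pose proof (Rabs_pos h); pose proof (Rabs_pos (x - x'));
  pose proof (Rabs_pos (a + b - x - x')).
  assert (Rabs h * Rabs (a + b - x - x') <= B * (b - a)) by (apply Rmult_le_compat; lra).
  rewrite <- Rmult_assoc. nra.
Qed.

Section Layer.
Variables (I : Type) (a b : R) (E : R3 -> Prop) (g h : I -> R) (L kappa B : R).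
Hypothesis ab : a < b.
Hypothesis L0 : 0 <= L.
Hypothesis B0 : 0 <= B.
Hypothesis kappa0 : 0 < kappa.
Hypothesis gB : forall i, Rabs (g i) <= B.
Hypothesis hB : forall i, Rabs (h i) <= B.
Hypothesis h_inj : forall i j, i <> j -> h i < h j \/ h j < h i.
Hypothesis h_gap : forall i j, h j < h i -> 1 <= h i - h j.
Hypothesis g_h : forall i j, h j < h i -> g i = g j \/ 1 <= g i - g j.

Let H i x := height a b (g i) (h i) x.
Let gap i j x := H i x - H j x.

Lemma gap_facts i j x : h j < h i -> a <= x <= b ->
  (b - x) * (x - a) <= gap i j x /\ (g i <> g j -> b - x <= gap i j x) /\
  gap i j x <= (b - a) * (2 * B + 2 * B * (b - a)) /\
  (g i = g j -> gap i j x <= 2 * B * (b - a) * (x - a)).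
Proof.
  intros Hij Hx. pose proof (h_gap i j Hij) as G1.
  pose proof (gB i) as Bi; pose proof (gB j) as Bj; pose proof (hB i) as Ci; pose proof (hB j) as Cj.
  apply Rabs_le_inv in Bi, Bj, Ci, Cj.
  assert (0 <= (b - x) * (x - a)) as P by (apply Rmult_le_pos; lra).
  assert (gap i j x = (b - x) * (g i - g j) + (h i - h j) * ((b - x) * (x - a))) as ->
    by (unfold gap, H, height; ring).
  assert ((b - x) * (x - a) <= (h i - h j) * ((b - x) * (x - a))) by nra.
  assert ((h i - h j) * ((b - x) * (x - a)) <= 2 * B * ((b - x) * (x - a))) by (apply Rmult_le_compat_r; lra).
  assert ((b - x) * (x - a) <= (b - a) * (x - a)) by (apply Rmult_le_compat_r; lra).
  assert ((b - a) * (x - a) <= (b - a) * (b - a)) by (apply Rmult_le_compat_l; lra).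
  assert (0 <= B) by (pose proof (Rabs_pos (g i)); pose proof (gB i); lra).
  assert (2 * B * ((b - x) * (x - a)) <= 2 * B * ((b - a) * (x - a))) by (apply Rmult_le_compat_l; lra).
  assert (2 * B * ((b - a) * (x - a)) <= 2 * B * ((b - a) * (b - a))) by (apply Rmult_le_compat_l; lra).
  assert ((b - x) * (g i - g j) <= (b - a) * (2 * B))
    by (apply Rle_trans with ((b - x) * (2 * B)); [apply Rmult_le_compat_l|apply Rmult_le_compat_r]; lra).
  destruct (g_h i j Hij) as [Eg|Gg].
  - rewrite Eg, Rminus_diag, Rmult_0_r in *. repeat split; try lra; try tauto.
  - assert (b - x <= (b - x) * (g i - g j)) by nra. repeat split; try lra.
Qed.

Lemma pair_cases (P : I -> I -> Prop) : (forall i, P i i) -> (forall i j, P i j -> P j i) ->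
  (forall i j, h j < h i -> P i j) -> forall i j, P i j.
Proof.
  intros R S G i j. destruct (classic (i = j)) as [<-|N]; auto.
  destruct (h_inj i j N); auto.
Qed.

(** The larger of the two distances to the ends is at least (b - a)/2, so the smaller one is at most
    2/(b - a) times their product. *)
Lemma ends_bound d x Q : a <= x <= b -> 0 <= Q -> (b - x) * (x - a) <= Q ->
  d <= x - a -> d <= b - x -> d <= 2 / (b - a) * Q.
Proof.
  intros Hx HQ H1 H2 H3.
  apply (Rmult_le_reg_l (b - a)); [lra|].
  replace ((b - a) * (2 / (b - a) * Q)) with (2 * Q) by (field; lra).
  destruct (Rle_dec d 0); [nra|].
  destruct (Rle_dec (x - a) (b - x)); nra.
Qed.

Let C1 := 4 * L + 8 * L / (b - a).

Lemma C1_ge : 0 <= C1 /\ 4 * L <= C1 /\ 4 * L * (2 / (b - a)) <= C1.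
Proof.
  assert (0 < / (b - a)) by (apply Rinv_0_lt_compat; lra).
  assert (0 <= L * / (b - a)) by (apply Rmult_le_pos; lra).
  unfold C1, Rdiv; repeat split; nra.
Qed.

(* At every level two strands are apart in y, or apart in z in the order
   prescribed by [h]; the last case allows them to share a tip at a. *)
Definition layered_at (Y Z : I -> R -> R) : Prop :=
  forall i j x, h j < h i -> a <= x <= b ->
    kappa <= Rabs (Y i x - Y j x) \/ kappa <= Z i x - Z j x \/
    (g i = g j /\ kappa * (x - a) <= Rabs (Y i x - Y j x)).

(** The y-coordinates stay fixed. Strands that are close in y have the same order in z before and
    after, so no intermediate time brings them together; near a shared tip the y-distance is itself
    linear in x - a, as is the gap of the new heights. *)
Lemma to_heights (Y Z : I -> R -> R) :
  (forall i, lip a b L (Y i)) -> (forall i, lip a b L (Z i)) ->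
  (forall i, Z i a = 0 /\ Z i b = 0) -> layered_at Y Z ->
  (forall p, E p -> (px p <= a /\ forall i, g i = 0) \/ b <= px p) ->
  ambient_isotopic (union E (graph a b Y Z)) (union E (graph a b Y H)).
Proof.
  intros LY LZ Zend Lay HE.
  set (K := (b - a) * (2 * B + 2 * B * (b - a)) + 2 * B * (b - a) + 1 + kappa).
  assert (0 <= (b - a) * (2 * B + 2 * B * (b - a)) /\ 0 <= 2 * B * (b - a)) as [K1 K2].
  { assert (0 <= B * (b - a)) by (apply Rmult_le_pos; lra). split; [apply Rmult_le_pos; lra|lra]. }
  destruct C1_ge as [C10 [C11 C12]].
  apply (level_isotopic a b E Y Z Y H (L + (B + B * (b - a))) ((1 + C1) * (K / kappa))).
  - assert (0 <= B * (b - a)) by (apply Rmult_le_pos; lra). lra.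
  - apply Rmult_le_pos; [lra|]. apply Rmult_le_pos; [unfold K; lra | left; now apply Rinv_0_lt_compat].
  - intros i; apply (lip_mono a b L); auto. nra.
  - intros i; apply (lip_mono a b L); auto. nra.
  - intros i; apply (lip_mono a b L); auto. nra.
  - intros i; apply (lip_mono a b (B + B * (b - a))); [lra|]. apply height_lip; auto; lra.
  - intros r i j x Hr Hx. revert i j. apply pair_cases.
    + intros i. rewrite !Rminus_diag, Rabs_R0. lra.
    + intros i j P. rewrite (Rabs_minus_sym (Y j x - Y j x)), (Rabs_minus_sym (H j x - Z j x)),
        (Rabs_minus_sym (mix r (Y j x) (Y j x))), (Rabs_minus_sym (mix r (Z j x) (H j x))). exact P.
    + intros i j Hij. destruct (gap_facts i j x Hij Hx) as [G1 [G2 [G3 G4]]].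
      assert (0 <= gap i j x) as G0.
      { assert (0 <= (b - x) * (x - a)) by (apply Rmult_le_pos; lra). lra. }
      replace (Y i x - Y i x - (Y j x - Y j x)) with 0 by ring. rewrite Rabs_R0, Rplus_0_l.
      replace (mix r (Y i x) (Y i x) - mix r (Y j x) (Y j x)) with (Y i x - Y j x) by (unfold mix; ring).
      replace (mix r (Z i x) (H i x) - mix r (Z j x) (H j x))
        with ((1 - r) * (Z i x - Z j x) + r * gap i j x) by (unfold mix, gap; ring).
      (* The old heights vanish at both ends, hence are bounded by the distance to the nearer end.
         By [ends_bound] this is at most a multiple of (b - x)(x - a), which the new gap
         dominates. *)
      assert (Rabs (H i x - Z i x - (H j x - Z j x)) <= (1 + C1) * gap i j x) as U.
      { replace (H i x - Z i x - (H j x - Z j x)) with (gap i j x + (Z j x - Z i x)) by (unfold gap; ring).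
        eapply Rle_trans; [apply Rabs_triang|]. rewrite (Rabs_right (gap i j x)) by lra.
        assert (forall k e, e = a \/ e = b -> Rabs (Z k x) <= L * Rabs (x - e)) as ZB.
        { intros k e He. replace (Z k x) with (Z k x - Z k e)
            by (destruct (Zend k), He as [->| ->]; lra). apply LZ; destruct He; lra. }
        destruct (Rle_dec L 0) as [Lz|Lp].
        - assert (L = 0) as Lz' by lra. pose proof (ZB i a (or_introl eq_refl)) as z1.
          pose proof (ZB j a (or_introl eq_refl)) as z2. rewrite Lz' in z1, z2.
          pose proof (Rabs_triang (Z j x) (- Z i x)) as t. rewrite Rabs_Ropp in t. unfold Rminus. nra.
        - assert (Rabs (Z j x - Z i x) / (4 * L) <= 2 / (b - a) * gap i j x) as V.
          { apply ends_bound with x; auto;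
            (apply (Rmult_le_reg_r (4 * L)); [lra|]; unfold Rdiv; rewrite Rmult_assoc, Rinv_l, Rmult_1_r by lra;
             pose proof (Rabs_triang (Z j x) (- Z i x)) as t; rewrite Rabs_Ropp in t).
            + pose proof (ZB i a (or_introl eq_refl)); pose proof (ZB j a (or_introl eq_refl)).
              rewrite (Rabs_right (x - a)) in * by lra. unfold Rminus in *; nra.
            + pose proof (ZB i b (or_intror eq_refl)); pose proof (ZB j b (or_intror eq_refl)).
              rewrite (Rabs_left1 (x - b)) in * by lra. unfold Rminus in *; nra. }
          apply (Rmult_le_compat_l (4 * L)) in V; [|lra].
          replace (4 * L * (Rabs (Z j x - Z i x) / (4 * L))) with (Rabs (Z j x - Z i x)) in V by (field; lra).
          assert (4 * L * (2 / (b - a)) * gap i j x <= C1 * gap i j x) by (apply Rmult_le_compat_r; lra). lra. }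
      eapply Rle_trans; [exact U|]. rewrite Rmult_assoc. apply Rmult_le_compat_l; [lra|].
      assert (forall q, kappa * gap i j x <= K * q -> gap i j x <= K / kappa * q) as Q.
      { intros q Hq. apply (Rmult_le_reg_l kappa); auto.
        replace (kappa * (K / kappa * q)) with (K * q) by (field; lra). auto. }
      apply Q. pose proof (Rabs_pos (Y i x - Y j x)) as A1.
      set (m := (1 - r) * (Z i x - Z j x) + r * gap i j x).
      pose proof (Rabs_pos m) as A2. pose proof (Rle_abs m) as A3.
      assert (0 <= K) by (unfold K; lra).
      destruct (Lay i j x Hij Hx) as [S|[S|[S1 S2]]].
      * apply Rle_trans with (kappa * K); [apply Rmult_le_compat_l; unfold K; lra|]. nra.
      * apply Rle_trans with (K * m); [|apply Rmult_le_compat_l; lra].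
        assert (kappa * gap i j x <= K * (Z i x - Z j x)).
        { apply Rle_trans with (kappa * K); [apply Rmult_le_compat_l; unfold K; lra|]. nra. }
        assert (kappa * gap i j x <= K * gap i j x) by (apply Rmult_le_compat_r; unfold K; lra).
        unfold m. nra.
      * specialize (G4 S1).
        apply Rle_trans with (2 * B * (b - a) * (kappa * (x - a))); [nra|].
        apply Rle_trans with (2 * B * (b - a) * Rabs (Y i x - Y j x)); [apply Rmult_le_compat_l; auto|].
        apply Rmult_le_compat; try lra. unfold K; lra.
  - intros p Ep. unfold H, height. destruct (HE p Ep) as [[Hp G]|Hp]; [left|right]; split; auto; intros i; split; auto.
    + rewrite G. destruct (Zend i) as [-> _]. ring.
    + destruct (Zend i) as [_ ->]. ring.
Qed.

(* Lift all strands to the heights [H], move them there in the y-direction, and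
   lower them again. *)
Lemma layer_isotopic (Y0 Z0 Y1 Z1 : I -> R -> R) :
  (forall i, lip a b L (Y0 i)) -> (forall i, lip a b L (Z0 i)) ->
  (forall i, lip a b L (Y1 i)) -> (forall i, lip a b L (Z1 i)) ->
  (forall i, Z0 i a = 0 /\ Z0 i b = 0) -> (forall i, Z1 i a = 0 /\ Z1 i b = 0) ->
  layered_at Y0 Z0 -> layered_at Y1 Z1 ->
  (forall i, Y0 i b = Y1 i b) ->
  (forall i j, g i = g j -> Y1 i a - Y0 i a = Y1 j a - Y0 j a) ->
  (forall p, E p -> (px p <= a /\ forall i, g i = 0 /\ Y0 i a = Y1 i a) \/ b <= px p) ->
  ambient_isotopic (union E (graph a b Y0 Z0)) (union E (graph a b Y1 Z1)).
Proof.
  intros LY0 LZ0 LY1 LZ1 E0 E1 S0 S1 Yb Ya HE.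
  assert (forall p, E p -> (px p <= a /\ forall i, g i = 0) \/ b <= px p) as HE'.
  { intros p Ep. destruct (HE p Ep) as [[? G]|]; auto. left; split; auto. intros i; apply G. }
  eapply isotopic_trans; [apply to_heights; eauto|].
  eapply isotopic_trans; [|apply isotopic_sym; apply to_heights; eauto].
  destruct C1_ge as [C10 [C11 C12]].
  assert (0 <= B * (b - a)) by (apply Rmult_le_pos; lra).
  apply (level_isotopic a b E Y0 H Y1 H (L + (B + B * (b - a))) C1); try lra.
  - intros i; apply (lip_mono a b L); auto; lra.
  - intros i; apply (lip_mono a b (B + B * (b - a))); [lra|]. apply height_lip; auto; lra.
  - intros i; apply (lip_mono a b L); auto; lra.
  - intros i; apply (lip_mono a b (B + B * (b - a))); [lra|]. apply height_lip; auto; lra.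
  - intros r i j x Hr Hx. revert i j. apply pair_cases.
    + intros i. rewrite !Rminus_diag, Rabs_R0. lra.
    + intros i j P. rewrite (Rabs_minus_sym (Y1 j x - Y0 j x)), (Rabs_minus_sym (H j x - H j x)),
        (Rabs_minus_sym (mix r (Y0 j x) (Y1 j x))), (Rabs_minus_sym (mix r (H j x) (H j x))). exact P.
    + intros i j Hij. destruct (gap_facts i j x Hij Hx) as [G1 [G2 [G3 G4]]].
      assert (0 <= gap i j x) as G0.
      { assert (0 <= (b - x) * (x - a)) by (apply Rmult_le_pos; lra). lra. }
      replace (H i x - H i x - (H j x - H j x)) with 0 by ring. rewrite Rabs_R0, Rplus_0_r.
      replace (mix r (H i x) (H i x) - mix r (H j x) (H j x)) with (gap i j x) by (unfold mix, gap; ring).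
      rewrite (Rabs_right (gap i j x)) by lra.
      apply Rle_trans with (C1 * gap i j x).
      2:{ apply Rmult_le_compat_l; auto. pose proof (Rabs_pos (mix r (Y0 i x) (Y1 i x) - mix r (Y0 j x) (Y1 j x))); lra. }
      assert (forall k e, e = a \/ e = b ->
        Rabs ((Y1 k x - Y0 k x) - (Y1 k e - Y0 k e)) <= 2 * L * Rabs (x - e)) as DB.
      { intros k e He. apply Rabs_diff_lip; [apply LY0|apply LY1]; destruct He; lra. }
      set (d := Rabs (Y1 i x - Y0 i x - (Y1 j x - Y0 j x))).
      (* Displacements that agree at an end differ by at most 4 L times the distance to it. If
         [g i = g j] both ends are available and [ends_bound] applies; otherwise the end [b]
         suffices, because the gap is then at least b - x. *)
      assert (forall e, e = a \/ e = b -> Y1 i e - Y0 i e = Y1 j e - Y0 j e -> d <= 4 * L * Rabs (x - e)) as DE.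
      { intros e He Q. pose proof (DB i e He) as q1; pose proof (DB j e He) as q2. rewrite Q in q1.
        rewrite Rabs_minus_sym in q2. unfold d.
        pose proof (Rabs_tri3 (Y1 i x - Y0 i x) (Y1 j e - Y0 j e) (Y1 j x - Y0 j x)). lra. }
      pose proof (DE b (or_intror eq_refl) ltac:(rewrite !Yb; ring)) as Db.
      rewrite (Rabs_left1 (x - b)) in Db by lra.
      destruct (classic (g i = g j)) as [Eg|Ng].
      * pose proof (DE a (or_introl eq_refl) (Ya i j Eg)) as Da. rewrite (Rabs_right (x - a)) in Da by lra.
        destruct (Rle_dec L 0) as [Lz|Lp].
        { assert (L = 0) as Lz' by lra. rewrite Lz' in Da. nra. }
        assert (d / (4 * L) <= 2 / (b - a) * gap i j x) as V.
        { apply ends_bound with x; auto;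
            apply (Rmult_le_reg_r (4 * L)); try lra; unfold Rdiv; rewrite Rmult_assoc, Rinv_l, Rmult_1_r by lra; lra. }
        apply (Rmult_le_compat_l (4 * L)) in V; [|lra].
        replace (4 * L * (d / (4 * L))) with d in V by (field; lra).
        assert (4 * L * (2 / (b - a)) * gap i j x <= C1 * gap i j x) by (apply Rmult_le_compat_r; lra). lra.
      * specialize (G2 Ng). nra.
  - intros p Ep. destruct (HE p Ep) as [[Hp G]|Hp]; [left|right]; split; auto; intros i; split; auto. apply G.
Qed.
End Layer.

(** * Reparametrisation of the first coordinate and rotation *)

Lemma cont3_xmap f : continuity f -> cont3 (fun p => (f (px p), py p, pz p)).
Proof.
  intros C. apply cont3_iff. intros p eps He.
  destruct (C (px p) (eps / 2) ltac:(lra)) as [d [Hd D]].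
  exists (Rmin d (eps / 2)). split; [apply Rmin_pos; lra|]. intros q Hq.
  pose proof (Rmin_l d (eps / 2)); pose proof (Rmin_r d (eps / 2)).
  assert (Rabs (f (px p) - f (px q)) < eps / 2) as B.
  { destruct (Req_dec (px p) (px q)) as [<-|N]; [rewrite Rminus_diag, Rabs_R0; lra|].
    rewrite Rabs_minus_sym. apply D. split; [split; [exact I | auto]|].
    simpl; unfold Rdist. rewrite Rabs_minus_sym. pose proof (proj1 (n1_coord p q)); lra. }
  pose proof (Rabs_pos (px p - px q)).
  unfold n1 in *; unfold px, py, pz in *; cbn [fst snd]. lra.
Qed.

(** Staying at bounded distance from the identity makes [f] surjective by the intermediate value
    theorem; monotonicity makes the inverse continuous. *)
Lemma homeo3_xmap f (B : R) : (forall x y, x < y -> f x < f y) -> continuity f ->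
  (forall x, Rabs (f x - x) <= B) -> homeo3 (fun p => (f (px p), py p, pz p)).
Proof.
  intros Inc C Bd.
  assert (0 <= B) as B0 by (pose proof (Rabs_pos (f 0 - 0)); specialize (Bd 0); lra).
  assert (forall y, exists x, f x = y) as S.
  { intros y. destruct (IVT (fun x => f x - y) (y - B - 1) (y + B + 1)) as [z [_ Hz]].
    - apply continuity_minus; auto. apply continuity_const; intros ? ?; auto.
    - lra.
    - specialize (Bd (y - B - 1)). apply Rabs_le_inv in Bd. lra.
    - specialize (Bd (y + B + 1)). apply Rabs_le_inv in Bd. lra.
    - exists z; lra. }
  set (g := fun y => proj1_sig (constructive_indefinite_description _ (S y))).
  assert (forall y, f (g y) = y) as FG.
  { intros y; exact (proj2_sig (constructive_indefinite_description _ (S y))). }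
  assert (forall x y, f x < f y -> x < y) as Ref.
  { intros x y Hxy. destruct (Rtotal_order x y) as [?|[->|Hl]]; auto; [lra|].
    specialize (Inc _ _ Hl); lra. }
  assert (forall x, g (f x) = x) as GF.
  { intros x. destruct (Rtotal_order (g (f x)) x) as [Hl|[?|Hl]]; auto;
      apply Inc in Hl; rewrite FG in Hl; lra. }
  assert (continuity g) as Cg.
  { intros y eps He. pose proof (Inc (g y - eps) (g y) ltac:(lra)) as I1.
    pose proof (Inc (g y) (g y + eps) ltac:(lra)) as I2. rewrite FG in I1, I2.
    exists (Rmin (y - f (g y - eps)) (f (g y + eps) - y)). split; [apply Rmin_pos; lra|].
    intros y' [_ Hy]. simpl in *; unfold Rdist in *.
    pose proof (Rmin_l (y - f (g y - eps)) (f (g y + eps) - y)).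
    pose proof (Rmin_r (y - f (g y - eps)) (f (g y + eps) - y)).
    assert (Rabs (y' - y) < y - f (g y - eps)) as D1 by lra.
    assert (Rabs (y' - y) < f (g y + eps) - y) as D2 by lra.
    apply Rabs_def2 in D1, D2. apply Rabs_def1.
    - assert (g y' < g y + eps) by (apply Ref; rewrite FG; lra). lra.
    - assert (g y - eps < g y') by (apply Ref; rewrite FG; lra). lra. }
  exists (fun p => (g (px p), py p, pz p)). repeat split.
  - intros p. unfold px at 1; cbn [fst snd]. rewrite GF. now apply R3_ext.
  - intros p. unfold px at 1; cbn [fst snd]. rewrite FG. now apply R3_ext.
  - now apply cont3_xmap.
  - now apply cont3_xmap.
Qed.

Lemma x_reparam_isotopic (psi : R -> R) (B : R) (K : R3 -> Prop) :
  (forall x y, x < y -> psi x < psi y) -> continuity psi -> (forall x, Rabs (psi x - x) <= B) ->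
  ambient_isotopic K (fun p => exists q, K q /\ p = (psi (px q), py q, pz q)).
Proof.
  intros Inc C Bd. apply (straight_isotopy (fun q => (psi (px q), py q, pz q))).
  - now apply cont3_xmap.
  - intros s Hs.
    assert (homeo3 (fun p => (mix s (px p) (psi (px p)), py p, pz p))) as G.
    { apply (homeo3_xmap (fun x => mix s x (psi x)) B).
      - intros x y Hxy. specialize (Inc x y Hxy). unfold mix.
        destruct (Req_dec s 0) as [->|]; nra.
      - unfold mix. apply continuity_plus; apply continuity_mult; auto;
          try (apply continuity_const; intros ? ?; reflexivity). apply derivable_continuous, derivable_id.
      - intros x. unfold mix. replace ((1 - s) * x + s * psi x - x) with (s * (psi x - x)) by ring.
        rewrite Rabs_mult, (Rabs_right s) by lra. specialize (Bd x).
        pose proof (Rabs_pos (psi x - x)). nra. }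
    replace (fun p => vmove s p (psi (px p), py p, pz p))
      with (fun p => (mix s (px p) (psi (px p)), py p, pz p)); auto.
    apply FunctionalExtensionality.functional_extensionality; intros p.
    unfold vmove, mix; apply R3_ext; coords; ring.
Qed.

Lemma x_translate_isotopic (d : R) (K : R3 -> Prop) :
  ambient_isotopic K (fun p => exists q, K q /\ p = (px q + d, py q, pz q)).
Proof.
  apply (x_reparam_isotopic (fun x => x + d) (Rabs d)).
  - intros; lra.
  - apply continuity_plus; [apply derivable_continuous, derivable_id | apply continuity_const; intros ? ?; auto].
  - intros x. replace (x + d - x) with d by ring. lra.
Qed.

Definition rot (t : R) (p : R3) : R3 :=
  (px p * cos t + pz p * sin t, py p, pz p * cos t - px p * sin t).

Lemma sin_lip a b : Rabs (sin a - sin b) <= Rabs (a - b).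
Proof.
  assert (forall x y, x < y -> Rabs (sin x - sin y) <= Rabs (x - y)) as G.
  { intros x y H. destruct (MVT_cor2 sin cos x y H ltac:(intros; apply derivable_pt_lim_sin)) as [c [E _]].
    rewrite (Rabs_minus_sym (sin x)), E, Rabs_mult, (Rabs_minus_sym x).
    pose proof (Rabs_pos (y - x)). pose proof (COS_bound c).
    assert (Rabs (cos c) <= 1) by (apply Rabs_le; lra). nra. }
  destruct (Rtotal_order a b) as [H|[->|H]]; auto.
  - rewrite !Rminus_diag; lra.
  - rewrite (Rabs_minus_sym a), (Rabs_minus_sym (sin a)); auto.
Qed.

Lemma cos_lip a b : Rabs (cos a - cos b) <= Rabs (a - b).
Proof.
  rewrite !cos_sin. replace (a - b) with ((PI / 2 + a) - (PI / 2 + b)) by ring. apply sin_lip.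
Qed.

Lemma rot_n1 t p q : n1 (rot t p) (rot t q) <= 2 * n1 p q.
Proof.
  unfold n1, rot, px, py, pz; cbn [fst snd].
  replace (fst (fst p) * cos t + snd p * sin t - (fst (fst q) * cos t + snd q * sin t))
    with ((fst (fst p) - fst (fst q)) * cos t + (snd p - snd q) * sin t) by ring.
  replace (snd p * cos t - fst (fst p) * sin t - (snd q * cos t - fst (fst q) * sin t))
    with ((snd p - snd q) * cos t + - ((fst (fst p) - fst (fst q)) * sin t)) by ring.
  set (a := fst (fst p) - fst (fst q)); set (b := snd p - snd q).
  pose proof (Rabs_triang (a * cos t) (b * sin t)). pose proof (Rabs_triang (b * cos t) (- (a * sin t))).
  rewrite Rabs_Ropp, !Rabs_mult in *.
  pose proof (COS_bound t); pose proof (SIN_bound t).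
  assert (Rabs (cos t) <= 1) by (apply Rabs_le; lra). assert (Rabs (sin t) <= 1) by (apply Rabs_le; lra).
  pose proof (Rabs_pos a); pose proof (Rabs_pos b). pose proof (Rabs_pos (snd (fst p) - snd (fst q))). nra.
Qed.

(** Changing the signs of x and z together preserves orientation: it is the end of a rotation about
    the y-axis, so no mirror image enters. *)
Lemma rot_isotopic (K : R3 -> Prop) :
  ambient_isotopic K (fun p => K (- px p, py p, - pz p)).
Proof.
  exists (fun t => rot (PI * t)).
  assert (forall t p, rot (- t) (rot t p) = p) as RR.
  { intros t p. pose proof (sin2_cos2 t) as S; unfold Rsqr in S.
    unfold rot; apply R3_ext; coords; rewrite ?cos_neg, ?sin_neg; auto.
    - transitivity (fst (fst p) * (sin t * sin t + cos t * cos t)); [ring | rewrite S; ring].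
    - transitivity (snd p * (sin t * sin t + cos t * cos t)); [ring | rewrite S; ring]. }
  split.
  - apply ambient_isotopy_intro.
    + intros t p eps Ht He.
      set (m := Rabs (px p) + Rabs (pz p) + 1).
      assert (0 < m) as Hm by (unfold m; pose proof (Rabs_pos (px p)); pose proof (Rabs_pos (pz p)); lra).
      pose proof PI_RGT_0 as HPI.
      exists (Rmin (eps / 4) (eps / 8 / (PI * m))). split.
      { apply Rmin_pos; [lra|]. apply Rdiv_lt_0_compat; [lra|]. now apply Rmult_lt_0_compat. }
      intros s q Hs Hst Hpq.
      pose proof (Rmin_l (eps / 4) (eps / 8 / (PI * m))) as B1.
      pose proof (Rmin_r (eps / 4) (eps / 8 / (PI * m))) as B2.
      pose proof (n1_tri (rot (PI * t) p) (rot (PI * s) p) (rot (PI * s) q)) as T.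
      pose proof (rot_n1 (PI * s) p q) as R2.
      pose proof (cos_lip (PI * t) (PI * s)) as LC. pose proof (sin_lip (PI * t) (PI * s)) as LS.
      rewrite <- Rmult_minus_distr_l, Rabs_mult, (Rabs_right PI), (Rabs_minus_sym t) in LC, LS by lra.
      set (e := PI * Rabs (s - t)) in *.
      assert (e * m <= eps / 8) as Em.
      { unfold e. assert (PI * m * Rabs (s - t) <= PI * m * (eps / 8 / (PI * m)))
          by (apply Rmult_le_compat_l; [apply Rmult_le_pos; lra | lra]).
        replace (PI * m * (eps / 8 / (PI * m))) with (eps / 8) in * by (field; lra). lra. }
      assert (n1 (rot (PI * t) p) (rot (PI * s) p) <= 2 * (e * m)) as R1.
      { unfold n1, rot, px, py, pz; cbn [fst snd]. fold (px p) (pz p).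
        replace (px p * cos (PI * t) + pz p * sin (PI * t) - (px p * cos (PI * s) + pz p * sin (PI * s)))
          with (px p * (cos (PI * t) - cos (PI * s)) + pz p * (sin (PI * t) - sin (PI * s))) by ring.
        replace (pz p * cos (PI * t) - px p * sin (PI * t) - (pz p * cos (PI * s) - px p * sin (PI * s)))
          with (pz p * (cos (PI * t) - cos (PI * s)) + - (px p * (sin (PI * t) - sin (PI * s)))) by ring.
        rewrite Rminus_diag, Rabs_R0.
        pose proof (Rabs_triang (px p * (cos (PI * t) - cos (PI * s))) (pz p * (sin (PI * t) - sin (PI * s)))).
        pose proof (Rabs_triang (pz p * (cos (PI * t) - cos (PI * s))) (- (px p * (sin (PI * t) - sin (PI * s))))).
        rewrite Rabs_Ropp, !Rabs_mult in *. unfold m.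
        pose proof (Rabs_pos (px p)); pose proof (Rabs_pos (pz p)).
        assert (0 <= e) by (pose proof (Rabs_pos (cos (PI * t) - cos (PI * s))); lra). nra. }
      lra.
    + intros t _. exists (rot (- (PI * t))). repeat split.
      * apply RR.
      * intros p. rewrite <- (Ropp_involutive (PI * t)) at 1. apply RR.
      * apply (cont_n1_lip _ 2); intros; apply rot_n1.
      * apply (cont_n1_lip _ 2); intros; apply rot_n1.
    + intros p. unfold rot. rewrite Rmult_0_r, cos_0, sin_0.
      apply R3_ext; coords; ring.
  - intros p. rewrite Rmult_1_r. assert (forall q, rot PI q = (- px q, py q, - pz q)) as E.
    { intros q; unfold rot. rewrite cos_PI, sin_PI. apply R3_ext; coords; ring. }
    split.
    + intros Kp. exists (- px p, py p, - pz p). split; auto. rewrite E.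
      apply R3_ext; coords; ring.
    + intros [q [Kq ->]]. rewrite E.
      replace (- px (- px q, py q, - pz q), py (- px q, py q, - pz q), - pz (- px q, py q, - pz q)) with q; auto.
      apply R3_ext; coords; ring.
Qed.

(** * Plats of braid words *)

(* A letter acts on four strands at heights 1, 2, 3, 4; [S13] performs its two
   crossings simultaneously.  Caps are drawn as wedges with tips at distance 1/2
   from the braid, so that a plat is the graph of four functions. *)
Inductive pos := p1 | p2 | p3 | p4.
Inductive letter := Id | S1 (b : bool) | S2 (b : bool) | S3 (b : bool) | S13 (b c : bool).

Definition pval (j : pos) : R := match j with p1 => 1 | p2 => 2 | p3 => 3 | p4 => 4 end.
(** The y-coordinate of the wedge tip of the cap over a position; caps join 1-2 and 3-4. *)
Definition pcen (j : pos) : R := match j with p1 | p2 => 3 / 2 | p3 | p4 => 7 / 2 end.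
Definition sg (b : bool) : R := if b then 1 else -1.

Definition tgt (L : letter) (j : pos) : pos :=
  match L, j with
  | S1 _, p1 | S13 _ _, p1 => p2
  | S1 _, p2 | S13 _ _, p2 => p1
  | S2 _, p2 => p3
  | S2 _, p3 => p2
  | S3 _, p3 | S13 _ _, p3 => p4
  | S3 _, p4 | S13 _ _, p4 => p3
  | _, _ => j
  end.

(** The sign convention is that of the polygonal model: [true] puts the upward strand at z = 1 in
    the middle of the crossing, over the other strand. *)
Definition zs (L : letter) (j : pos) : R :=
  match L, j with
  | S1 b, p1 | S13 b _, p1 => sg b
  | S1 b, p2 | S13 b _, p2 => - sg b
  | S2 b, p2 => sg b
  | S2 b, p3 => - sg b
  | S3 b, p3 | S13 _ b, p3 => sg b
  | S3 b, p4 | S13 _ b, p4 => - sg b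
  | _, _ => 0
  end.

Definition tent (x : R) : R := 1 - Rabs (2 * x - 1).
Definition ystep (L : letter) (j : pos) (x : R) : R := pval j + (pval (tgt L j) - pval j) * x.
Definition zstep (L : letter) (j : pos) (x : R) : R := zs L j * tent x.

Fixpoint ypath (w : list letter) (j : pos) (x : R) : R :=
  match w with
  | [] => pcen j + (pval j - pcen j) * (1 - 2 * x)
  | L :: w => if Rle_dec x 1 then ystep L j x else ypath w (tgt L j) (x - 1)
  end.

Fixpoint zpath (w : list letter) (j : pos) (x : R) : R :=
  match w with
  | [] => 0
  | L :: w => if Rle_dec x 1 then zstep L j x else zpath w (tgt L j) (x - 1)
  end.

Fixpoint perm (w : list letter) (j : pos) : pos :=
  match w with [] => j | L :: w => perm w (tgt L j) end.

Definition len (w : list letter) : R := INR (length w).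

Definition ystrand (w : list letter) (j : pos) (x : R) : R :=
  if Rle_dec x 0 then pcen j + (pval j - pcen j) * (1 + 2 * x) else ypath w j x.
Definition zstrand (w : list letter) (j : pos) (x : R) : R :=
  if Rle_dec x 0 then 0 else zpath w j x.

Definition plat (w : list letter) : R3 -> Prop :=
  graph (- / 2) (len w + / 2) (ystrand w) (zstrand w).

Lemma len_nil : len [] = 0.
Proof. reflexivity. Qed.
Lemma len_cons L w : len (L :: w) = len w + 1.
Proof. unfold len. cbn [length]. now rewrite S_INR. Qed.
Lemma len_app u v : len (u ++ v) = len u + len v.
Proof. unfold len. now rewrite length_app, plus_INR. Qed.
Lemma len_pos w : 0 <= len w.
Proof. apply pos_INR. Qed.

Lemma tgt_invol L j : tgt L (tgt L j) = j.
Proof. destruct L, j; reflexivity. Qed.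

Lemma perm_surj w j : exists i, perm w i = j.
Proof.
  revert j; induction w as [|L w IH]; intros j; simpl; [eauto|].
  destruct (IH j) as [i Hi]. exists (tgt L i). now rewrite tgt_invol.
Qed.

Lemma perm_app u v j : perm (u ++ v) j = perm v (perm u j).
Proof. revert j; induction u; simpl; auto. Qed.

Lemma tent_0 : tent 0 = 0.
Proof. unfold tent. rewrite Rabs_left1; lra. Qed.
Lemma tent_1 : tent 1 = 0.
Proof. unfold tent. rewrite Rabs_right; lra. Qed.

Lemma ypath_0 w j : ypath w j 0 = pval j.
Proof.
  destruct w; simpl; [ring|]. destruct (Rle_dec 0 1); [unfold ystep; ring | lra].
Qed.
Lemma zpath_0 w j : zpath w j 0 = 0.
Proof.
  destruct w; simpl; auto. destruct (Rle_dec 0 1); [|lra]. unfold zstep; rewrite tent_0; ring.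
Qed.

Lemma path_app_l u v j x : x <= len u -> 0 <= x ->
  ypath (u ++ v) j x = ypath u j x /\ zpath (u ++ v) j x = zpath u j x.
Proof.
  revert j x; induction u as [|L u IH]; intros j x Hx H0.
  - rewrite len_nil in Hx. replace x with 0 by lra. now rewrite !ypath_0, !zpath_0.
  - rewrite len_cons in Hx. simpl. destruct (Rle_dec x 1); auto. apply IH; lra.
Qed.

Lemma path_app_r u v j x : len u <= x ->
  ypath (u ++ v) j x = ypath v (perm u j) (x - len u) /\
  zpath (u ++ v) j x = zpath v (perm u j) (x - len u).
Proof.
  revert j x; induction u as [|L u IH]; intros j x Hx.
  - simpl. now rewrite len_nil, Rminus_0_r.
  - rewrite len_cons in *. simpl. destruct (Rle_dec x 1).
    + assert (len u = 0) as Z by (pose proof (len_pos u); lra).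
      assert (u = []) as -> by (destruct u; auto; rewrite len_cons in Z; pose proof (len_pos u); lra).
      rewrite Z. replace x with 1 by (pose proof (len_pos []); lra).
      replace (1 - (0 + 1)) with 0 by ring. simpl.
      rewrite ypath_0, zpath_0. unfold ystep, zstep. rewrite tent_1. split; ring.
    + destruct (IH (tgt L j) (x - 1)) as [-> ->]; [lra|].
      now replace (x - 1 - len u) with (x - (len u + 1)) by ring.
Qed.

Lemma path_end w j : ypath w j (len w) = pval (perm w j) /\ zpath w j (len w) = 0.
Proof.
  destruct (path_app_r w [] j (len w) (Rle_refl _)) as [H1 H2].
  rewrite app_nil_r, Rminus_diag, ?ypath_0, ?zpath_0 in *. auto.
Qed.

Lemma lip_glue a b c L f : a <= b <= c -> lip a b L f -> lip b c L f -> lip a c L f.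
Proof.
  intros Hb H1 H2.
  assert (forall x x', a <= x -> x <= x' -> x' <= c -> Rabs (f x - f x') <= L * Rabs (x - x')) as G.
  { intros x x' ? Hx ?. destruct (Rle_dec x' b), (Rle_dec b x).
    - apply H1; lra.
    - apply H1; lra.
    - apply H2; lra.
    - pose proof (H1 x b ltac:(lra) ltac:(lra)) as B1. pose proof (H2 b x' ltac:(lra) ltac:(lra)) as B2.
      pose proof (Rabs_tri3 (f x) (f b) (f x')). rewrite (Rabs_left1 (x - b)) in B1 by lra.
      rewrite (Rabs_left1 (b - x')) in B2 by lra.
      rewrite (Rabs_left1 (x - x')) by lra. lra. }
  intros x x' Hx Hx'. destruct (Rle_dec x x').
  - apply G; lra.
  - rewrite (Rabs_minus_sym (f x)), (Rabs_minus_sym x). apply G; lra.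
Qed.

Lemma lip_ext a b L f g : (forall x, a <= x <= b -> f x = g x) -> lip a b L f -> lip a b L g.
Proof. intros E H x x' Hx Hx'. rewrite <- !E by auto. apply H; auto. Qed.

Lemma lip_affine a b L m c f : Rabs m <= L -> (forall x, f x = c + m * x) -> lip a b L f.
Proof.
  intros Hm E x x' _ _. rewrite !E. replace (c + m * x - (c + m * x')) with (m * (x - x')) by ring.
  rewrite Rabs_mult. apply Rmult_le_compat_r; auto using Rabs_pos.
Qed.

Lemma lip_shift a b d L f : lip (a - d) (b - d) L f -> lip a b L (fun x => f (x - d)).
Proof.
  intros H x x' Hx Hx'. replace (x - x') with ((x - d) - (x' - d)) by ring. apply H; lra.
Qed.

Lemma tent_lip x x' : Rabs (tent x - tent x') <= 2 * Rabs (x - x').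
Proof.
  unfold tent. replace (1 - Rabs (2 * x - 1) - (1 - Rabs (2 * x' - 1))) with (Rabs (2 * x' - 1) - Rabs (2 * x - 1)) by ring.
  eapply Rle_trans; [apply Rabs_triang_inv2|].
  replace (2 * x' - 1 - (2 * x - 1)) with (2 * (x' - x)) by ring.
  rewrite Rabs_mult, (Rabs_right 2), Rabs_minus_sym by lra. lra.
Qed.

Lemma zs_bound L j : Rabs (zs L j) <= 1.
Proof. destruct L, j; simpl; apply Rabs_le; try destruct b; try destruct c; simpl; lra. Qed.

Lemma path_lip w j : lip 0 (len w + / 2) 2 (ypath w j) /\ lip 0 (len w + / 2) 2 (zpath w j).
Proof.
  revert j; induction w as [|L w IH]; intros j.
  - split; simpl.
    + apply (lip_affine _ _ _ (- 2 * (pval j - pcen j)) (pval j)); [|intros; ring].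
      apply Rabs_le; destruct j; simpl; lra.
    + apply (lip_affine _ _ _ 0 0); [rewrite Rabs_R0; lra | intros; ring].
  - rewrite len_cons. pose proof (len_pos w). destruct (IH (tgt L j)) as [IY IZ]. split.
    + apply lip_glue with 1; [lra| |].
      * apply (lip_ext _ _ _ (ystep L j)); [intros x Hx; simpl; destruct (Rle_dec x 1); lra|].
        apply (lip_affine _ _ _ (pval (tgt L j) - pval j) (pval j)); [|intros; unfold ystep; ring].
        apply Rabs_le; destruct L, j; simpl; lra.
      * apply (lip_ext _ _ _ (fun x => ypath w (tgt L j) (x - 1))).
        { intros x Hx; simpl; destruct (Rle_dec x 1); auto. replace x with 1 by lra.
          rewrite Rminus_diag, ypath_0. unfold ystep; ring. }
        apply lip_shift. apply (lip_restrict 0 (len w + / 2)); auto; lra.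
    + apply lip_glue with 1; [lra| |].
      * apply (lip_ext _ _ _ (zstep L j)); [intros x Hx; simpl; destruct (Rle_dec x 1); lra|].
        intros x x' _ _. unfold zstep. rewrite <- Rmult_minus_distr_l, Rabs_mult.
        pose proof (zs_bound L j); pose proof (tent_lip x x'); pose proof (Rabs_pos (zs L j));
        pose proof (Rabs_pos (tent x - tent x')). nra.
      * apply (lip_ext _ _ _ (fun x => zpath w (tgt L j) (x - 1))).
        { intros x Hx; simpl; destruct (Rle_dec x 1); auto. replace x with 1 by lra.
          rewrite Rminus_diag, zpath_0. unfold zstep; rewrite tent_1; ring. }
        apply lip_shift. apply (lip_restrict 0 (len w + / 2)); auto; lra.
Qed.

Lemma strand_lip w j : lip (- / 2) (len w + / 2) 2 (ystrand w j) /\ lip (- / 2) (len w + / 2) 2 (zstrand w j).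
Proof.
  pose proof (len_pos w). destruct (path_lip w j) as [IY IZ]. split; apply lip_glue with 0; try lra.
  - apply (lip_ext _ _ _ (fun x => pcen j + (pval j - pcen j) * (1 + 2 * x))).
    { intros x Hx; unfold ystrand; destruct (Rle_dec x 0); lra. }
    apply (lip_affine _ _ _ (2 * (pval j - pcen j)) (pval j)); [|intros; ring].
    apply Rabs_le; destruct j; simpl; lra.
  - apply (lip_ext _ _ _ (ypath w j)); auto.
    intros x Hx; unfold ystrand; destruct (Rle_dec x 0); auto.
    replace x with 0 by lra; rewrite ypath_0; ring.
  - apply (lip_ext _ _ _ (fun _ => 0)); [intros x Hx; unfold zstrand; destruct (Rle_dec x 0); lra|].
    apply (lip_affine _ _ _ 0 0); [rewrite Rabs_R0; lra | intros; ring].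
  - apply (lip_ext _ _ _ (zpath w j)); auto.
    intros x Hx; unfold zstrand; destruct (Rle_dec x 0); auto.
    replace x with 0 by lra; now rewrite zpath_0.
Qed.

Definition left_part (u : list letter) : R3 -> Prop := graph (- / 2) (len u) (ystrand u) (zstrand u).
Definition right_part (x0 : R) (v : list letter) : R3 -> Prop :=
  graph x0 (x0 + len v + / 2) (fun j x => ypath v j (x - x0)) (fun j x => zpath v j (x - x0)).
Definition slab (x0 : R) (r : list letter) : R3 -> Prop :=
  graph x0 (x0 + len r) (fun j x => ypath r j (x - x0)) (fun j x => zpath r j (x - x0)).

Lemma strand_app_l u v j x : x <= len u ->
  ystrand (u ++ v) j x = ystrand u j x /\ zstrand (u ++ v) j x = zstrand u j x.
Proof.
  intros Hx. unfold ystrand, zstrand. destruct (Rle_dec x 0); auto. apply path_app_l; lra.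
Qed.

Lemma strand_pos w j x : 0 <= x -> ystrand w j x = ypath w j x /\ zstrand w j x = zpath w j x.
Proof.
  intros Hx. unfold ystrand, zstrand. destruct (Rle_dec x 0); auto.
  replace x with 0 by lra. rewrite ypath_0, zpath_0. split; ring.
Qed.

(** Right of the cut the strands are renamed by their positions at the cut. Since [perm u] is onto,
    the underlying sets agree. *)
Lemma plat_app u v p : plat (u ++ v) p <-> left_part u p \/ right_part (len u) v p.
Proof.
  pose proof (len_pos u); pose proof (len_pos v).
  unfold plat, left_part, right_part, graph. rewrite len_app. split.
  - intros [j [x [Hx ->]]]. destruct (Rle_dec x (len u)) as [L|G].
    + left. exists j, x. destruct (strand_app_l u v j x L) as [-> ->]. split; auto; lra.
    + right. exists (perm u j), x. split; [lra|].
      destruct (strand_pos (u ++ v) j x ltac:(lra)) as [-> ->].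
      destruct (path_app_r u v j x ltac:(lra)) as [-> ->]. auto.
  - intros [[j [x [Hx ->]]]|[j [x [Hx ->]]]].
    + exists j, x. destruct (strand_app_l u v j x ltac:(lra)) as [-> ->]. split; auto; lra.
    + destruct (perm_surj u j) as [i <-]. exists i, x. split; [lra|].
      destruct (strand_pos (u ++ v) i x ltac:(lra)) as [-> ->].
      destruct (path_app_r u v i x ltac:(lra)) as [-> ->]. auto.
Qed.

Lemma right_part_app x0 r v p :
  right_part x0 (r ++ v) p <-> slab x0 r p \/ right_part (x0 + len r) v p.
Proof.
  pose proof (len_pos r); pose proof (len_pos v).
  unfold right_part, slab, graph. rewrite len_app. split.
  - intros [j [x [Hx ->]]]. destruct (Rle_dec (x - x0) (len r)) as [L|G].
    + left. exists j, x. destruct (path_app_l r v j (x - x0) L ltac:(lra)) as [-> ->]. split; auto; lra.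
    + right. exists (perm r j), x. split; [lra|].
      destruct (path_app_r r v j (x - x0) ltac:(lra)) as [-> ->].
      now replace (x - x0 - len r) with (x - (x0 + len r)) by ring.
  - intros [[j [x [Hx ->]]]|[j [x [Hx ->]]]].
    + exists j, x. destruct (path_app_l r v j (x - x0) ltac:(lra) ltac:(lra)) as [-> ->]. split; auto; lra.
    + destruct (perm_surj r j) as [i <-]. exists i, x. split; [lra|].
      destruct (path_app_r r v i (x - x0) ltac:(lra)) as [-> ->].
      now replace (x - x0 - len r) with (x - (x0 + len r)) by ring.
Qed.

(* Strand i passes over strand j whenever they cross and [h j < h i]. *)
Fixpoint laid (r : list letter) (h : pos -> nat) : Prop :=
  match r with
  | [] => True
  | L :: r => (forall i j, tgt L i = j -> (h j < h i)%nat -> 2 <= zs L i - zs L j) /\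
              laid r (fun j => h (tgt L j))
  end.

Lemma step_apart L i j x : i <> j -> tgt L i <> j -> 0 <= x <= 1 ->
  1 <= Rabs (ystep L i x - ystep L j x).
Proof.
  intros N T Hx. unfold ystep.
  destruct L, i, j; simpl in *; try congruence;
    abs_lra.
Qed.

Lemma step_cross L i x : tgt L i <> i ->
  Rabs (ystep L i x - ystep L (tgt L i) x) = Rabs (2 * x - 1).
Proof.
  intros N. unfold ystep. rewrite tgt_invol.
  destruct L, i; simpl in *; try congruence;
    try (f_equal; lra); rewrite Rabs_minus_sym; f_equal; lra.
Qed.

Lemma pval_apart i j : i <> j -> 1 <= Rabs (pval i - pval j).
Proof.
  intros N. destruct i, j; simpl; try congruence;
    abs_lra.
Qed.

(** At a crossing the y-distance is |2x - 1| and the z-distance at least 2 (1 - |2x - 1|), so they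
    cannot both be small. Strands that do not cross in a letter stay at y-distance 1. *)
Lemma laid_separated r h i j x : laid r h -> (h j < h i)%nat -> 0 <= x <= len r ->
  / 3 <= Rabs (ypath r i x - ypath r j x) \/ / 3 <= zpath r i x - zpath r j x.
Proof.
  revert h i j x; induction r as [|L r IH]; intros h i j x Hl Hij Hx.
  - rewrite len_nil in Hx. replace x with 0 by lra. rewrite !ypath_0. left.
    pose proof (pval_apart i j ltac:(intros ->; lia)). lra.
  - rewrite len_cons in Hx. destruct Hl as [HL Hl]. simpl. destruct (Rle_dec x 1) as [X|X].
    + assert (i <> j) as N by (intros ->; lia).
      destruct (classic (tgt L i = j)) as [T|T].
      * specialize (HL i j T Hij). subst j. rewrite step_cross by auto.
        unfold zstep. rewrite <- Rmult_minus_distr_r. unfold tent.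
        destruct (Rle_dec (/ 3) (Rabs (2 * x - 1))); [now left|right]. nra.
      * left. pose proof (step_apart L i j x N T ltac:(lra)). lra.
    + apply (IH (fun k => h (tgt L k))); auto; [now rewrite !tgt_invol | lra].
Qed.

Lemma INR_gap n m : (n < m)%nat -> 1 <= INR m - INR n.
Proof. intros H. apply le_INR in H. rewrite S_INR in H. lra. Qed.

Definition pos_max (h : pos -> nat) : R := INR (h p1 + h p2 + h p3 + h p4).
Lemma pos_max_bound h j : Rabs (INR (h j)) <= pos_max h.
Proof. rewrite Rabs_right by (apply Rle_ge, pos_INR). apply le_INR. destruct j; lia. Qed.

(** Inside a plat both ends of the slab are attached to the rest, which forces [g = 0]; the order
    [h] of the incoming strands does all the work. *)
Lemma layered_relation u r r' v h :
  r <> [] -> length r = length r' -> (forall j, perm r j = perm r' j) ->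
  (forall i j, h i = h j -> i = j) -> laid r h -> laid r' h ->
  ambient_isotopic (plat (u ++ r ++ v)) (plat (u ++ r' ++ v)).
Proof.
  intros Nr Hlen Hperm Hinj L1 L2.
  assert (len r' = len r) as Hl by (unfold len; now rewrite Hlen).
  set (E := union (left_part u) (right_part (len u + len r) v)).
  assert (forall s, len s = len r -> forall p, union E (slab (len u) s) p <-> plat (u ++ s ++ v) p) as Q.
  { intros s Hs p. rewrite plat_app, right_part_app, Hs. unfold E, union. tauto. }
  apply (isotopic_iff _ _ _ _ (Q r eq_refl) (Q r' Hl)).
  assert (0 < len r) as Hr.
  { destruct r; [congruence|]. rewrite len_cons. pose proof (len_pos r); lra. }
  unfold slab. rewrite Hl.
  apply (layer_isotopic pos (len u) (len u + len r) E (fun _ => 0) (fun j => INR (h j)) 2 (/ 3) (pos_max h)); try lra.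
  - unfold pos_max; apply pos_INR.
  - intros; rewrite Rabs_R0; apply pos_INR.
  - intros; apply pos_max_bound.
  - intros i j N. destruct (Nat.lt_total (h i) (h j)) as [?|[?|?]]; [left|exfalso; auto|right]; now apply lt_INR.
  - intros i j Hij. apply INR_gap. now apply INR_lt.
  - auto.
  - intros i; apply lip_shift. apply (lip_restrict 0 (len r + / 2)); try lra. apply path_lip.
  - intros i; apply lip_shift. apply (lip_restrict 0 (len r + / 2)); try lra. apply path_lip.
  - intros i; apply lip_shift. apply (lip_restrict 0 (len r + / 2)); try lra. rewrite <- Hl; apply path_lip.
  - intros i; apply lip_shift. apply (lip_restrict 0 (len r + / 2)); try lra. rewrite <- Hl; apply path_lip.
  - intros i. rewrite Rminus_diag, zpath_0. replace (len u + len r - len u) with (len r) by ring.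
    split; auto. apply path_end.
  - intros i. rewrite Rminus_diag, zpath_0. replace (len u + len r - len u) with (len r) by ring.
    rewrite <- Hl. split; auto. apply path_end.
  - intros i j x Hij Hx. apply INR_lt in Hij.
    destruct (laid_separated r h i j (x - len u) L1 Hij ltac:(lra)); auto.
  - intros i j x Hij Hx. apply INR_lt in Hij.
    destruct (laid_separated r' h i j (x - len u) L2 Hij ltac:(lra)); auto.
  - intros i. replace (len u + len r - len u) with (len r) by ring.
    destruct (path_end r i) as [-> _]. rewrite <- Hl. destruct (path_end r' i) as [-> _]. now rewrite Hperm.
  - intros i j _. rewrite Rminus_diag, !ypath_0. ring.
  - intros p [[i [x [Hx ->]]]|[i [x [Hx ->]]]]; unfold px; cbn [fst snd].
    + left. split; [lra|]. intros j. rewrite Rminus_diag, !ypath_0. auto.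
    + right; lra.
Qed.

(** Nothing is attached to the left of the caps, so the tips may travel too, provided that tips with
    different displacements get different tip heights [g]. Strand j of the first word becomes strand
    [sigma j] of the second. *)
Lemma layered_cap_relation r r' v (sigma : pos -> pos) (g h : pos -> nat) :
  length r = length r' -> (forall j, sigma (sigma j) = j) ->
  (forall j, perm r j = perm r' (sigma j)) ->
  (forall i j, h i = h j -> i = j) -> laid r h -> laid r' (fun j => h (sigma j)) ->
  (forall i j, (h j < h i)%nat -> (g j <= g i)%nat) ->
  (forall i j, pcen i = pcen j -> g i = g j) ->
  (forall i j, g i = g j -> pcen (sigma i) - pcen i = pcen (sigma j) - pcen j) ->
  ambient_isotopic (plat (r ++ v)) (plat (r' ++ v)).
Proof.
  intros Hlen Hsig Hperm Hinj L1 L2 Hgh Hg Htip.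
  assert (len r' = len r) as Hl by (unfold len; now rewrite Hlen).
  pose proof (len_pos r) as Hr.
  set (E := right_part (len r) v).
  apply (isotopic_iff (union E (graph (- / 2) (len r) (ystrand r) (zstrand r))) _
    (union E (graph (- / 2) (len r) (fun j => ystrand r' (sigma j)) (fun j => zstrand r' (sigma j))))).
  { intros p. rewrite plat_app. unfold union, E, left_part. tauto. }
  { intros p. rewrite plat_app. unfold union, E, left_part. rewrite Hl.
    assert (graph (- / 2) (len r) (fun j => ystrand r' (sigma j)) (fun j => zstrand r' (sigma j)) p <->
      graph (- / 2) (len r) (ystrand r') (zstrand r') p) as ->; [|tauto].
    unfold graph. split; intros [j [x [Hx ->]]]; exists (sigma j), x; rewrite ?Hsig; auto. }
  apply (layer_isotopic pos (- / 2) (len r) E (fun j => INR (g j)) (fun j => INR (h j)) 2 (/ 3)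
           (pos_max h + pos_max g)); try lra.
  - pose proof (pos_INR (h p1 + h p2 + h p3 + h p4)); pose proof (pos_INR (g p1 + g p2 + g p3 + g p4));
    unfold pos_max; lra.
  - intros i. pose proof (pos_max_bound g i). pose proof (pos_INR (h p1 + h p2 + h p3 + h p4)). unfold pos_max in *; lra.
  - intros i. pose proof (pos_max_bound h i). pose proof (pos_INR (g p1 + g p2 + g p3 + g p4)). unfold pos_max in *; lra.
  - intros i j N. destruct (Nat.lt_total (h i) (h j)) as [?|[?|?]]; [left|exfalso; auto|right]; now apply lt_INR.
  - intros i j Hij. apply INR_gap. now apply INR_lt.
  - intros i j Hij. apply INR_lt in Hij. specialize (Hgh i j Hij).
    destruct (Nat.eq_dec (g i) (g j)) as [->|]; auto. right. apply INR_gap. lia.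
  - intros i; apply (lip_restrict (- / 2) (len r + / 2)); try lra. apply strand_lip.
  - intros i; apply (lip_restrict (- / 2) (len r + / 2)); try lra. apply strand_lip.
  - intros i; apply (lip_restrict (- / 2) (len r + / 2)); try lra. rewrite <- Hl; apply strand_lip.
  - intros i; apply (lip_restrict (- / 2) (len r + / 2)); try lra. rewrite <- Hl; apply strand_lip.
  - intros i. unfold zstrand at 1. destruct (Rle_dec (- / 2) 0); [|lra]. split; auto.
    destruct (strand_pos r i (len r) Hr) as [_ ->]. apply path_end.
  - intros i. unfold zstrand at 1. destruct (Rle_dec (- / 2) 0); [|lra]. split; auto.
    rewrite <- Hl. destruct (strand_pos r' (sigma i) (len r') ltac:(lra)) as [_ ->]. apply path_end.
  - intros i j x Hij Hx. apply INR_lt in Hij. unfold ystrand, zstrand.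
    destruct (Rle_dec x 0).
    + assert (i <> j) as N by (intros ->; lia).
      destruct (classic (pcen i = pcen j)) as [Ec|Nc].
      * right; right. rewrite (Hg i j Ec). split; auto.
        destruct i, j; simpl in *; try congruence; try lra;
          abs_lra.
      * left. destruct i, j; simpl in *; try congruence;
          abs_lra.
    + destruct (laid_separated r h i j x L1 Hij ltac:(lra)); auto.
  - intros i j x Hij Hx. apply INR_lt in Hij. unfold ystrand, zstrand.
    destruct (Rle_dec x 0).
    + assert (sigma i <> sigma j) as N.
      { intros Es. apply (f_equal sigma) in Es. rewrite !Hsig in Es. subst. lia. }
      destruct (classic (pcen (sigma i) = pcen (sigma j))) as [Ec|Nc].
      * right; right. split.
        (* Strands under one cap after [sigma] have equal [g]: otherwise they came from different
           caps, and the partner [k] of [i], which is carried along with [i], would be a third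
           strand under the same cap. *)
        -- assert (pcen i = pcen j -> g i = g j) as H1 by apply Hg.
           destruct (Nat.eq_dec (g i) (g j)) as [->|Ng]; auto. exfalso.
           assert (pcen i <> pcen j) as Nc by auto.
           assert (exists k, k <> i /\ pcen k = pcen i) as [k [Nk Ek]]
             by (destruct i; [exists p2|exists p1|exists p4|exists p3]; simpl; split; congruence || lra).
           pose proof (Htip k i (Hg k i Ek)) as Tk.
           assert (pcen (sigma k) = pcen (sigma i)) as Es by lra.
           assert (sigma k <> sigma i) as Ns.
           { intros Es'. apply (f_equal sigma) in Es'. rewrite !Hsig in Es'. auto. }
           assert (sigma k <> sigma j) as Ns'.
           { intros Es'. apply (f_equal sigma) in Es'. rewrite !Hsig in Es'. subst. auto. }
           rewrite Ec in Es. destruct (sigma i), (sigma j), (sigma k); simpl in *; try congruence; lra.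
        -- destruct (sigma i), (sigma j); simpl in *; try congruence; try lra;
             abs_lra.
      * left. destruct (sigma i), (sigma j); simpl in *; try congruence; try lra;
          abs_lra.
    + destruct (laid_separated r' (fun j => h (sigma j)) (sigma i) (sigma j) x L2); auto; [|lra].
      now rewrite !Hsig.
  - intros i. rewrite <- Hl at 2. destruct (strand_pos r i (len r) Hr) as [-> _].
    destruct (strand_pos r' (sigma i) (len r') ltac:(lra)) as [-> _].
    destruct (path_end r i) as [-> _]. destruct (path_end r' (sigma i)) as [-> _]. now rewrite Hperm.
  - intros i j Hij. apply INR_eq in Hij. specialize (Htip i j Hij).
    unfold ystrand. destruct (Rle_dec (- / 2) 0); [|lra].
    replace (1 + 2 * - / 2) with 0 by field. lra.
  - intros p [i [x [Hx ->]]]. right. unfold px; cbn [fst snd]. lra.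
Qed.

(** * Moves at the left caps *)

Ltac split_min_max := unfold Rmin, Rmax in *;
  repeat match goal with
  | |- context [Rle_dec ?a ?b] => destruct (Rle_dec a b)
  | H : context [Rle_dec ?a ?b] |- _ => destruct (Rle_dec a b)
  end; try lra.

Lemma lip_continuity f L : (forall x y, Rabs (f x - f y) <= L * Rabs (x - y)) -> continuity f.
Proof.
  intros H x eps He. assert (0 <= Rabs L) by apply Rabs_pos.
  exists (eps / (Rabs L + 1)). split; [apply Rdiv_lt_0_compat; lra|].
  intros y [_ Hy]. simpl in *; unfold Rdist in *. specialize (H y x).
  apply (Rmult_lt_compat_l (Rabs L + 1)) in Hy; [|lra].
  replace ((Rabs L + 1) * (eps / (Rabs L + 1))) with eps in Hy by (field; lra).
  pose proof (Rle_abs L). pose proof (Rabs_pos (y - x)). nra.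
Qed.

Lemma lip_min a b L f g : lip a b L f -> lip a b L g -> lip a b L (fun x => Rmin (f x) (g x)).
Proof.
  intros F G x x' Hx Hx'. specialize (F x x' Hx Hx'). specialize (G x x' Hx Hx').
  apply Rabs_le. apply Rabs_le_inv in F, G. unfold Rmin. destruct (Rle_dec (f x) (g x)), (Rle_dec (f x') (g x')); lra.
Qed.

Lemma lip_max a b L f g : lip a b L f -> lip a b L g -> lip a b L (fun x => Rmax (f x) (g x)).
Proof.
  intros F G x x' Hx Hx'. specialize (F x x' Hx Hx'). specialize (G x x' Hx Hx').
  apply Rabs_le. apply Rabs_le_inv in F, G. unfold Rmax. destruct (Rle_dec (f x) (g x)), (Rle_dec (f x') (g x')); lra.
Qed.

Lemma lip_plus a b L L' f g : lip a b L f -> lip a b L' g -> lip a b (L + L') (fun x => f x + g x).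
Proof.
  intros F G x x' Hx Hx'. specialize (F x x' Hx Hx'). specialize (G x x' Hx Hx').
  replace (f x + g x - (f x' + g x')) with ((f x - f x') + (g x - g x')) by ring.
  eapply Rle_trans; [apply Rabs_triang|]. lra.
Qed.

Lemma lip_scal a b L m f : lip a b L f -> Rabs m <= 1 -> lip a b L (fun x => m * f x).
Proof.
  intros F Hm x x' Hx Hx'. specialize (F x x' Hx Hx').
  rewrite <- Rmult_minus_distr_l, Rabs_mult. pose proof (Rabs_pos m). pose proof (Rabs_pos (f x - f x')). nra.
Qed.

(** The caps, of length 1/2, are stretched to length 3/2 while the rest is shifted by 1. The long
    wedges are then bent into short wedges followed by a trivial letter. *)
Lemma Id_cap v : ambient_isotopic (plat v) (plat (Id :: v)).
Proof.
  set (psi := fun x => x + Rmax 0 (Rmin 1 (2 * x + 1))).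
  set (Y := fun j x => pcen j + (pval j - pcen j) * ((2 * x + 1) / 3)).
  pose proof (len_pos v) as Hv.
  apply (isotopic_trans _ (union (right_part 1 v) (graph (- / 2) 1 Y (fun _ _ => 0)))).
  - apply (isotopic_iff (plat v) _ (fun p => exists q, plat v q /\ p = (psi (px q), py q, pz q))).
    + reflexivity.
    + intros p. unfold union, right_part, graph. split.
      * intros [q [[j [x [Hx ->]]] ->]]. coords.
        destruct (Rle_dec x 0) as [L|G].
        -- right. exists j, (psi x).
           assert (psi x = 3 * x + 1) as -> by (unfold psi; split_min_max).
           split; [lra|]. unfold ystrand, zstrand, Y. destruct (Rle_dec x 0); [|lra].
           f_equal. f_equal. field.
        -- left. exists j, (psi x).
           assert (psi x = x + 1) as -> by (unfold psi; split_min_max).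
           split; [lra|]. replace (x + 1 - 1) with x by ring.
           destruct (strand_pos v j x ltac:(lra)) as [-> ->]. auto.
      * intros [[j [x [Hx ->]]]|[j [x [Hx ->]]]].
        -- exists (x - 1, ypath v j (x - 1), zpath v j (x - 1)). coords.
           assert (psi (x - 1) = x) as -> by (unfold psi; split_min_max).
           split; auto. exists j, (x - 1). split; [lra|].
           destruct (strand_pos v j (x - 1) ltac:(lra)) as [-> ->]. auto.
        -- exists ((x - 1) / 3, Y j x, 0). coords.
           assert (psi ((x - 1) / 3) = x) as ->
             by (unfold psi; split_min_max).
           split; auto. exists j, ((x - 1) / 3). split; [lra|].
           unfold ystrand, zstrand, Y. destruct (Rle_dec ((x - 1) / 3) 0); [|lra].
           f_equal. f_equal. field.
    + apply (x_reparam_isotopic psi 1).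
      * intros x y H. unfold psi; split_min_max.
      * apply (lip_continuity _ 3). intros x y. apply Rabs_le.
        pose proof (Rle_abs (x - y)). pose proof (Rle_abs (- (x - y))). rewrite Rabs_Ropp in *.
        unfold psi; split_min_max.
      * intros x. apply Rabs_le. unfold psi; split_min_max.
  - apply (isotopic_iff (union (right_part 1 v) (graph (- / 2) 1 Y (fun _ _ => 0))) _
      (union (right_part 1 v) (graph (- / 2) 1 (ystrand [Id]) (zstrand [Id])))).
    { reflexivity. }
    { intros p. change (Id :: v) with ([Id] ++ v). rewrite plat_app. unfold union, left_part.
      replace (len [Id]) with 1 by (unfold len; simpl; ring). tauto. }
    apply (level_isotopic _ _ _ _ _ _ _ 2 2); try lra.
    + intros j. apply (lip_affine _ _ _ (2 / 3 * (pval j - pcen j)) (pcen j + (pval j - pcen j) / 3)).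
      * apply Rabs_le; destruct j; simpl; lra.
      * intros x; unfold Y; field.
    + intros j. apply (lip_affine _ _ _ 0 0); [rewrite Rabs_R0; lra | intros; ring].
    + intros j. pose proof (strand_lip [Id] j) as [H _]. apply (lip_restrict (- / 2) (len [Id] + / 2)); auto; try lra.
      unfold len; simpl; lra.
    + intros j. pose proof (strand_lip [Id] j) as [_ H]. apply (lip_restrict (- / 2) (len [Id] + / 2)); auto; try lra.
      unfold len; simpl; lra.
    + intros r i j x Hr Hx.
      assert (forall k, zstrand [Id] k x = 0) as Ez.
      { intros k; unfold zstrand; destruct (Rle_dec x 0); auto. simpl. destruct (Rle_dec x 1); auto.
        unfold zstep; simpl; ring. }
      (* Both pictures are wedges, opened by the factors [(2 * x + 1) / 3] and [e]. Since [e] is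
         between the first factor and three times it, displacement and distance remain comparable up
         to the tip. *)
      assert (exists e, (2 * x + 1) / 3 <= e <= 2 * x + 1 /\ e <= 1 /\
        forall k, ystrand [Id] k x = pcen k + (pval k - pcen k) * e) as [e [He [He' Ey]]].
      { destruct (Rle_dec x 0).
        - exists (2 * x + 1). repeat split; try lra. intros k. unfold ystrand. destruct (Rle_dec x 0); [ring|lra].
        - exists 1. repeat split; try lra. intros k. unfold ystrand. destruct (Rle_dec x 0); [lra|].
          simpl. destruct (Rle_dec x 1); [|lra]. unfold ystep; simpl; ring. }
      rewrite !Ez, !Ey. unfold mix, Y. set (a := (2 * x + 1) / 3) in *.
      replace (0 - 0 - (0 - 0)) with 0 by ring. rewrite Rabs_R0.
      replace ((1 - r) * 0 + r * 0 - ((1 - r) * 0 + r * 0)) with 0 by ring. rewrite Rabs_R0.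
      assert (0 <= a) by (unfold a; lra). assert (e <= 3 * a) by (unfold a; lra).
      set (m := (1 - r) * a + r * e).
      assert (a <= m <= e) by (unfold m; nra).
      assert (forall k, (1 - r) * (pcen k + (pval k - pcen k) * a) + r * (pcen k + (pval k - pcen k) * e)
         = pcen k + (pval k - pcen k) * m) as Em by (intros; unfold m; ring).
      rewrite !Em. destruct i, j; simpl;
        match goal with |- Rabs ?u + 0 <= 2 * (Rabs ?v + 0) =>
          unfold Rabs; destruct (Rcase_abs u), (Rcase_abs v); lra end.
    + intros p [j [x [Hx ->]]]. right. unfold px; cbn [fst snd]. split; [lra|].
      intros k. unfold Y, ystrand, zstrand. destruct (Rle_dec 1 0); [lra|]. simpl.
      destruct (Rle_dec 1 1); [|lra]. unfold ystep, zstep; simpl. split; field.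
Qed.

(** Half-widths of a finger rooted at x = 3, with tip at -1/2 for [rho] and at 5/2 for [rho']. The
    slope 7 is the ratio of the lengths 7/2 and 1/2, so an affine change of abscissa fixing 3 turns
    one finger into the other. *)
Definition rho (x : R) : R := Rmin (x + / 2) (/ 2).
Definition rho' (x : R) : R := Rmin (7 * (x - 5 / 2)) (/ 2).

(** The finger keeps 3 <= y <= 4 and z = 0, and [O] avoids the swept region by at least 1/4 in y or
    z unless it lies beyond the roots. Displacements are at most 6/7 times 7/2, that is 3, against
    the clearance 1/4; hence the constant 12 below. *)
Lemma finger_slide (O : R3 -> Prop) :
  (forall p, O p -> 3 <= px p \/ / 4 <= Rabs (pz p) \/ py p <= 11 / 4 \/ 17 / 4 <= py p) ->
  ambient_isotopic (union O (graph (- / 2) 3 (fun b x => 7 / 2 + sg b * rho x) (fun _ _ => 0)))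
                   (union O (graph (5 / 2) 3 (fun b x => 7 / 2 + sg b * rho' x) (fun _ _ => 0))).
Proof.
  intros HO.
  set (T := (R3 + bool * R)%type).
  set (A := fun t : T => match t with inl p => O p | inr (_, x) => - / 2 <= x <= 3 end).
  set (theta := fun x => 3 - (3 - x) / 7).
  set (c := fun t : T => match t with inl p => p | inr (b, x) => (x, 7 / 2 + sg b * rho x, 0) end : R3).
  set (c' := fun t : T => match t with inl p => p | inr (b, x) => (theta x, 7 / 2 + sg b * rho x, 0) end : R3).
  apply (isotopic_iff (image A c) _ (image A c')).
  { intros p; split.
    - intros [[q|[b x]] [At ->]]; [left; exact At | right; exists b, x; auto].
    - intros [Op|[b [x [Hx ->]]]]; [exists (inl p); auto | exists (inr (b, x)); auto]. }
  { assert (forall x, rho' (theta x) = rho x) as Er.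
    { intros x; unfold rho', rho, theta. f_equal. field. }
    intros p; split.
    - intros [[q|[b x]] [At ->]]; [left; exact At|right]. simpl in At. exists b, (theta x).
      rewrite Er. split; auto. unfold theta; lra.
    - intros [Op|[b [x [Hx ->]]]]; [exists (inl p); auto|].
      assert (theta (3 - 7 * (3 - x)) = x) as Et by (unfold theta; field).
      exists (inr (b, 3 - 7 * (3 - x))). split; [simpl; lra|]. unfold c'. now rewrite <- Er, Et. }
  assert (forall r b x q, 0 <= r <= 1 -> - / 2 <= x <= 3 -> O q ->
    n1 (vsub (theta x, 7 / 2 + sg b * rho x, 0) (x, 7 / 2 + sg b * rho x, 0)) (vsub q q) <=
    12 * n1 (vmove r (x, 7 / 2 + sg b * rho x, 0) (theta x, 7 / 2 + sg b * rho x, 0)) (vmove r q q)) as G.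
  { intros r b x q Hr Hx Oq. destruct q as [[qx qy] qz].
    assert (3 <= 7 / 2 + sg b * rho x <= 4) as Hy.
    { unfold rho, Rmin. destruct b, (Rle_dec (x + / 2) (/ 2)); simpl; lra. }
    set (y := 7 / 2 + sg b * rho x) in *. apply HO in Oq.
    unfold n1, vsub, vmove, px, py, pz in *; cbn [fst snd] in *.
    replace (theta x - x - (qx - qx)) with (6 / 7 * (3 - x)) by (unfold theta; field).
    replace (y - y - (qy - qy)) with 0 by ring. replace (0 - 0 - (qz - qz)) with 0 by ring.
    rewrite Rabs_R0, (Rabs_right (6 / 7 * (3 - x))) by lra.
    replace ((1 - r) * x + r * theta x - ((1 - r) * qx + r * qx))
      with ((3 - qx) - (1 - 6 / 7 * r) * (3 - x)) by (unfold theta; field).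
    replace ((1 - r) * y + r * y - ((1 - r) * qy + r * qy)) with (y - qy) by ring.
    replace ((1 - r) * 0 + r * 0 - ((1 - r) * qz + r * qz)) with (- qz) by ring. rewrite Rabs_Ropp.
    set (u := 3 - qx - (1 - 6 / 7 * r) * (3 - x)).
    pose proof (Rabs_pos u); pose proof (Rabs_pos (y - qy)); pose proof (Rabs_pos qz).
    pose proof (Rle_abs (y - qy)); pose proof (Rle_abs (- (y - qy))). rewrite Rabs_Ropp in *.
    destruct Oq as [?|[?|[?|?]]]; try lra.
    pose proof (Rle_abs (- u)). rewrite Rabs_Ropp in *.
    assert (/ 7 * (3 - x) <= (1 - 6 / 7 * r) * (3 - x)) by (apply Rmult_le_compat_r; lra).
    unfold u in *; lra. }
  apply (straight_move_isotopic A c c' 12).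
  intros r [p|[i x]] [q|[j x']] Hr As At; cbn [A c c'] in *.
  - replace (vsub p p) with (vsub q q) by (apply R3_ext; unfold vsub, px, py, pz; simpl; ring).
    rewrite n1_refl. pose proof (n1_nonneg (vmove r p p) (vmove r q q)); lra.
  - rewrite (n1_sym (vsub p p)), (n1_sym (vmove r p p)). apply G; auto.
  - apply G; auto.
  - set (y := 7 / 2 + sg i * rho x); set (y' := 7 / 2 + sg j * rho x').
    unfold n1, vsub, vmove, px, py, pz; cbn [fst snd].
    replace (theta x - x - (theta x' - x')) with (6 / 7 * (x' - x)) by (unfold theta; field).
    replace ((1 - r) * x + r * theta x - ((1 - r) * x' + r * theta x'))
      with ((1 - 6 / 7 * r) * (x - x')) by (unfold theta; field).
    rewrite !Rminus_diag, Rabs_R0, !Rabs_mult, (Rabs_right (6 / 7)), (Rabs_right (1 - 6 / 7 * r)), (Rabs_minus_sym x') by lra.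
    pose proof (Rabs_pos (x - x')).
    pose proof (Rabs_pos ((1 - r) * y + r * y - ((1 - r) * y' + r * y'))).
    pose proof (Rabs_pos ((1 - r) * 0 + r * 0 - ((1 - r) * 0 + r * 0))).
    assert (/ 7 * Rabs (x - x') <= (1 - 6 / 7 * r) * Rabs (x - x')) by (apply Rmult_le_compat_r; lra). lra.
Qed.

(** With [S13] split this is s2 s1 s3^-1 s2^-1, the element called [fy] later. *)
Definition passing : list letter := [S2 true; S13 true false; S2 false].

(** The legs of the second arc are at z = [zeta] and z = - [zeta] while its midline [ctr] descends
    across the first arc, which is straight at y = 7/2; both functions have settled at x = 5/2. The
    midline starts at 11/2 because the heights interleave the two arcs, so all strands have the same
    [g] and every tip must be displaced by the same amount, here 2. *)
Definition zeta (x : R) : R := Rmin (x + / 2) (Rmax (5 / 2 - x) 0).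
Definition ctr (x : R) : R := Rmax (3 / 2) (11 / 2 - 4 / 3 * (x + / 2)).

(* The first arc passes between the two legs of the second one.  Once the first
   arc is straight, its tip is slid past the crossings, the second arc is
   straightened in the freed region, and the tip is slid back. *)
Lemma passing_cap v : ambient_isotopic (plat (passing ++ v)) (plat ([Id; Id; Id] ++ v)).
Proof.
  pose proof (len_pos v) as Hv.
  assert (len passing = 3) as L3 by (unfold len; simpl; ring).
  assert (len [Id; Id; Id] = 3) as L3' by (unfold len; simpl; ring).
  set (E := right_part 3 v).
  set (FY := fun b x => 7 / 2 + sg b * rho x). set (FY' := fun b x => 7 / 2 + sg b * rho' x).
  set (AY := fun b x => ctr x + sg b * rho x). set (AZ := fun b x => sg b * zeta x).
  set (BY := fun b x => 3 / 2 + sg b * rho x). set (ZZ := fun (_ : bool) (_ : R) => 0).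
  set (Y1 := fun j x => match j with p1 => FY false x | p2 => FY true x | p3 => AY false x | p4 => AY true x end).
  set (Z1 := fun j x => match j with p1 | p2 => 0 | p3 => AZ false x | p4 => AZ true x end).
  assert (forall a b, lip a b 1 rho) as Lr.
  { intros a b. apply lip_min; [apply (lip_affine _ _ _ 1 (/ 2)) | apply (lip_affine _ _ _ 0 (/ 2))];
      try (intros; ring); rewrite ?Rabs_R0, ?Rabs_R1; lra. }
  assert (forall a b, lip a b 1 zeta) as Lz.
  { intros a b. apply lip_min; [apply (lip_affine _ _ _ 1 (/ 2)) | apply lip_max;
      [apply (lip_affine _ _ _ (-1) (5 / 2)) | apply (lip_affine _ _ _ 0 0)]];
      try (intros; ring); try (apply Rabs_le; lra). }
  assert (forall a b, lip a b 2 ctr) as Lc.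
  { intros a b. apply lip_max; [apply (lip_affine _ _ _ 0 (3 / 2)) | apply (lip_affine _ _ _ (- 4 / 3) (11 / 2 - 4 / 3 * / 2))];
      try (intros; field); try (apply Rabs_le; lra). }
  assert (forall b, Rabs (sg b) <= 1) as Sg by (intros []; simpl; apply Rabs_le; lra).
  assert (forall a b s, lip a b 3 (FY s)) as LF.
  { intros a b s. replace 3 with (2 + 1) by ring. apply lip_plus; [apply (lip_affine _ _ _ 0 (7 / 2)); [rewrite Rabs_R0; lra | intros; ring]|].
    now apply lip_scal. }
  assert (forall a b s, lip a b 3 (BY s)) as LB.
  { intros a b s. replace 3 with (2 + 1) by ring. apply lip_plus; [apply (lip_affine _ _ _ 0 (3 / 2)); [rewrite Rabs_R0; lra | intros; ring]|].
    now apply lip_scal. }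
  assert (forall a b s, lip a b 3 (AY s)) as LA.
  { intros a b s. replace 3 with (2 + 1) by ring. apply lip_plus; auto. now apply lip_scal. }
  assert (forall a b s, lip a b 3 (AZ s)) as LAZ.
  { intros a b s. apply (lip_mono _ _ 1); [lra|]. now apply lip_scal. }
  assert (forall a b, lip a b 3 (fun _ => 0)) as L0.
  { intros a b. apply (lip_affine _ _ _ 0 0); [rewrite Rabs_R0; lra | intros; ring]. }
  apply (isotopic_trans _ (union E (graph (- / 2) 3 Y1 Z1))).
  { apply (isotopic_iff (union E (graph (- / 2) 3 (ystrand passing) (zstrand passing))) _ (union E (graph (- / 2) 3 Y1 Z1))).
    { intros p. rewrite plat_app. unfold union, E, left_part. rewrite L3. tauto. }
    { reflexivity. }
    (* The strands p1, p2 of the first arc lie between the legs p3 and p4 of the second one. *)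
    set (h := fun j => match j with p3 => 0 | p1 => 1 | p2 => 2 | p4 => 3 end%nat).
    assert (laid passing h) as Hl.
    { unfold passing; simpl. repeat split; intros i j Hij; destruct i; simpl in Hij; subst j; simpl; intros; try lia; lra. }
    apply (layer_isotopic pos (- / 2) 3 E (fun _ => 0) (fun j => INR (h j)) 3 (/ 4) 3); try lra.
    - intros; rewrite Rabs_R0; lra.
    - intros i; apply Rabs_le; destruct i; simpl; lra.
    - intros i j N. destruct (Nat.lt_total (h i) (h j)) as [?|[?|?]];
        [left; now apply lt_INR|exfalso; destruct i, j; simpl in *; congruence|right; now apply lt_INR].
    - intros i j Hij. apply INR_gap. now apply INR_lt.
    - auto.
    - intros i. apply (lip_mono _ _ 2); [lra|]. apply (lip_restrict (- / 2) (len passing + / 2)); try lra. apply strand_lip.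
    - intros i. apply (lip_mono _ _ 2); [lra|]. apply (lip_restrict (- / 2) (len passing + / 2)); try lra. apply strand_lip.
    - intros []; [apply LF | apply LF | apply LA | apply LA].
    - intros []; [apply L0 | apply L0 | apply LAZ | apply LAZ].
    - intros i. unfold zstrand at 1. destruct (Rle_dec (- / 2) 0); [|lra]. split; auto.
      destruct (strand_pos passing i 3 ltac:(lra)) as [_ ->]. rewrite <- L3. apply path_end.
    - assert (zeta (- / 2) = 0) as E1 by (unfold zeta, Rmin, Rmax; destruct (Rle_dec (5 / 2 - - / 2) 0), (Rle_dec _ _); lra).
      assert (zeta 3 = 0) as E2 by (unfold zeta, Rmin, Rmax; destruct (Rle_dec (5 / 2 - 3) 0), (Rle_dec _ _); lra).
      intros []; unfold Z1, AZ; rewrite ?E1, ?E2; split; ring.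
    - intros i j x Hij Hx. apply INR_lt in Hij. unfold ystrand, zstrand.
      destruct (Rle_dec x 0).
      + destruct (classic (pcen i = pcen j)) as [Ec|Nc].
        * right; right. split; auto. assert (i <> j) by (intros ->; lia).
          destruct i, j; simpl in *; try congruence; try lra;
            abs_lra.
        * left. destruct i, j; simpl in *; try congruence;
            abs_lra.
      + destruct (laid_separated passing h i j x Hl Hij ltac:(lra)); [left|right;left]; lra.
    - intros i j x Hij Hx. apply INR_lt in Hij.
      destruct i, j; simpl in Hij; try lia; unfold Y1, Z1, FY, AY, AZ, sg.
      + destruct (Rle_dec (/ 4) (zeta x)); [right; left; lra|left].
        unfold zeta, ctr, Rmin, Rmax in *.
        destruct (Rle_dec (5 / 2 - x) 0), (Rle_dec (x + / 2) _), (Rle_dec (3 / 2) _);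
          abs_lra.
      + right; right. split; auto. unfold rho, Rmin. destruct (Rle_dec _ _); rewrite Rabs_right by lra; lra.
      + destruct (Rle_dec (/ 4) (zeta x)); [right; left; lra|left].
        unfold zeta, ctr, rho, Rmin, Rmax in *.
        destruct (Rle_dec (5 / 2 - x) 0), (Rle_dec (x + / 2) (/ 2)), (Rle_dec (x + / 2) _), (Rle_dec (3 / 2) _);
          try lra; abs_lra.
      + destruct (Rle_dec (/ 4) (zeta x)); [right; left; lra|left].
        unfold zeta, ctr, rho, Rmin, Rmax in *.
        destruct (Rle_dec (5 / 2 - x) 0), (Rle_dec (x + / 2) (/ 2)), (Rle_dec (x + / 2) _), (Rle_dec (3 / 2) _);
          try lra; abs_lra.
      + destruct (Rle_dec (/ 4) (zeta x)); [right; left; lra|left].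
        unfold zeta, ctr, Rmin, Rmax in *.
        destruct (Rle_dec (5 / 2 - x) 0), (Rle_dec (x + / 2) _), (Rle_dec (3 / 2) _);
          abs_lra.
      + right; right. split; auto. unfold rho, Rmin. destruct (Rle_dec _ _); rewrite Rabs_right by lra; lra.
    - intros i. destruct (strand_pos passing i 3 ltac:(lra)) as [-> _]. rewrite <- L3 at 1.
      destruct (path_end passing i) as [-> _].
      unfold Y1, FY, AY, sg, ctr, rho, Rmin, Rmax.
      destruct i; simpl; destruct (Rle_dec (3 + / 2) (/ 2)); try lra; destruct (Rle_dec _ _); lra.
    - intros i j _. unfold ystrand. destruct (Rle_dec (- / 2) 0); [|lra].
      unfold Y1, FY, AY, sg, ctr, rho, Rmin, Rmax.
      destruct (Rle_dec (- / 2 + / 2) (/ 2)); [|lra]. destruct (Rle_dec _ _); [|lra].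
      destruct i, j; simpl; lra.
    - intros p [i [x [Hx ->]]]. right. unfold px; cbn [fst snd]. lra. }
  set (O1 := union E (graph (- / 2) 3 AY AZ)).
  set (O2 := union E (graph (- / 2) 3 BY ZZ)).
  apply (isotopic_trans _ (union O1 (graph (5 / 2) 3 FY' ZZ))).
  { apply (isotopic_iff (union O1 (graph (- / 2) 3 FY ZZ)) _ (union O1 (graph (5 / 2) 3 FY' ZZ))); [|reflexivity|].
    { intros p. unfold O1, union, graph. split.
      - intros [[?|[[] [x [Hx ->]]]]|[[] [x [Hx ->]]]]; auto; right;
          [exists p4 | exists p3 | exists p2 | exists p1]; exists x; auto.
      - intros [?|[[] [x [Hx ->]]]]; auto;
          [right; exists false|right; exists true|left; right; exists false|left; right; exists true]; exists x; auto. }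
    apply finger_slide. intros p [[i [x [Hx ->]]]|[b [x [Hx ->]]]]; coords; [left; lra|].
    destruct (Rle_dec (/ 4) (zeta x)) as [Hz|Hz].
    - right; left. unfold AZ. rewrite Rabs_mult. replace (Rabs (sg b)) with 1 by (destruct b; simpl; [rewrite Rabs_R1|rewrite Rabs_left1]; lra).
      rewrite Rabs_right; lra.
    - unfold AY. assert (0 <= rho x <= / 2) as Hr by (unfold rho, Rmin; destruct (Rle_dec _ _); lra).
      unfold zeta, ctr, Rmin, Rmax in *. right; right.
      destruct (Rle_dec (5 / 2 - x) 0), (Rle_dec (x + / 2) _), (Rle_dec (3 / 2) _), b; simpl; lra. }
  apply (isotopic_trans _ (union O2 (graph (5 / 2) 3 FY' ZZ))).
  { set (E' := union (union E (graph (5 / 2) 3 FY' ZZ)) (graph (5 / 2) 3 BY ZZ)).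
    assert (forall x, 5 / 2 <= x -> ctr x = 3 / 2 /\ zeta x = 0) as Late.
    { intros x Hx. unfold ctr, zeta, Rmin, Rmax.
      destruct (Rle_dec (5 / 2 - x) 0), (Rle_dec (3 / 2) _), (Rle_dec (x + / 2) _); split; lra. }
    assert (forall Y Z, (forall b x, 5 / 2 <= x -> Y b x = BY b x /\ Z b x = 0) -> forall p,
      union E' (graph (- / 2) (5 / 2) Y Z) p <-> union (union E (graph (- / 2) 3 Y Z)) (graph (5 / 2) 3 FY' ZZ) p) as Q.
    { intros Y Z HYZ p. unfold E', union. split.
      - intros [[[?|?]|[b [x [Hx ->]]]]|[b [x [Hx ->]]]]; auto; left; right; exists b, x; split; auto; try lra.
        destruct (HYZ b x ltac:(lra)) as [-> ->]. auto.
      - intros [[?|[b [x [Hx ->]]]]|?]; auto. destruct (Rle_dec x (5 / 2)).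
        + right. exists b, x. split; auto; lra.
        + left; right. exists b, x. split; [lra|]. destruct (HYZ b x ltac:(lra)) as [-> ->]. auto. }
    apply (isotopic_iff (union E' (graph (- / 2) (5 / 2) AY AZ)) _ (union E' (graph (- / 2) (5 / 2) BY ZZ))).
    { apply Q. intros b x Hx. destruct (Late x Hx) as [L1 L2]. unfold AY, BY, AZ. rewrite L1, L2. split; ring. }
    { apply Q. auto. }
    apply (level_isotopic _ _ _ _ _ _ _ 3 6); try lra; auto.
    - intros r i j x Hr Hx. unfold AY, BY, AZ, ZZ, mix.
      replace (3 / 2 + sg i * rho x - (ctr x + sg i * rho x) - (3 / 2 + sg j * rho x - (ctr x + sg j * rho x))) with 0 by ring.
      replace ((1 - r) * (ctr x + sg i * rho x) + r * (3 / 2 + sg i * rho x) -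
        ((1 - r) * (ctr x + sg j * rho x) + r * (3 / 2 + sg j * rho x))) with ((sg i - sg j) * rho x) by ring.
      replace (0 - sg i * zeta x - (0 - sg j * zeta x)) with ((sg i - sg j) * - zeta x) by ring.
      rewrite Rabs_R0, !Rabs_mult, Rabs_Ropp.
      set (w := Rabs ((1 - r) * (sg i * zeta x) + r * 0 - ((1 - r) * (sg j * zeta x) + r * 0))).
      assert (0 <= w) by apply Rabs_pos. pose proof (Rabs_pos (sg i - sg j)).
      assert (Rabs (zeta x) <= 6 * Rabs (rho x)).
      { unfold zeta, rho, Rmin, Rmax. destruct (Rle_dec (5 / 2 - x) 0), (Rle_dec (x + / 2) (/ 2)), (Rle_dec _ _);
          rewrite !Rabs_right; lra. }
      nra.
    - intros p H. right. destruct (Late (5 / 2) ltac:(lra)) as [L1 L2]. split.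
      + destruct H as [[[i [x [Hx ->]]]|[b [x [Hx ->]]]]|[b [x [Hx ->]]]]; unfold px; cbn [fst snd]; lra.
      + intros b. unfold AY, BY, AZ, ZZ. rewrite L1, L2. split; ring. }
  apply (isotopic_trans _ (union O2 (graph (- / 2) 3 FY ZZ))).
  { apply isotopic_sym, finger_slide. intros p [[i [x [Hx ->]]]|[b [x [Hx ->]]]]; coords; [left; lra|].
    right; right; left. unfold BY, rho, Rmin. destruct (Rle_dec _ _), b; simpl; lra. }
  apply (isotopic_iff (union O2 (graph (- / 2) 3 FY ZZ)) _ (union O2 (graph (- / 2) 3 FY ZZ))); [reflexivity| |apply isotopic_refl].
  assert (forall x, - / 2 <= x <= 3 -> forall j, ystrand [Id; Id; Id] j x = pcen j + 2 * (pval j - pcen j) * rho x /\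
    zstrand [Id; Id; Id] j x = 0) as S.
  { intros x Hx j. unfold ystrand, zstrand, rho, Rmin. destruct (Rle_dec x 0), (Rle_dec (x + / 2) (/ 2)); try (exfalso; lra).
    - split; auto; field.
    - simpl. unfold ystep, zstep; simpl.
      destruct (Rle_dec x 1); [|destruct (Rle_dec (x - 1) 1); [|destruct (Rle_dec (x - 1 - 1) 1); [|lra]]]; split; field. }
  intros p. rewrite plat_app, L3'. unfold O2, union, left_part. rewrite L3'. unfold graph. split.
  - intros [[?|[[] [x [Hx ->]]]]|[[] [x [Hx ->]]]]; auto; left;
      [exists p2|exists p1|exists p4|exists p3]; exists x; split; auto;
      match goal with |- _ = (_, ystrand _ ?j _, _) => destruct (S x Hx j) as [-> ->] end;
      unfold BY, FY, ZZ; simpl; f_equal; f_equal; field.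
  - intros [[j [x [Hx ->]]]|?]; auto. destruct (S x Hx j) as [-> ->].
    destruct j; [left;right;exists false|left;right;exists true|right;exists false|right;exists true];
      exists x; split; auto; unfold BY, FY, ZZ; simpl; f_equal; f_equal; field.
Qed.

(** * The twist knot as a plat *)

Lemma perm_rev w j : perm (rev w) (perm w j) = j.
Proof.
  revert j; induction w as [|L w IH]; intros j; simpl; auto.
  rewrite perm_app, IH. simpl. apply tgt_invol.
Qed.

Lemma zs_tgt L j : zs L (tgt L j) = - zs L j.
Proof. destruct L, j; simpl; ring. Qed.

Lemma tent_sym x : tent (1 - x) = tent x.
Proof.
  unfold tent. replace (2 * (1 - x) - 1) with (- (2 * x - 1)) by ring. now rewrite Rabs_Ropp.
Qed.

Lemma len_rev w : len (rev w) = len w.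
Proof. unfold len. now rewrite length_rev. Qed.

Lemma path_rev w j x : 0 <= x <= len w ->
  ypath (rev w) (perm w j) (len w - x) = ypath w j x /\
  zpath (rev w) (perm w j) (len w - x) = - zpath w j x.
Proof.
  revert j x; induction w as [|L w IH]; intros j x Hx.
  - rewrite len_nil in *. replace (0 - x) with 0 by lra. replace x with 0 by lra. simpl. split; ring.
  - rewrite len_cons in *. simpl. destruct (Rle_dec x 1) as [X|X].
    + destruct (path_app_r (rev w) [L] (perm w (tgt L j)) (len w + 1 - x)) as [-> ->];
        [rewrite len_rev; lra|].
      rewrite perm_rev, len_rev. replace (len w + 1 - x - len w) with (1 - x) by ring. simpl.
      destruct (Rle_dec (1 - x) 1); [|lra]. unfold ystep, zstep. rewrite tgt_invol, zs_tgt, tent_sym.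
      split; ring.
    + destruct (path_app_l (rev w) [L] (perm w (tgt L j)) (len w + 1 - x)) as [-> ->];
        [rewrite len_rev; lra | lra|].
      replace (len w + 1 - x) with (len w - (x - 1)) by ring. apply IH; lra.
Qed.

Lemma path_right_cap w j x : len w <= x ->
  ypath w j x = pcen (perm w j) + (pval (perm w j) - pcen (perm w j)) * (1 - 2 * (x - len w)) /\
  zpath w j x = 0.
Proof.
  intros Hx. destruct (path_app_r w [] j x Hx) as [H1 H2]. rewrite app_nil_r in *. now rewrite H1, H2.
Qed.

(** Turning the plat about the y-axis reads its word from the right. This exchanges both rising with
    falling and over with under, so each letter keeps its sign. *)
Lemma plat_rev w : ambient_isotopic (plat w) (plat (rev w)).
Proof.
  assert (forall u p, plat u p -> plat (rev u) (len u - px p, py p, - pz p)) as G.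
  { intros u p [j [x [Hx ->]]]. coords. pose proof (len_pos u).
    exists (perm u j), (len u - x). rewrite len_rev. split; [lra|].
    destruct (Rle_dec x 0) as [X|X].
    - destruct (strand_pos (rev u) (perm u j) (len u - x)) as [-> ->]; [lra|].
      destruct (path_right_cap (rev u) (perm u j) (len u - x)) as [-> ->]; [rewrite len_rev; lra|].
      rewrite perm_rev, len_rev. unfold ystrand, zstrand. destruct (Rle_dec x 0); [|lra].
      f_equal; [f_equal|]; ring.
    - destruct (strand_pos u j x ltac:(lra)) as [-> ->].
      destruct (Rle_dec x (len u)) as [X'|X'].
      + destruct (strand_pos (rev u) (perm u j) (len u - x)) as [-> ->]; [lra|].
        destruct (path_rev u j x ltac:(lra)) as [-> ->]. reflexivity.
      + destruct (path_right_cap u j x ltac:(lra)) as [-> ->].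
        unfold ystrand, zstrand. destruct (Rle_dec (len u - x) 0); [|lra].
        f_equal; [f_equal|]; ring. }
  apply (isotopic_trans _ (fun p => plat w (- px p, py p, - pz p))); [apply rot_isotopic|].
  refine (isotopic_iff _ _ _ _ _ _ (x_translate_isotopic (len w) (fun p => plat w (- px p, py p, - pz p)))); [reflexivity|].
  intros p; split.
  - intros [q [Hq ->]]. specialize (G w _ Hq).
    replace (px q + len w, py q, pz q)
      with (len w - px (- px q, py q, - pz q), py (- px q, py q, - pz q), - pz (- px q, py q, - pz q)); auto.
    coords; f_equal; [f_equal|]; ring.
  - intros Hp. specialize (G (rev w) p Hp). rewrite rev_involutive, len_rev in G.
    exists (px p - len w, py p, pz p). split.
    + unfold px, py, pz in *; cbn [fst snd] in *.
      replace (- (fst (fst p) - len w)) with (len w - fst (fst p)) by ring. exact G.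
    + apply R3_ext; coords; ring.
Qed.

Definition twist_word (m : nat) : list letter := repeat (S2 true) m ++ [S1 false; S2 true].

(** The distance to the nearest end of a cap. Pushing a vertical cap outwards by this amount
    produces the wedge used in [plat]. *)
Definition lcap (y : R) : R := Rmin (Rabs (y - 1)) (Rmin (Rabs (y - 2)) (Rmin (Rabs (y - 3)) (Rabs (y - 4)))).

Lemma lcap_lip y y' : Rabs (lcap y - lcap y') <= Rabs (y - y').
Proof.
  pose proof (Rabs_tri3 y y') as T. 
  assert (forall d, Rabs (Rabs (y - d) - Rabs (y' - d)) <= Rabs (y - y')) as G.
  { intros d. eapply Rle_trans; [apply Rabs_triang_inv2|]. right; f_equal; ring. }
  pose proof (G 1) as G1; pose proof (G 2) as G2; pose proof (G 3) as G3; pose proof (G 4) as G4.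
  apply Rabs_le_inv in G1, G2, G3, G4. unfold lcap. apply Rabs_le.
  generalize dependent (Rabs (y - 1)); generalize dependent (Rabs (y - 2));
  generalize dependent (Rabs (y - 3)); generalize dependent (Rabs (y - 4)).
  generalize (Rabs (y' - 1)), (Rabs (y' - 2)), (Rabs (y' - 3)), (Rabs (y' - 4)).
  intros. split_min_max.
Qed.

Lemma lcap_pval j y : lcap y <= Rabs (y - pval j).
Proof. destruct j; unfold lcap; simpl; split_min_max. Qed.

Definition caps_y (y : R) : Prop := 1 <= y <= 2 \/ 3 <= y <= 4.

Definition flat_plat (w : list letter) (p : R3) : Prop :=
  (px p = 0 /\ caps_y (py p) /\ pz p = 0) \/ (px p = len w /\ caps_y (py p) /\ pz p = 0) \/ slab 0 w p.

Lemma lcap_range y : caps_y y -> 0 <= lcap y <= / 2.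
Proof.
  intros [H|H]; unfold lcap; (split; [repeat apply Rmin_glb; apply Rabs_pos|]).
  - destruct (Rle_dec y (3 / 2)).
    + eapply Rle_trans; [apply Rmin_l|]. rewrite Rabs_right; lra.
    + eapply Rle_trans; [apply Rmin_r|]. eapply Rle_trans; [apply Rmin_l|]. rewrite Rabs_left1; lra.
  - eapply Rle_trans; [apply Rmin_r|]. eapply Rle_trans; [apply Rmin_r|]. destruct (Rle_dec y (7 / 2)).
    + eapply Rle_trans; [apply Rmin_l|]. rewrite Rabs_right; lra.
    + eapply Rle_trans; [apply Rmin_r|]. rewrite Rabs_left1; lra.
Qed.

Lemma cap_point j t : 0 <= t <= / 2 ->
  let y := pcen j + (pval j - pcen j) * (1 - 2 * t) in caps_y y /\ lcap y = t.
Proof.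
  intros Ht y. assert (caps_y y) as C by (unfold y; destruct j; simpl; [left|left|right|right]; lra).
  split; auto. apply Rle_antisym.
  - eapply Rle_trans; [apply (lcap_pval j)|]. unfold y.
    destruct j; simpl; abs_lra.
  - unfold lcap, y; destruct j; simpl; repeat apply Rmin_glb;
    abs_lra.
Qed.

Lemma cap_point_inv y : caps_y y -> exists j, y = pcen j + (pval j - pcen j) * (1 - 2 * lcap y).
Proof.
  assert (forall j t, 0 <= t <= / 2 -> y = pcen j + (pval j - pcen j) * (1 - 2 * t) ->
    exists j, y = pcen j + (pval j - pcen j) * (1 - 2 * lcap y)) as G.
  { intros j t Ht E. exists j. destruct (cap_point j t Ht) as [_ L]. rewrite <- E in L. now rewrite L. }
  intros [H|H]; [destruct (Rle_dec y (3 / 2)) | destruct (Rle_dec y (7 / 2))].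
  - apply (G p1 (y - 1)); simpl; lra.
  - apply (G p2 (2 - y)); simpl; lra.
  - apply (G p3 (y - 3)); simpl; lra.
  - apply (G p4 (4 - y)); simpl; lra.
Qed.

(** A point of a cap that is close to the braid is close to the end of a strand, where the outward
    push [lcap] vanishes; this bounds the displacement by the distance. Points of opposite caps are
    at distance at least 1 in x. *)
Lemma flat_plat_isotopic w : (0 < len w) -> ambient_isotopic (flat_plat w) (plat w).
Proof.
  intros Hw0. assert (1 <= len w) as Hw.
  { destruct w; [rewrite len_nil in Hw0; lra|]. rewrite len_cons; pose proof (len_pos w); lra. }
  set (T := (R3 + bool * R)%type).
  set (A := fun t : T => match t with inl p => slab 0 w p | inr (_, y) => caps_y y end).
  set (c := fun t : T => match t with inl p => p | inr (b, y) => (if b then len w else 0, y, 0) end : R3).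
  set (c' := fun t : T => match t with inl p => p
     | inr (b, y) => (if b then len w + lcap y else - lcap y, y, 0) end : R3).
  apply (isotopic_iff (image A c) _ (image A c')).
  { intros p. unfold flat_plat. split.
    - intros [[q|[[] y]] [At ->]]; simpl in At; unfold px, py, pz; cbn [c fst snd]; auto.
    - intros [[H1 [H2 H3]]|[[H1 [H2 H3]]|H]].
      + exists (inr (false, py p)). split; auto. now apply R3_ext.
      + exists (inr (true, py p)). split; auto. now apply R3_ext.
      + exists (inl p). auto. }
  { intros p. split.
    - intros [[q|[b y]] [At ->]]; simpl in At.
      + destruct At as [j [x [Hx ->]]]. exists j, x. destruct (strand_pos w j x ltac:(lra)) as [-> ->].
        rewrite Rminus_0_r. split; auto; lra.
      + pose proof (lcap_range y At). destruct (cap_point_inv y At) as [j Ej]. destruct b; cbn [c'].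
        * destruct (perm_surj w j) as [i <-]. exists i, (len w + lcap y). split; [lra|].
          destruct (strand_pos w i (len w + lcap y) ltac:(lra)) as [-> ->].
          destruct (path_right_cap w i (len w + lcap y) ltac:(lra)) as [-> ->].
          replace (len w + lcap y - len w) with (lcap y) by ring. now rewrite <- Ej.
        * exists j, (- lcap y). split; [lra|]. unfold ystrand, zstrand. destruct (Rle_dec (- lcap y) 0); [|lra].
          replace (1 + 2 * - lcap y) with (1 - 2 * lcap y) by ring. now rewrite <- Ej.
    - intros [j [x [Hx ->]]]. destruct (Rle_dec x 0) as [X|X]; [|destruct (Rle_dec x (len w)) as [X'|X']].
      + destruct (cap_point j (- x) ltac:(lra)) as [C1 C2]. cbv zeta in *.
        exists (inr (false, ystrand w j x)). unfold ystrand, zstrand. destruct (Rle_dec x 0); [|lra].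
        replace (1 + 2 * x) with (1 - 2 * - x) by ring. split; [exact C1|].
        cbn [c']. rewrite C2. f_equal; f_equal; ring.
      + destruct (strand_pos w j x ltac:(lra)) as [-> ->]. exists (inl (x, ypath w j x, zpath w j x)).
        split; auto. exists j, x. rewrite Rminus_0_r. split; auto; lra.
      + destruct (cap_point (perm w j) (x - len w) ltac:(lra)) as [C1 C2]. cbv zeta in *.
        destruct (strand_pos w j x ltac:(lra)) as [-> ->].
        destruct (path_right_cap w j x ltac:(lra)) as [-> ->].
        eexists (inr (true, _)). split; [exact C1|].
        cbn [c']. rewrite C2. f_equal; f_equal; ring. }
  assert (forall r b y q, 0 <= r <= 1 -> caps_y y -> slab 0 w q ->
    n1 (vsub (c' (inr (b, y))) (c (inr (b, y)))) (vsub q q) <=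
    3 * n1 (vmove r (c (inr (b, y))) (c' (inr (b, y)))) (vmove r q q)) as Gd.
  { intros r b y q Hr Hy [j [x [Hx ->]]]. rewrite Rminus_0_r. cbn [c c'].
    pose proof (lcap_range y Hy) as Lr.
    destruct (path_lip w j) as [LY _].
    set (y' := ypath w j x) in *.
    assert (lcap y <= 3 * Rabs (y - y') + 2 * (if b then len w - x else x)) as B.
    { destruct b.
      - pose proof (LY x (len w) ltac:(lra) ltac:(lra)) as B1. destruct (path_end w j) as [B2 _].
        rewrite B2 in B1. fold y' in B1. rewrite (Rabs_left1 (x - len w)) in B1 by lra.
        pose proof (lcap_pval (perm w j) y). pose proof (Rabs_tri3 y y' (pval (perm w j))).
        pose proof (Rabs_pos (y - y')). lra.
      - pose proof (LY x 0 ltac:(lra) ltac:(lra)) as B1. rewrite ypath_0 in B1.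
        fold y' in B1. rewrite (Rabs_right (x - 0)) in B1 by lra.
        pose proof (lcap_pval j y). pose proof (Rabs_tri3 y y' (pval j)).
        pose proof (Rabs_pos (y - y')). lra. }
    unfold n1, vsub, vmove, px, py, pz; cbn [fst snd].
    replace ((1 - r) * y + r * y - ((1 - r) * y' + r * y')) with (y - y') by ring.
    set (w3 := Rabs ((1 - r) * 0 + r * 0 - _)). assert (0 <= w3) by apply Rabs_pos.
    rewrite !Rminus_diag, Rabs_R0. pose proof (Rabs_pos (y - y')).
    destruct b.
    - replace (len w + lcap y - len w - 0) with (lcap y) by ring. rewrite (Rabs_right (lcap y)) by lra.
      set (u := (1 - r) * len w + r * (len w + lcap y) - _). pose proof (Rle_abs u).
      assert (len w - x <= u) by (unfold u; nra). lra.
    - replace (- lcap y - 0 - 0) with (- lcap y) by ring. rewrite Rabs_Ropp, (Rabs_right (lcap y)) by lra.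
      set (u := (1 - r) * 0 + r * - lcap y - _). pose proof (Rle_abs (- u)). rewrite Rabs_Ropp in *.
      assert (x <= - u) by (unfold u; nra). lra. }
  apply (straight_move_isotopic A c c' 3).
  intros r [p|[b y]] [q|[b' y']] Hr As At; simpl in As, At.
  - replace (vsub (c' (inl p)) (c (inl p))) with (vsub (c' (inl q)) (c (inl q)))
      by (apply R3_ext; unfold vsub, px, py, pz; simpl; ring).
    rewrite n1_refl. pose proof (n1_nonneg (vmove r (c (inl p)) (c' (inl p))) (vmove r (c (inl q)) (c' (inl q)))); lra.
  - rewrite (n1_sym (vsub (c' (inl p)) _)), (n1_sym (vmove r (c (inl p)) _)). apply Gd; auto.
  - apply Gd; auto.
  - pose proof (lcap_range y As); pose proof (lcap_range y' At). pose proof (lcap_lip y y') as Ll.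
    cbn [c c']. unfold n1, vsub, vmove, px, py, pz; cbn [fst snd].
    replace ((1 - r) * y + r * y - ((1 - r) * y' + r * y')) with (y - y') by ring.
    set (w3 := Rabs ((1 - r) * 0 + r * 0 - _)). assert (0 <= w3) by apply Rabs_pos.
    rewrite !Rminus_diag, Rabs_R0. pose proof (Rabs_pos (y - y')).
    match goal with |- Rabs ?d + 0 + 0 <= 3 * (Rabs ?u + _ + _) => pose proof (Rabs_pos u);
      assert (Rabs d <= Rabs (y - y') \/ (Rabs d <= 1 /\ 1 <= Rabs u)) end.
    { destruct b, b'.
      - left. replace (len w + lcap y - len w - (len w + lcap y' - len w)) with (lcap y - lcap y') by ring. auto.
      - right. split; [apply Rabs_le; lra|]. eapply Rle_trans; [|apply Rle_abs]. nra.
      - right. split; [apply Rabs_le; lra|]. rewrite Rabs_minus_sym. eapply Rle_trans; [|apply Rle_abs]. nra.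
      - left. replace (- lcap y - 0 - (- lcap y' - 0)) with (- (lcap y - lcap y')) by ring. rewrite Rabs_Ropp. auto. }
    lra.
Qed.

Lemma seg_iff x1 y1 z1 x2 y2 z2 p : seg (x1, y1, z1) (x2, y2, z2) p <->
  exists s, 0 <= s <= 1 /\ p = (x1 + s * (x2 - x1), y1 + s * (y2 - y1), z1 + s * (z2 - z1)).
Proof.
  unfold seg; split; intros [s [Hs ->]]; exists s; split; auto; f_equal; [f_equal| |f_equal|]; ring.
Qed.

Definition step_graph (x0 : R) (L : letter) (p : R3) : Prop :=
  exists j x, 0 <= x <= 1 /\ p = (x0 + x, ystep L j x, zstep L j x).

Lemma slab_one x0 L p : slab x0 [L] p <-> step_graph x0 L p.
Proof.
  assert (len [L] = 1) as E by (unfold len; simpl; ring).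
  unfold slab, step_graph, graph. rewrite E. simpl. split.
  - intros [j [x [Hx ->]]]. exists j, (x - x0). destruct (Rle_dec (x - x0) 1); [|lra].
    split; [lra|]. f_equal; f_equal; ring.
  - intros [j [x [Hx ->]]]. exists j, (x0 + x). replace (x0 + x - x0) with x by ring.
    destruct (Rle_dec x 1); [|lra]. split; auto; lra.
Qed.

Lemma slab_app x0 u v p : slab x0 (u ++ v) p <-> slab x0 u p \/ slab (x0 + len u) v p.
Proof.
  pose proof (len_pos u); pose proof (len_pos v).
  unfold slab, graph. rewrite len_app. split.
  - intros [j [x [Hx ->]]]. destruct (Rle_dec (x - x0) (len u)) as [L|G].
    + left. exists j, x. destruct (path_app_l u v j (x - x0) L ltac:(lra)) as [-> ->]. split; auto; lra.
    + right. exists (perm u j), x. split; [lra|].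
      destruct (path_app_r u v j (x - x0) ltac:(lra)) as [-> ->].
      now replace (x - x0 - len u) with (x - (x0 + len u)) by ring.
  - intros [[j [x [Hx ->]]]|[j [x [Hx ->]]]].
    + exists j, x. destruct (path_app_l u v j (x - x0) ltac:(lra) ltac:(lra)) as [-> ->]. split; auto; lra.
    + destruct (perm_surj u j) as [i <-]. exists i, x. split; [lra|].
      destruct (path_app_r u v i (x - x0) ltac:(lra)) as [-> ->].
      now replace (x - x0 - len u) with (x - (x0 + len u)) by ring.
Qed.

Lemma slab_letters x0 w p : w <> [] ->
  (slab x0 w p <-> exists k L, nth_error w k = Some L /\ step_graph (x0 + INR k) L p).
Proof.
  revert x0; induction w as [|L w IH]; intros x0 N; [congruence|].
  destruct w as [|L' w].
  - rewrite slab_one. split.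
    + intros S. exists 0%nat, L. simpl. rewrite Rplus_0_r. auto.
    + intros [[|k] [L0 [E S]]]; simpl in E; [|destruct k; discriminate].
      injection E as ->. simpl in S. now rewrite Rplus_0_r in S.
  - change (L :: L' :: w) with ([L] ++ (L' :: w)) at 1. rewrite slab_app, slab_one, IH by congruence.
    replace (len [L]) with 1 by (unfold len; simpl; ring). split.
    + intros [G|[k [L0 [E G]]]].
      * exists 0%nat, L. simpl. rewrite Rplus_0_r. auto.
      * exists (S k), L0. split; auto. rewrite S_INR.
        now replace (x0 + (INR k + 1)) with (x0 + 1 + INR k) by ring.
    + intros [[|k] [L0 [E S]]].
      * injection E as ->. simpl in S. rewrite Rplus_0_r in S. auto.
      * right. exists k, L0. split; auto. rewrite S_INR in S.
        now replace (x0 + 1 + INR k) with (x0 + (INR k + 1)) by ring.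
Qed.

Definition pnat (j : pos) : nat := match j with p1 => 1 | p2 => 2 | p3 => 3 | p4 => 4 end.
Definition gen_index (L : letter) : nat := match L with S1 _ => 1 | S2 _ => 2 | _ => 3 end.
Definition gen_sign (L : letter) : R := match L with S1 b | S2 b | S3 b => sg b | _ => 0 end.

(* A crossing strand is made of two segments meeting where [tent] has its corner. *)
Lemma two_segments x0 ya yb e p :
  seg (x0, ya, 0) (x0 + / 2, (ya + yb) / 2, e) p \/ seg (x0 + / 2, (ya + yb) / 2, e) (x0 + 1, yb, 0) p <->
  exists x, 0 <= x <= 1 /\ p = (x0 + x, ya + (yb - ya) * x, e * tent x).
Proof.
  rewrite !seg_iff. unfold tent. split.
  - intros [[s [Hs ->]]|[s [Hs ->]]].
    + exists (s / 2). split; [lra|]. rewrite Rabs_left1 by lra. f_equal; [f_equal|]; field.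
    + exists (/ 2 + s / 2). split; [lra|]. rewrite Rabs_right by lra. f_equal; [f_equal|]; field.
  - intros [x [Hx ->]]. destruct (Rle_dec x (/ 2)).
    + left. exists (2 * x). split; [lra|]. rewrite Rabs_left1 by lra. f_equal; [f_equal|]; field.
    + right. exists (2 * x - 1). split; [lra|]. rewrite Rabs_right by lra. f_equal; [f_equal|]; field.
Qed.

Lemma strand_piece_iff k L j p : gen_sign L <> 0 ->
  strand_piece (S k) (gen_index L) (gen_sign L) (pnat j) p <->
  exists x, 0 <= x <= 1 /\ p = (INR k + x, ystep L j x, zstep L j x).
Proof.
  intros HL. unfold ystep, zstep. unfold strand_piece. rewrite S_INR.
  replace (INR k + 1 - 1) with (INR k) by ring.
  replace (INR k + 1 - / 2) with (INR k + / 2) by field.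
  assert (forall ya yb q e, ya + (yb - ya) / 2 = q ->
    (seg (INR k, ya, 0) (INR k + / 2, q, e) p \/ seg (INR k + / 2, q, e) (INR k + 1, yb, 0) p) <->
    exists x, 0 <= x <= 1 /\ p = (INR k + x, ya + (yb - ya) * x, e * tent x)) as T.
  { intros ya yb q e <-. rewrite <- two_segments. replace (ya + (yb - ya) / 2) with ((ya + yb) / 2) by field. tauto. }
  assert (forall y, seg (INR k, y, 0) (INR k + 1, y, 0) p <->
    exists x, 0 <= x <= 1 /\ p = (INR k + x, y + (y - y) * x, 0 * tent x)) as T0.
  { intros y. rewrite seg_iff. split; intros [x [Hx ->]]; exists x; split; auto; f_equal; [f_equal| |f_equal|]; ring. }
  destruct L; simpl in HL; try lra; destruct j; cbn [gen_index gen_sign pnat Nat.eqb Nat.add tgt zs pval];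
    first [rewrite <- T0 | rewrite <- T with (q := INR 1 + / 2) by (simpl; field)
      | rewrite <- T with (q := INR 2 + / 2) by (simpl; field)
      | rewrite <- T with (q := INR 3 + / 2) by (simpl; field)];
    replace (INR 1) with 1 by (simpl; ring); replace (INR 2) with 2 by (simpl; ring);
    replace (INR 3) with 3 by (simpl; ring); replace (INR 4) with 4 by (simpl; ring);
    replace (1 + 1) with 2 by ring; replace (2 + 1) with 3 by ring; replace (3 + 1) with 4 by ring; tauto.
Qed.

Lemma twist_word_nth m k : (k < m + 2)%nat -> exists L, nth_error (twist_word m) k = Some L /\
  gen_sign L <> 0 /\ twist_step_gen m (S k) = (gen_index L, gen_sign L).
Proof.
  intros Hk. unfold twist_step_gen, twist_word.
  destruct (Nat.leb_spec (S k) m) as [H|H].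
  - exists (S2 true). rewrite nth_error_app1 by (rewrite repeat_length; lia).
    rewrite nth_error_repeat by lia. simpl. repeat split; lra.
  - rewrite nth_error_app2 by (rewrite repeat_length; lia). rewrite repeat_length.
    destruct (Nat.eqb_spec (S k) (m + 1)) as [H1|H1].
    + exists (S1 false). replace (k - m)%nat with 0%nat by lia. simpl. repeat split; lra.
    + exists (S2 true). replace (k - m)%nat with 1%nat by lia. simpl. repeat split; lra.
Qed.

Lemma TwistKnot_flat m p : flat_plat (twist_word m) p <-> TwistKnot m p.
Proof.
  assert (len (twist_word m) = INR (m + 2)) as E.
  { unfold len, twist_word. rewrite length_app, repeat_length. reflexivity. }
  assert (forall x, px p = x /\ caps_y (py p) /\ pz p = 0 <->
            seg (x, 1, 0) (x, 2, 0) p \/ seg (x, 3, 0) (x, 4, 0) p) as C.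
  { intros x. rewrite !seg_iff. split.
    - intros [H1 [[H2|H2] H3]]; [left; exists (py p - 1)|right; exists (py p - 3)]; (split; [lra|]);
        apply R3_ext; unfold px, py, pz in *; cbn [fst snd]; lra.
    - intros [[s [Hs ->]]|[s [Hs ->]]]; unfold px, py, pz, caps_y; cbn [fst snd]; repeat split; lra. }
  unfold flat_plat, TwistKnot. cbv zeta. rewrite !C, E, slab_letters
    by (unfold twist_word; destruct m; simpl; congruence).
  assert ((exists k L, nth_error (twist_word m) k = Some L /\ step_graph (0 + INR k) L p) <->
    exists k j, (1 <= k <= m + 2)%nat /\ (1 <= j <= 4)%nat /\
      strand_piece k (fst (twist_step_gen m k)) (snd (twist_step_gen m k)) j p) as ->; [|tauto].
  split.
  - intros [k [L [Hk [j G]]]]. assert (k < m + 2)%nat as K.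
    { replace (m + 2)%nat with (length (twist_word m))
        by (unfold twist_word; rewrite length_app, repeat_length; reflexivity).
      apply nth_error_Some. congruence. }
    destruct (twist_word_nth m k K) as [L' [E1 [E2 E3]]]. rewrite Hk in E1. injection E1 as <-.
    exists (S k), (pnat j). split; [lia|]. split; [destruct j; simpl; lia|].
    rewrite E3. cbn [fst snd]. apply strand_piece_iff; auto. now rewrite Rplus_0_l in G.
  - intros [k [j [Hk [Hj G]]]]. destruct k as [|k]; [lia|].
    destruct (twist_word_nth m k ltac:(lia)) as [L [E1 [E2 E3]]].
    exists k, L. split; auto. rewrite E3 in G. cbn [fst snd] in G. rewrite Rplus_0_l.
    assert (exists j', pnat j' = j) as [j' <-].
    { destruct j as [|[|[|[|[|]]]]]; try lia; [exists p1|exists p2|exists p3|exists p4]; auto. }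
    apply strand_piece_iff in G; auto. exists j'. exact G.
Qed.

Lemma TwistKnot_plat m : ambient_isotopic (TwistKnot m) (plat (twist_word m)).
Proof.
  apply (isotopic_iff (flat_plat (twist_word m)) _ (plat (twist_word m))).
  - apply TwistKnot_flat.
  - reflexivity.
  - apply flat_plat_isotopic. unfold twist_word. rewrite len_app.
    pose proof (len_pos (repeat (S2 true) m)). unfold len at 2; simpl. lra.
Qed.

(** * The braid group modulo flypes *)

Definition sim (u v : list letter) : Prop := ambient_isotopic (plat u) (plat v).
Definition weq (u v : list letter) : Prop := forall p s, sim (p ++ u ++ s) (p ++ v ++ s).
Definition leq (u v : list letter) : Prop := forall s, sim (u ++ s) (v ++ s).

(* [weq]: interchangeable anywhere in a plat; [leq]: next to the left caps. *)
Infix "==" := weq (at level 70).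
Infix "=<" := leq (at level 70).

#[local] Instance sim_equiv : Equivalence sim.
Proof.
  split; [intros u; apply isotopic_refl | intros u v; apply isotopic_sym | intros u v w; apply isotopic_trans].
Qed.

#[local] Instance weq_equiv : Equivalence weq.
Proof.
  split.
  - intros u p s; reflexivity.
  - intros u v H p s; symmetry; apply H.
  - intros u v w H G p s; etransitivity; [apply H | apply G].
Qed.

#[local] Instance leq_equiv : Equivalence leq.
Proof.
  split.
  - intros u s; reflexivity.
  - intros u v H s; symmetry; apply H.
  - intros u v w H G s; etransitivity; [apply H | apply G].
Qed.

#[local] Instance weq_leq : subrelation weq leq.
Proof. intros u v H s. exact (H [] s). Qed.

#[local] Instance leq_sim : subrelation leq sim.
Proof. intros u v H. specialize (H []). now rewrite !app_nil_r in H. Qed.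

#[local] Instance weq_sim : subrelation weq sim.
Proof. intros u v H. apply leq_sim, weq_leq, H. Qed.

#[local] Instance app_weq : Proper (weq ==> weq ==> weq) (@app letter).
Proof.
  intros u u' H v v' G p s. transitivity (p ++ (u' ++ v) ++ s).
  - rewrite <- !app_assoc. apply H.
  - rewrite <- !app_assoc. rewrite !(app_assoc p u'). apply G.
Qed.

#[local] Instance cons_weq : Proper (eq ==> weq ==> weq) (@cons letter).
Proof. intros L L' <- v v' G. change (L :: v) with ([L] ++ v). change (L :: v') with ([L] ++ v'). now rewrite G. Qed.

#[local] Instance app_leq : Proper (leq ==> eq ==> leq) (@app letter).
Proof. intros u u' H v v' <- s. rewrite <- !app_assoc. apply H. Qed.

(** An order of the strands that decides the crossings of the letter. It also decides the letter
    followed by its inverse, since the same strand stays on top. *)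
Definition letter_height (L : letter) (j : pos) : nat :=
  match L with
  | S1 b => match j with p1 => if b then 2 else 1 | p2 => if b then 1 else 2 | p3 => 3 | p4 => 4 end
  | S3 c => match j with p1 => 1 | p2 => 2 | p3 => if c then 4 else 3 | p4 => if c then 3 else 4 end
  | S13 b c => match j with p1 => if b then 2 else 1 | p2 => if b then 1 else 2
                          | p3 => if c then 4 else 3 | p4 => if c then 3 else 4 end
  | S2 b => match j with p1 => 1 | p2 => if b then 3 else 2 | p3 => if b then 2 else 3 | p4 => 4 end
  | Id => match j with p1 => 1 | p2 => 2 | p3 => 3 | p4 => 4 end
  end%nat.

Lemma layered_weq r r' h : r <> [] -> length r = length r' -> (forall j, perm r j = perm r' j) ->
  (forall i j, h i = h j -> i = j) -> laid r h -> laid r' h -> r == r'.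
Proof. intros ? ? ? ? ? ? p s. eapply layered_relation; eauto. Qed.

Ltac laid_tac := simpl; repeat split; intros i j Hij; destruct i; simpl in Hij; subst j; simpl; intros; try lia; lra.
Ltac layered h := apply (layered_weq _ _ h);
  [congruence | reflexivity | intros []; reflexivity | intros [] []; simpl; congruence | laid_tac | laid_tac].

Lemma Id_comm L : [L; Id] == [Id; L].
Proof.
  apply (layered_weq _ _ (letter_height L)); [congruence | reflexivity | destruct L; intros []; reflexivity | | |];
  destruct L; try destruct b; try destruct c;
  match goal with |- forall _, _ => intros [] []; simpl; congruence | _ => laid_tac end.
Qed.

(** A trivial letter commutes with every letter, so it travels to the left caps, which absorb it.
    Words of different lengths become comparable by padding, although [layered_relation] wants equal
    lengths. *)
Lemma Id_drop s : Id :: s == s.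
Proof.
  assert (forall p, p ++ [Id] == Id :: p) as M.
  { induction p as [|L p IH]; [reflexivity|]. simpl. rewrite IH.
    change (L :: Id :: p) with ([L; Id] ++ p). now rewrite Id_comm. }
  intros p q. transitivity ((p ++ [Id]) ++ s ++ q).
  { now rewrite <- app_assoc. }
  transitivity (Id :: p ++ s ++ q).
  { change (Id :: p ++ s ++ q) with ((Id :: p) ++ (s ++ q)). apply leq_sim. intros r. apply weq_leq.
    now rewrite M. }
  symmetry. apply Id_cap.
Qed.

Lemma S1_cancel b s : S1 b :: S1 (negb b) :: s == s.
Proof.
  transitivity ([Id; Id] ++ s); [|simpl; now rewrite !Id_drop].
  change (S1 b :: S1 (negb b) :: s) with ([S1 b; S1 (negb b)] ++ s).
  enough ([S1 b; S1 (negb b)] == [Id; Id]) as -> by reflexivity.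
  destruct b; [layered (letter_height (S1 true)) | layered (letter_height (S1 false))].
Qed.

Lemma S2_cancel b s : S2 b :: S2 (negb b) :: s == s.
Proof.
  transitivity ([Id; Id] ++ s); [|simpl; now rewrite !Id_drop].
  change (S2 b :: S2 (negb b) :: s) with ([S2 b; S2 (negb b)] ++ s).
  enough ([S2 b; S2 (negb b)] == [Id; Id]) as -> by reflexivity.
  destruct b; [layered (letter_height (S2 true)) | layered (letter_height (S2 false))].
Qed.

Lemma S3_cancel b s : S3 b :: S3 (negb b) :: s == s.
Proof.
  transitivity ([Id; Id] ++ s); [|simpl; now rewrite !Id_drop].
  change (S3 b :: S3 (negb b) :: s) with ([S3 b; S3 (negb b)] ++ s).
  enough ([S3 b; S3 (negb b)] == [Id; Id]) as -> by reflexivity.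
  destruct b; [layered (letter_height (S3 true)) | layered (letter_height (S3 false))].
Qed.

Lemma S13_split b c s : S13 b c :: s == S1 b :: S3 c :: s.
Proof.
  rewrite <- (Id_drop s) at 1.
  change (S13 b c :: Id :: s) with ([S13 b c; Id] ++ s).
  change (S1 b :: S3 c :: s) with ([S1 b; S3 c] ++ s).
  enough ([S13 b c; Id] == [S1 b; S3 c]) as -> by reflexivity.
  destruct b, c; [layered (letter_height (S13 true true)) | layered (letter_height (S13 true false))
    | layered (letter_height (S13 false true)) | layered (letter_height (S13 false false))].
Qed.

Lemma S1_S3_comm b c s : S1 b :: S3 c :: s == S3 c :: S1 b :: s.
Proof.
  change (S1 b :: S3 c :: s) with ([S1 b; S3 c] ++ s).
  change (S3 c :: S1 b :: s) with ([S3 c; S1 b] ++ s).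
  enough ([S1 b; S3 c] == [S3 c; S1 b]) as -> by reflexivity.
  destruct b, c; [layered (letter_height (S13 true true)) | layered (letter_height (S13 true false))
    | layered (letter_height (S13 false true)) | layered (letter_height (S13 false false))].
Qed.

(** In a positive letter the rising strand is on top. A positive word in which each pair crosses at
    most once is therefore laid by this order, and both sides of the braid relation are such
    words. *)
Definition descending (j : pos) : nat := match j with p1 => 4 | p2 => 3 | p3 => 2 | p4 => 1 end.

Notation x1 s := (S1 true :: s).
Notation X1 s := (S1 false :: s).
Notation x2 s := (S2 true :: s).
Notation X2 s := (S2 false :: s).
Notation x3 s := (S3 true :: s).
Notation X3 s := (S3 false :: s).

Lemma braid12 s : x1 (x2 (x1 s)) == x2 (x1 (x2 s)).
Proof.
  change ([S1 true; S2 true; S1 true] ++ s == [S2 true; S1 true; S2 true] ++ s).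
  enough ([S1 true; S2 true; S1 true] == [S2 true; S1 true; S2 true]) as -> by reflexivity.
  layered descending.
Qed.

Lemma braid23 s : x2 (x3 (x2 s)) == x3 (x2 (x3 s)).
Proof.
  change ([S2 true; S3 true; S2 true] ++ s == [S3 true; S2 true; S3 true] ++ s).
  enough ([S2 true; S3 true; S2 true] == [S3 true; S2 true; S3 true]) as -> by reflexivity.
  layered descending.
Qed.

Lemma aa' s : x1 (X1 s) == s. Proof. exact (S1_cancel true s). Qed.
Lemma a'a s : X1 (x1 s) == s. Proof. exact (S1_cancel false s). Qed.
Lemma bb' s : x2 (X2 s) == s. Proof. exact (S2_cancel true s). Qed.
Lemma b'b s : X2 (x2 s) == s. Proof. exact (S2_cancel false s). Qed.
Lemma cc' s : x3 (X3 s) == s. Proof. exact (S3_cancel true s). Qed.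
Lemma c'c s : X3 (x3 s) == s. Proof. exact (S3_cancel false s). Qed.

Ltac cancel := repeat first [rewrite aa' | rewrite a'a | rewrite bb' | rewrite b'b | rewrite cc' | rewrite c'c].

Lemma b'a'b s : X2 (X1 (x2 s)) == x1 (X2 (X1 s)).
Proof.
  transitivity (X2 (X1 (x2 (x1 (x2 (X2 (X1 s))))))); [now cancel|].
  rewrite <- braid12. now cancel.
Qed.

Lemma a'ba s : X1 (x2 (x1 s)) == x2 (x1 (X2 s)).
Proof.
  transitivity (X1 (x2 (x1 (x2 (X2 s))))); [now cancel|]. rewrite <- braid12. now cancel.
Qed.

Lemma b'ab s : X2 (x1 (x2 s)) == x1 (x2 (X1 s)).
Proof.
  transitivity (X2 (x1 (x2 (x1 (X1 s))))); [now cancel|]. rewrite braid12. now cancel.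
Qed.

Lemma braid12' s : X1 (X2 (X1 s)) == X2 (X1 (X2 s)).
Proof.
  transitivity (X1 (X2 (X1 (x2 (x1 (x2 (X2 (X1 (X2 s)))))))));[now cancel|].
  rewrite <- braid12. now cancel.
Qed.

Lemma c'b'c s : X3 (X2 (x3 s)) == x2 (X3 (X2 s)).
Proof.
  transitivity (X3 (X2 (x3 (x2 (x3 (X3 (X2 s))))))); [now cancel|].
  rewrite <- braid23. now cancel.
Qed.

Lemma c'bc s : X3 (x2 (x3 s)) == x2 (x3 (X2 s)).
Proof.
  transitivity (X3 (x2 (x3 (x2 (X2 s))))); [now cancel|]. rewrite braid23. now cancel.
Qed.

Lemma b'c'b s : X2 (X3 (x2 s)) == x3 (X2 (X3 s)).
Proof.
  transitivity (X2 (X3 (x2 (x3 (x2 (X2 (X3 s))))))); [now cancel|].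
  rewrite braid23. now cancel.
Qed.

Lemma braid23' s : X3 (X2 (X3 s)) == X2 (X3 (X2 s)).
Proof.
  transitivity (X3 (X2 (X3 (x2 (x3 (x2 (X2 (X3 (X2 s)))))))));[now cancel|].
  rewrite braid23. now cancel.
Qed.

Lemma cap_leq r r' (sigma : pos -> pos) (g h : pos -> nat) :
  length r = length r' -> (forall j, sigma (sigma j) = j) ->
  (forall j, perm r j = perm r' (sigma j)) ->
  (forall i j, h i = h j -> i = j) -> laid r h -> laid r' (fun j => h (sigma j)) ->
  (forall i j, (h j < h i)%nat -> (g j <= g i)%nat) ->
  (forall i j, pcen i = pcen j -> g i = g j) ->
  (forall i j, g i = g j -> pcen (sigma i) - pcen i = pcen (sigma j) - pcen j) ->
  r =< r'.
Proof. intros ? ? ? ? ? ? ? ? ? s. eapply layered_cap_relation; eauto. Qed.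

(** Untwisting one cap: [sigma] exchanges the two legs of its wedge, and the tips stay where they
    are. *)
Lemma S1_cap e : [S1 e] =< [].
Proof.
  transitivity [Id]; [|apply weq_leq, (Id_drop [])].
  apply (cap_leq _ _ (tgt (S1 e)) (fun _ => 0%nat) (letter_height (S1 e)));
    try reflexivity; try (intros; lia); try (intros []; reflexivity).
  - destruct e; intros [] []; simpl; congruence.
  - destruct e; laid_tac.
  - destruct e; laid_tac.
  - intros [] [] _; simpl; lra.
Qed.

Lemma S3_cap e : [S3 e] =< [].
Proof.
  transitivity [Id]; [|apply weq_leq, (Id_drop [])].
  apply (cap_leq _ _ (tgt (S3 e)) (fun _ => 0%nat) (letter_height (S3 e)));
    try reflexivity; try (intros; lia); try (intros []; reflexivity).
  - destruct e; intros [] []; simpl; congruence.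
  - destruct e; laid_tac.
  - destruct e; laid_tac.
  - intros [] [] _; simpl; lra.
Qed.

Definition swap_arcs (j : pos) : pos := match j with p1 => p3 | p2 => p4 | p3 => p1 | p4 => p2 end.

(** One arc crosses the other while staying entirely above it. The tip heights separate the two
    arcs, so their tips may travel in opposite directions. *)
Lemma exchange_cap : [S2 true; S13 true true; S2 true] =< [].
Proof.
  transitivity [Id; Id; Id]; [|apply weq_leq; now rewrite !Id_drop].
  apply (cap_leq _ _ swap_arcs (fun j => match j with p1 | p2 => 1 | _ => 0 end)%nat
     (fun j => match j with p1 => 3 | p2 => 4 | p3 => 1 | p4 => 2 end)%nat);
    try reflexivity; try (intros []; reflexivity); try (intros [] []; simpl; first [congruence | lia | lra]).
  - laid_tac.
  - laid_tac.
Qed.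

Lemma passing_leq : passing =< [].
Proof.
  transitivity [Id; Id; Id]; [intros s; apply passing_cap | apply weq_leq; now rewrite !Id_drop].
Qed.

(** * Inverses, conjugates, and the normal closure of s1 s3^-1 *)

Definition linv (L : letter) : letter :=
  match L with
  | Id => Id | S1 b => S1 (negb b) | S2 b => S2 (negb b) | S3 b => S3 (negb b)
  | S13 b c => S13 (negb b) (negb c)
  end.

Fixpoint inv (w : list letter) : list letter :=
  match w with [] => [] | L :: w => inv w ++ [linv L] end.

Lemma linv_r L s : L :: linv L :: s == s.
Proof.
  destruct L as [|e|e|e|e f]; simpl; [now rewrite !Id_drop | apply S1_cancel | apply S2_cancel | apply S3_cancel |].
  rewrite !S13_split, (S1_S3_comm (negb e)), S3_cancel. apply S1_cancel.
Qed.

Lemma linv_l L s : linv L :: L :: s == s.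
Proof.
  transitivity (linv L :: linv (linv L) :: s); [|apply linv_r].
  destruct L as [|e|e|e|e f]; simpl; rewrite ?Bool.negb_involutive; reflexivity.
Qed.

Lemma inv_r w s : w ++ inv w ++ s == s.
Proof.
  revert s; induction w as [|L w IH]; intros s; simpl; [reflexivity|].
  rewrite <- app_assoc, IH. apply linv_r.
Qed.

Lemma inv_l w s : inv w ++ w ++ s == s.
Proof.
  revert s; induction w as [|L w IH]; intros s; simpl; [reflexivity|].
  rewrite <- app_assoc. simpl. rewrite linv_l. apply IH.
Qed.

Lemma leq_nil_app u v : u =< [] -> v =< [] -> u ++ v =< [].
Proof. intros H G. rewrite H. exact G. Qed.

Lemma leq_nil_inv u : u =< [] -> inv u =< [].
Proof.
  intros H s. transitivity (u ++ inv u ++ s); [symmetry; apply H|].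
  apply weq_sim, inv_r.
Qed.

Definition conj (w u : list letter) : list letter := w ++ u ++ inv w.

#[local] Instance conj_weq : Proper (eq ==> weq ==> weq) conj.
Proof. intros w w' <- u v H. unfold conj. now rewrite H. Qed.

Lemma conj_app w u v : conj w (u ++ v) == conj w u ++ conj w v.
Proof. unfold conj. rewrite <- !app_assoc. now rewrite inv_l. Qed.

Lemma inv_app u v : inv (u ++ v) = inv v ++ inv u.
Proof. induction u as [|L u IH]; simpl; [now rewrite app_nil_r|]. now rewrite IH, app_assoc. Qed.

(** Both words are inverse to [conj w u]. *)
Lemma conj_inv w u : inv (conj w u) == conj w (inv u).
Proof.
  assert (forall x y, x ++ y == [] -> y ++ x == [] -> inv x == y) as U.
  { intros x y _ H. transitivity ((y ++ x) ++ inv x ++ []); [now rewrite H, app_nil_r|].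
    rewrite <- app_assoc, inv_r, app_nil_r. reflexivity. }
  apply U; unfold conj; rewrite <- ?app_assoc, inv_l; [rewrite inv_r|rewrite inv_l];
    rewrite <- (app_nil_r (inv w)); apply inv_r.
Qed.

Lemma conj_conj w v u : conj (w ++ v) u = conj w (conj v u).
Proof. unfold conj. now rewrite inv_app, <- !app_assoc. Qed.

(* The normal closure of s1 s3^-1 in B_4 is free on [fx] and [fy] and lies in
   the stabiliser of the left caps, so it can be erased anywhere in a word. *)
Definition fx : list letter := [S1 true; S3 false].
Definition fy : list letter := [S2 true; S1 true; S3 false; S2 false].

Lemma fx_leq : fx =< [].
Proof. exact (leq_nil_app [S1 true] [S3 false] (S1_cap true) (S3_cap false)). Qed.

Lemma fy_leq : fy =< [].
Proof.
  rewrite <- passing_leq. unfold passing, fy. now rewrite S13_split.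
Qed.

(** This and the following formulas describe how the generators and their inverses act by
    conjugation on the subgroup generated by [fx] and [fy]; the subgroup is thereby normal. *)
Lemma conj_a_x : conj [S1 true] fx == fx.
Proof. unfold conj, fx; simpl. now rewrite <- (S1_S3_comm false false), aa'. Qed.

Lemma conj_a_y : conj [S1 true] fy == fy ++ inv fx.
Proof. unfold conj, fy, fx; simpl. now rewrite c'b'c, braid12. Qed.

Lemma conj_b_x : conj [S2 true] fx == fy.
Proof. reflexivity. Qed.

Lemma conj_b_y : conj [S2 true] fy == fy ++ inv fx ++ fy.
Proof.
  unfold conj, fy, fx; simpl. rewrite c'b'c, b'a'b.
  rewrite a'a, <- (S1_S3_comm true false), braid12, braid23'. now cancel.
Qed.

Lemma conj_a'_x : conj [S1 false] fx == fx.
Proof. unfold conj, fx; simpl. now rewrite a'a, <- (S1_S3_comm true false). Qed.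

Lemma conj_a'_y : conj [S1 false] fy == fy ++ fx.
Proof.
  unfold conj, fy, fx; simpl.
  now rewrite a'ba, (S1_S3_comm true false []), braid23'.
Qed.

Lemma conj_b'_x : conj [S2 false] fx == fx ++ inv fy ++ fx.
Proof.
  unfold conj, fy, fx; simpl.
  rewrite c'bc, <- (braid12' (x1 _)), a'a, <- (S1_S3_comm false true), <- b'c'b, <- b'ab. now cancel.
Qed.

Lemma conj_b'_y : conj [S2 false] fy == fx.
Proof. unfold conj, fy, fx; simpl. now cancel. Qed.

Lemma conj_c_x e : conj [S3 e] fx == fx.
Proof.
  unfold conj, fx; simpl. rewrite <- (S1_S3_comm true e).
  destruct e; cbn [negb]; now cancel.
Qed.

Lemma conj_c_y : conj [S3 true] fy == inv fx ++ fy.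
Proof. unfold conj, fy, fx; simpl. now rewrite a'ba, braid23'. Qed.

Lemma conj_c'_y : conj [S3 false] fy == fx ++ fy.
Proof. unfold conj, fy, fx; simpl. now rewrite c'b'c, (S1_S3_comm true false), braid12. Qed.

(** If w u w^-1 dissolves at the left caps, then [u] can be deleted behind the prefix [w]. *)
Definition erasable (w u : list letter) : Prop := conj w u =< [].

#[local] Instance erasable_weq : Proper (eq ==> weq ==> iff) erasable.
Proof.
  intros w w' <- u v H. unfold erasable. assert (conj w u =< conj w v) as E by (apply weq_leq; now rewrite H).
  split; intros G; [rewrite <- E | rewrite E]; exact G.
Qed.

Lemma erasable_app w u v : erasable w u -> erasable w v -> erasable w (u ++ v).
Proof. intros H G. unfold erasable. rewrite (weq_leq _ _ (conj_app w u v)). now apply leq_nil_app. Qed.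

Lemma erasable_inv w u : erasable w u -> erasable w (inv u).
Proof. intros H. unfold erasable. rewrite <- (weq_leq _ _ (conj_inv w u)). now apply leq_nil_inv. Qed.

(** Conjugation by a letter turns [fx] and [fy] into words in [fx], [fy] and their inverses, and
    erasability is stable under products and inverses. *)
Lemma flype_letter w L : erasable w fx -> erasable w fy ->
  erasable w (conj [L] fx) /\ erasable w (conj [L] fy).
Proof.
  intros X Y. pose proof (erasable_inv w fx X) as X'. pose proof (erasable_inv w fy Y) as Y'.
  assert (forall u, conj [Id] u == u) as HId.
  { intros u. unfold conj; simpl. rewrite !Id_drop. now rewrite app_nil_r. }
  assert (forall e f u, conj [S13 e f] u == conj [S1 e] (conj [S3 f] u)) as H13.
  { intros e f u. unfold conj; simpl. rewrite !S13_split, <- !app_assoc; simpl.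
    now rewrite (S1_S3_comm (negb e)). }
  assert (forall e, erasable w (conj [S1 e] fx) /\ erasable w (conj [S1 e] fy)) as H1.
  { intros []; rewrite ?conj_a_x, ?conj_a_y, ?conj_a'_x, ?conj_a'_y; auto using erasable_app. }
  destruct L as [|e|e|e|e f].
  - rewrite !HId. auto.
  - apply H1.
  - destruct e; rewrite ?conj_b_x, ?conj_b_y, ?conj_b'_x, ?conj_b'_y; auto using erasable_app.
  - rewrite conj_c_x. destruct e; rewrite ?conj_c_y, ?conj_c'_y; auto using erasable_app.
  - rewrite !H13, conj_c_x. destruct (H1 e) as [Hx Hy]. split; auto.
    destruct f; rewrite ?conj_c_y, ?conj_c'_y, conj_app; apply erasable_app; auto.
    rewrite <- conj_inv. apply erasable_inv; auto.
Qed.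

(** The induction peels off the last letter of [w], the one that acts first on [fx] and [fy]. *)
Lemma flype w : erasable w fx /\ erasable w fy.
Proof.
  induction w as [|L w IH] using rev_ind.
  - split; [exact fx_leq | exact fy_leq].
  - destruct IH as [X Y]. destruct (flype_letter w L X Y) as [X' Y'].
    unfold erasable. rewrite !conj_conj. auto.
Qed.

(** Behind a prefix p, the factor [fx] is moved to the front as p [fx] p^-1, where the caps absorb
    it. *)
Lemma flype_weq s : x1 (X3 s) == s.
Proof.
  intros p t. change (x1 (X3 s) ++ t) with (fx ++ s ++ t).
  transitivity (conj p fx ++ p ++ s ++ t).
  - apply weq_sim. unfold conj. rewrite <- !app_assoc. now rewrite inv_l.
  - apply (proj1 (flype p)).
Qed.

Lemma c_a s : x3 s == x1 s.
Proof. rewrite <- (flype_weq (x3 s)). now cancel. Qed.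

Lemma c'_a' s : X3 s == X1 s.
Proof. transitivity (X1 (x1 (X3 s))); [now cancel | now rewrite flype_weq]. Qed.

(** * The two words *)

(** While alpha grows by PI the curve meets crossings at PI/2 - 1/2, at PI/2 (two), at PI/2 + 1/2
    and at PI (two), in this order. The right caps cut the last period at alpha = PI/2, which leaves
    the single final letter of [quads]. *)
Definition quad (bv bw : nat -> bool) (e1 e3 f1 f3 : bool) (q : nat) : list letter :=
  [S2 (bv q); S13 e1 e3; S2 (bw q); S13 f1 f3].
Definition quads bv bw e1 e3 f1 f3 (q n : nat) : list letter :=
  flat_map (quad bv bw e1 e3 f1 f3) (seq q n) ++ [S2 (bv (q + n)%nat)].

(** Turning the plat around makes its right caps left caps. *)
Lemma S1_right_cap e w : sim (w ++ [S1 e]) w.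
Proof.
  transitivity (rev (w ++ [S1 e])); [apply plat_rev|]. rewrite rev_app_distr. simpl.
  transitivity (rev w); [apply (S1_cap e) | symmetry; apply plat_rev].
Qed.

Lemma S1_power_cap k : repeat (S1 true) k =< [].
Proof.
  induction k as [|k IH]; [reflexivity|].
  exact (leq_nil_app [S1 true] _ (S1_cap true) IH).
Qed.

(** The element s2 s1 conjugates s2 to s1, so a power of s1 passes through it as the same power of
    s2. *)
Lemma power_ba k s : repeat (S1 true) k ++ x2 (x1 s) == x2 (x1 (repeat (S2 true) k ++ s)).
Proof.
  induction k as [|k IH]; simpl; [reflexivity|]. now rewrite IH, braid12.
Qed.

Lemma power_b'a' k s : repeat (S1 true) k ++ X2 (X1 s) == X2 (X1 (repeat (S2 true) k ++ s)).
Proof.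
  induction k as [|k IH]; simpl; [reflexivity|]. now rewrite IH, <- b'a'b.
Qed.

Lemma twist_word_rev m : sim (x2 (X1 (repeat (S2 true) m))) (twist_word m).
Proof.
  transitivity (rev (x2 (X1 (repeat (S2 true) m)))); [apply plat_rev|].
  simpl. rewrite rev_repeat, <- app_assoc. reflexivity.
Qed.

(** A letter s1 created at the right cap lets s1^(m+1) pass as s2^(m+1). One factor of it completes
    s2^-1 s1 s2 = s1 s2 s1^-1, whose first letter the left cap absorbs. What remains, s2 s1^-1 s2^m,
    is the twist word read backwards. *)
Lemma twist_normal_form_odd m :
  sim (X2 (X2 (repeat (S1 true) (S m) ++ [S2 true]))) (twist_word m).
Proof.
  rewrite <- twist_word_rev.
  transitivity ((X2 (X2 (repeat (S1 true) (S m) ++ [S2 true]))) ++ [S1 true]);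
    [symmetry; apply S1_right_cap|].
  transitivity (x1 (x2 (X1 (repeat (S2 true) m)))).
  - apply weq_sim. cbn [app]. rewrite <- app_assoc. cbn [app].
    rewrite power_ba, app_nil_r, b'b. cbn [repeat]. now rewrite b'ab.
  - apply (S1_cap true).
Qed.

(** As in the odd case, but with s1^-1 created at the right cap: s1^m s2^-1 s1^-1 becomes s2^-1
    s1^-1 s2^m. *)
Lemma twist_normal_form_even m :
  sim (x2 (x2 (repeat (S1 true) m ++ [S2 false]))) (twist_word m).
Proof.
  rewrite <- twist_word_rev.
  transitivity ((x2 (x2 (repeat (S1 true) m ++ [S2 false]))) ++ [S1 false]);
    [symmetry; apply S1_right_cap|].
  apply weq_sim. cbn [app]. rewrite <- app_assoc. cbn [app].
  now rewrite power_b'a', app_nil_r, bb'.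
Qed.

Lemma quad_trivial e s : [S2 e; S13 false true; S2 (negb e); S13 true true] ++ s == x1 (x1 s).
Proof. simpl. now rewrite !S13_split, !c_a, a'a, S2_cancel. Qed.

Lemma quads_trivial bv bw q n s :
  (forall k, (q <= k < q + n)%nat -> bw k = negb (bv k)) ->
  flat_map (quad bv bw false true true true) (seq q n) ++ s == repeat (S1 true) (2 * n) ++ s.
Proof.
  revert q; induction n as [|n IH]; intros q H; [reflexivity|].
  replace (2 * S n)%nat with (S (S (2 * n))) by lia. cbn [seq flat_map repeat].
  rewrite <- app_assoc, IH by (intros; apply H; lia).
  unfold quad. rewrite (H q) by lia. apply quad_trivial.
Qed.

(** With s3 replaced by s1, a quad whose two s2-letters have opposite signs collapses to s1^2. Only
    q = 2N, where both are negative, survives as s2^-2 s1^2. The quads before it form a power of s1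
    that the left cap absorbs; those after it contribute s1^(4N). *)
Lemma word_odd N :
  sim (quads (fun q => negb (q <=? 2 * N)%nat) (fun q => q <? 2 * N)%nat false true true true 0 (4 * N + 1))
      (twist_word (4 * N + 1)).
Proof.
  set (bv := fun q => negb (q <=? 2 * N)%nat). set (bw := fun q => (q <? 2 * N)%nat).
  rewrite <- twist_normal_form_odd. unfold quads.
  replace (4 * N + 1)%nat with (2 * N + (1 + 2 * N))%nat at 1 by lia.
  rewrite seq_app, flat_map_app. cbn [seq flat_map Nat.add].
  transitivity (repeat (S1 true) (2 * (2 * N)) ++ (X2 (X2 (repeat (S1 true) (S (4 * N + 1)) ++ [S2 true])))).
  - apply weq_sim. rewrite <- !app_assoc. rewrite quads_trivial.
    2:{ intros k Hk. unfold bv, bw. rewrite Bool.negb_involutive. 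
        destruct (Nat.ltb_spec k (2 * N)), (Nat.leb_spec k (2 * N)); auto; lia. }
    apply app_weq; [reflexivity|]. rewrite quads_trivial.
    2:{ intros k Hk. unfold bv, bw. rewrite Bool.negb_involutive.
        destruct (Nat.ltb_spec k (2 * N)), (Nat.leb_spec k (2 * N)); auto; lia. }
    unfold quad, bv, bw. rewrite Nat.leb_refl, Nat.ltb_irrefl.
    replace (4 * N + 1 <=? 2 * N)%nat with false by (symmetry; apply Nat.leb_gt; lia). cbn [negb app].
    rewrite !S13_split, !c_a, a'a.
    replace (S (4 * N + 1)) with (S (S (2 * (2 * N)))) by lia. reflexivity.
  - apply S1_power_cap.
Qed.

Definition negtwist : list letter := [S2 false; S1 false; S1 false; S2 false].
(* The inverse of the full twist on three strands. *)
Definition centre (s : list letter) : list letter := negtwist ++ X1 (X1 s).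

#[local] Instance centre_weq : Proper (weq ==> weq) centre.
Proof. intros u v H. unfold centre. now rewrite H. Qed.

Lemma centre_a s : centre (x1 s) == x1 (centre s).
Proof. unfold centre, negtwist; simpl. now rewrite a'a, <- (b'a'b (X1 (X2 _))), (braid12' (X1 s)), bb'. Qed.

Lemma centre_b s : centre (x2 s) == x2 (centre s).
Proof.
  unfold centre, negtwist; simpl.
  rewrite bb', (braid12' (X1 s)), (braid12' (X2 (X1 s))), (braid12' (X1 (x2 s))), b'a'b, a'a.
  reflexivity.
Qed.

Lemma centre_power_a k s : centre (repeat (S1 true) k ++ s) == repeat (S1 true) k ++ centre s.
Proof. induction k as [|k IH]; simpl; [reflexivity|]. now rewrite centre_a, IH. Qed.

(** Once s3 is replaced by s1, [negtwist] is the inverse of carrying one arc over the other, hence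
    trivial at the left caps; the remaining s1^-2 untwists a cap. *)
Lemma centre_cap s : sim (centre s) s.
Proof.
  assert (negtwist =< []) as H.
  { apply (leq_nil_inv [S2 true; S1 true; S1 true; S2 true]).
    transitivity [S2 true; S13 true true; S2 true]; [|apply exchange_cap].
    apply weq_leq. now rewrite S13_split, c_a. }
  transitivity ([S1 false] ++ [S1 false] ++ s); [apply H|].
  transitivity ([S1 false] ++ s); apply (S1_cap false).
Qed.

Lemma negtwist_centre s : negtwist ++ s == centre (x1 (x1 s)).
Proof. unfold centre. now rewrite a'a, a'a. Qed.

(** Each [negtwist] is the inverse full twist times s1^2. The full twist is central, so it moves to
    the front and vanishes at the caps, leaving s1^2. *)
Lemma negtwists_absorbed n k s :
  sim (x2 (x2 (repeat (S1 true) k ++ concat (repeat negtwist n) ++ s)))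
      (x2 (x2 (repeat (S1 true) (k + 2 * n) ++ s))).
Proof.
  revert k; induction n as [|n IH]; intros k; [now rewrite Nat.add_0_r|].
  cbn [repeat concat]. rewrite <- app_assoc.
  transitivity (centre (x2 (x2 (repeat (S1 true) (k + 2) ++ concat (repeat negtwist n) ++ s)))).
  - apply weq_sim. rewrite !centre_b, repeat_app, <- app_assoc, centre_power_a, negtwist_centre.
    reflexivity.
  - rewrite centre_cap, IH. now replace (k + 2 * S n)%nat with (k + 2 + 2 * n)%nat by lia.
Qed.

(** The first quad reduces to s2 s1^-2 s2^-1, which is s2^2 times [negtwist]; every later quad is a
    [negtwist]. The final letter is s2^-1 because N >= 1 puts it outside the exceptional index 0. *)
Lemma word_even N : (1 <= N)%nat ->
  sim (quads (fun q => q =? 0)%nat (fun _ => false) false false true false 0 N) (twist_word (2 * N)).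
Proof.
  intros HN. set (bv := fun q => (q =? 0)%nat). rewrite <- twist_normal_form_even.
  change (2 * N)%nat with (0 + 2 * N)%nat. rewrite <- negtwists_absorbed. apply weq_sim.
  unfold quads. cbn [repeat app].
  assert (forall n q s, (1 <= q)%nat ->
    flat_map (quad bv (fun _ => false) false false true false) (seq q n) ++ s == concat (repeat negtwist n) ++ s) as G.
  { induction n as [|n IH]; intros q s Hq; [reflexivity|]. cbn [seq flat_map repeat concat].
    rewrite <- !app_assoc, IH by lia. unfold quad, negtwist, bv.
    replace (q =? 0)%nat with false by (symmetry; apply Nat.eqb_neq; lia). simpl.
    now rewrite !S13_split, !c'_a', aa'. }
  destruct N as [|N]; [lia|]. cbn [seq flat_map repeat concat]. rewrite <- !app_assoc, G by lia.
  unfold quad, negtwist, bv. simpl. now rewrite !S13_split, !c'_a', aa', bb'.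
Qed.

(** * Separation of strands of the Fourier curve *)

(* The common lower bound of [Rabs (mix r a b)] over all r in [0,1]. *)
Definition pm (a b : R) : R := Rmax 0 (Rmin a b) + Rmax 0 (Rmin (- a) (- b)).

Lemma pm_mix r a b : 0 <= r <= 1 -> pm a b <= Rabs (mix r a b).
Proof.
  intros Hr. assert (Rmin a b <= mix r a b) by (unfold mix, Rmin; destruct (Rle_dec a b); nra).
  assert (Rmin (- a) (- b) <= - mix r a b) by (unfold mix, Rmin; destruct (Rle_dec (- a) (- b)); nra).
  pose proof (Rle_abs (mix r a b)). pose proof (Rle_abs (- mix r a b)). rewrite Rabs_Ropp in *.
  pose proof (Rabs_pos (mix r a b)). unfold pm. split_min_max.
Qed.

Lemma pm_nonneg a b : 0 <= pm a b.
Proof. unfold pm. pose proof (Rmax_l 0 (Rmin a b)). pose proof (Rmax_l 0 (Rmin (- a) (- b))). lra. Qed.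

Lemma pm_pos a b : 0 < a * b -> 0 < pm a b.
Proof.
  intros H. destruct (Rle_dec a 0).
  - assert (a < 0) by (destruct (Req_dec a 0); [subst; lra|lra]). assert (b < 0) by nra. unfold pm; split_min_max.
  - assert (0 < b) by nra. unfold pm; split_min_max.
Qed.

Lemma pm_ge t a b : t <= a -> t <= b -> t <= pm a b.
Proof. intros. unfold pm. split_min_max. Qed.

Lemma pm_ge_opp t a b : t <= - a -> t <= - b -> t <= pm a b.
Proof. intros. unfold pm. split_min_max. Qed.

Lemma lip_opp a b L f : lip a b L f -> lip a b L (fun x => - f x).
Proof.
  intros F x x' Hx Hx'. replace (- f x - - f x') with (f x' - f x) by ring.
  rewrite Rabs_minus_sym. apply F; auto.
Qed.

Lemma lip_pm a b L f g : 0 <= L -> lip a b L f -> lip a b L g -> lip a b (L + L) (fun x => pm (f x) (g x)).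
Proof.
  intros HL F G. assert (lip a b L (fun _ => 0)) as Z.
  { apply (lip_affine _ _ _ 0 0); [rewrite Rabs_R0; lra | intros; ring]. }
  apply lip_plus; apply lip_max; auto; apply lip_min; auto using lip_opp.
Qed.

Lemma lip_positive_bound a b L f : a <= b -> lip a b L f -> (forall x, a <= x <= b -> 0 < f x) ->
  exists d, 0 < d /\ forall x, a <= x <= b -> d <= f x.
Proof.
  intros Hab F P. set (cl := fun x => Rmax a (Rmin x b)).
  assert (forall x, a <= cl x <= b) as Hc by (intros x; unfold cl; split_min_max).
  assert (forall x y, Rabs (cl x - cl y) <= Rabs (x - y)) as Lc.
  { intros x y. pose proof (Rle_abs (x - y)). pose proof (Rle_abs (- (x - y))). rewrite Rabs_Ropp in *.
    apply Rabs_le. unfold cl; split_min_max. }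
  destruct (continuity_ab_min (fun x => f (cl x)) a b Hab) as [m [Hm1 Hm2]].
  - intros c _. apply (lip_continuity _ (Rabs L)). intros x y.
    eapply Rle_trans; [apply F; apply Hc|]. specialize (Lc x y). pose proof (Rle_abs L).
    pose proof (Rabs_pos (cl x - cl y)). pose proof (Rabs_pos L). nra.
  - exists (f (cl m)). split; [apply P, Hc|]. intros x Hx. specialize (Hm1 x Hx).
    assert (cl x = x) as E by (unfold cl; split_min_max). cbv beta in Hm1. now rewrite E in Hm1.
Qed.

(** Strict agreement of signs before and after the move, in y or in z. No intermediate time of a
    straight homotopy can then bring the two strands together. *)
Definition sep (a b c d : R) : Prop := 0 < a * b \/ 0 < c * d.

(* [Y0, Z0] and [Y1, Z1] are the differences of two strands before and after
   a straight move, as required by [level_isotopic]. *)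
Definition star (M a b : R) (Y0 Z0 Y1 Z1 : R -> R) : Prop :=
  forall r x, 0 <= r <= 1 -> a <= x <= b ->
    Rabs (Y1 x - Y0 x) + Rabs (Z1 x - Z0 x) <= M * (Rabs (mix r (Y0 x) (Y1 x)) + Rabs (mix r (Z0 x) (Z1 x))).

Lemma star_mono M M' a b Y0 Z0 Y1 Z1 : M <= M' -> star M a b Y0 Z0 Y1 Z1 -> star M' a b Y0 Z0 Y1 Z1.
Proof.
  intros H S r x Hr Hx. specialize (S r x Hr Hx).
  pose proof (Rabs_pos (mix r (Y0 x) (Y1 x))); pose proof (Rabs_pos (mix r (Z0 x) (Z1 x))). nra.
Qed.

Lemma star_glue M M' a c b Y0 Z0 Y1 Z1 : star M a c Y0 Z0 Y1 Z1 -> star M' c b Y0 Z0 Y1 Z1 ->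
  star (Rmax M M') a b Y0 Z0 Y1 Z1.
Proof.
  intros S S' r x Hr Hx. destruct (Rle_dec x c).
  - apply (star_mono M _ a c _ _ _ _ (Rmax_l _ _) S); auto; lra.
  - apply (star_mono M' _ c b _ _ _ _ (Rmax_r _ _) S'); auto; lra.
Qed.

(** By compactness the sum of the two common lower bounds [pm] has a positive minimum on the
    interval, and the displacement is bounded. *)
Lemma star_of_sep L a b Y0 Z0 Y1 Z1 : 0 <= L -> a <= b ->
  lip a b L Y0 -> lip a b L Z0 -> lip a b L Y1 -> lip a b L Z1 ->
  (forall x, a <= x <= b -> sep (Y0 x) (Y1 x) (Z0 x) (Z1 x)) ->
  exists M, star M a b Y0 Z0 Y1 Z1.
Proof.
  intros HL Hab LY0 LZ0 LY1 LZ1 S.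
  destruct (lip_positive_bound a b (L + L + (L + L)) (fun x => pm (Y0 x) (Y1 x) + pm (Z0 x) (Z1 x)) Hab) as [d [Hd D]].
  - apply lip_plus; apply lip_pm; auto.
  - intros x Hx. pose proof (pm_nonneg (Y0 x) (Y1 x)). pose proof (pm_nonneg (Z0 x) (Z1 x)).
    destruct (S x Hx) as [H1|H1]; apply pm_pos in H1; lra.
  - set (C := Rabs (Y1 a - Y0 a) + Rabs (Z1 a - Z0 a) + 4 * L * (b - a)).
    assert (forall x, a <= x <= b -> Rabs (Y1 x - Y0 x) + Rabs (Z1 x - Z0 x) <= C) as HC.
    { intros x Hx. assert (a <= a <= b) as Ha by lra.
      pose proof (Rabs_diff_lip _ _ _ _ L _ (LY0 x a Hx Ha) (LY1 x a Hx Ha)) as B1.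
      pose proof (Rabs_diff_lip _ _ _ _ L _ (LZ0 x a Hx Ha) (LZ1 x a Hx Ha)) as B2.
      rewrite (Rabs_right (x - a)) in B1, B2 by lra.
      pose proof (Rabs_triang_inv (Y1 x - Y0 x) (Y1 a - Y0 a)).
      pose proof (Rabs_triang_inv (Z1 x - Z0 x) (Z1 a - Z0 a)).
      assert (L * (x - a) <= L * (b - a)) by (apply Rmult_le_compat_l; lra). unfold C; lra. }
    assert (0 <= C).
    { specialize (HC a ltac:(lra)). pose proof (Rabs_pos (Y1 a - Y0 a)); pose proof (Rabs_pos (Z1 a - Z0 a)). lra. }
    exists (C / d). intros r x Hr Hx. eapply Rle_trans; [apply HC; auto|].
    apply (Rmult_le_reg_l d); auto. replace (d * (C / d * (Rabs (mix r (Y0 x) (Y1 x)) + Rabs (mix r (Z0 x) (Z1 x)))))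
      with (C * (Rabs (mix r (Y0 x) (Y1 x)) + Rabs (mix r (Z0 x) (Z1 x)))) by (field; lra).
    rewrite Rmult_comm. apply Rmult_le_compat_l; auto. specialize (D x Hx).
    pose proof (pm_mix r (Y0 x) (Y1 x) Hr). pose proof (pm_mix r (Z0 x) (Z1 x) Hr). lra.
Qed.

(** All four differences vanish at the tip [e], so the displacement is at most 4 L |x - e| while the
    y-distance is at least k |x - e|: the quotient stays bounded. *)
Lemma star_of_tip L a b e k Y0 Z0 Y1 Z1 : 0 <= L -> a <= e <= b -> 0 < k ->
  lip a b L Y0 -> lip a b L Z0 -> lip a b L Y1 -> lip a b L Z1 ->
  Y0 e = 0 -> Y1 e = 0 -> Z0 e = 0 -> Z1 e = 0 ->
  (forall x, a <= x <= b -> k * Rabs (x - e) <= pm (Y0 x) (Y1 x)) ->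
  exists M, star M a b Y0 Z0 Y1 Z1.
Proof.
  intros HL He Hk LY0 LZ0 LY1 LZ1 y0 y1 z0 z1 T. exists (4 * L / k). intros r x Hr Hx.
  pose proof (Rabs_diff_lip _ _ _ _ L _ (LY0 x e Hx He) (LY1 x e Hx He)) as B1.
  pose proof (Rabs_diff_lip _ _ _ _ L _ (LZ0 x e Hx He) (LZ1 x e Hx He)) as B2.
  rewrite y0, y1, Rminus_diag, Rminus_0_r in B1. rewrite z0, z1, Rminus_diag, Rminus_0_r in B2.
  apply Rle_trans with (4 * L * Rabs (x - e)); [lra|].
  apply (Rmult_le_reg_l k); auto.
  replace (k * (4 * L / k * (Rabs (mix r (Y0 x) (Y1 x)) + Rabs (mix r (Z0 x) (Z1 x)))))
      with (4 * L * (Rabs (mix r (Y0 x) (Y1 x)) + Rabs (mix r (Z0 x) (Z1 x)))) by (field; lra).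
  replace (k * (4 * L * Rabs (x - e))) with (4 * L * (k * Rabs (x - e))) by ring.
  apply Rmult_le_compat_l; [lra|]. specialize (T x Hx). pose proof (pm_mix r (Y0 x) (Y1 x) Hr).
  pose proof (Rabs_pos (mix r (Z0 x) (Z1 x))). lra.
Qed.

(** Seven terms of the Leibniz series give the upper bound. It makes PI/4 - 1/2 less than 1/3, which
    keeps [gph] increasing, and it is the bound that the smallest even case demands of its phase. *)
Lemma PI_bounds : 3 < PI < 10 / 3.
Proof.
  pose proof (PI_ineq 3) as [_ H]. pose proof PI2_3_2. split; [lra|].
  assert (sum_f_R0 (tg_alt PI_tg) (2 * 3) < 5 / 6); [|lra].
  unfold tg_alt, PI_tg. simpl. lra.
Qed.

(** The angle alpha as a function of the plat abscissa. At x = m - 1/2 the sine takes the values 0,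
    1, 0, -1, 0, so the left tip alpha = 0 falls on x = -1/2 and the crossing angles PI/2 - 1/2,
    PI/2, PI/2 + 1/2, PI fall on 1/2, 3/2, 5/2, 7/2, the midpoints of the letters of a quad. *)
Definition gph (x : R) : R := PI / 4 * (x + / 2) + (PI / 4 - / 2) * sin (PI / 2 * (x + / 2)).

Lemma gph_diff x y : x <= y -> / 12 * (y - x) <= gph y - gph x <= 2 * (y - x).
Proof.
  intros H. pose proof PI_bounds. pose proof (sin_lip (PI / 2 * (y + / 2)) (PI / 2 * (x + / 2))) as S.
  replace (PI / 2 * (y + / 2) - PI / 2 * (x + / 2)) with (PI / 2 * (y - x)) in S by ring.
  assert (0 <= PI / 2 * (y - x)) by (apply Rmult_le_pos; lra).
  rewrite (Rabs_right (PI / 2 * (y - x))) in S by lra. apply Rabs_le_inv in S.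
  set (d := sin (PI / 2 * (y + / 2)) - sin (PI / 2 * (x + / 2))) in *.
  replace (gph y - gph x) with (PI / 4 * (y - x) + (PI / 4 - / 2) * d) by (unfold gph, d; ring).
  assert (- ((PI / 4 - / 2) * (PI / 2 * (y - x))) <= (PI / 4 - / 2) * d <= (PI / 4 - / 2) * (PI / 2 * (y - x))) by nra.
  assert ((PI / 4 - / 2) * (PI / 2 * (y - x)) <= / 3 * (PI / 2 * (y - x))) by (apply Rmult_le_compat_r; lra).
  assert (3 * (y - x) <= PI * (y - x)) by (apply Rmult_le_compat_r; lra).
  assert (PI * (y - x) <= 10 / 3 * (y - x)) by (apply Rmult_le_compat_r; lra).
  lra.
Qed.

Lemma gph_lt x y : x < y -> gph x < gph y.
Proof. intros H. pose proof (gph_diff x y ltac:(lra)). lra. Qed.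

Lemma gph_m x m a s : x = m - / 2 -> PI / 2 * m = a -> sin a = s -> gph x = PI / 4 * m + (PI / 4 - / 2) * s.
Proof. intros -> H1 <-. unfold gph. replace (m - / 2 + / 2) with m by ring. now rewrite H1. Qed.

Lemma gph_tip : gph (- / 2) = 0.
Proof. rewrite (gph_m _ 0 0 0); [ring | ring | ring | apply sin_0]. Qed.
Lemma gph_1 : gph (/ 2) = PI / 2 - / 2.
Proof. rewrite (gph_m _ 1 (PI / 2) 1); [field | field | ring | apply sin_PI2]. Qed.
Lemma gph_2 : gph (3 / 2) = PI / 2.
Proof. rewrite (gph_m _ 2 PI 0); [field | field | field | apply sin_PI]. Qed.
Lemma gph_3 : gph (5 / 2) = PI / 2 + / 2.
Proof. rewrite (gph_m _ 3 (3 * (PI / 2)) (-1)); [field | field | field | apply sin_3PI2]. Qed.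
Lemma gph_4 : gph (7 / 2) = PI.
Proof. rewrite (gph_m _ 4 (2 * PI) 0); [field | field | field | apply sin_2PI]. Qed.
Lemma gph_5 : gph (9 / 2) = 3 * (PI / 2) - / 2.
Proof.
  rewrite (gph_m _ 5 (PI / 2 + 2 * PI) 1); [field | field | field |].
  rewrite sin_plus, cos_2PI, sin_2PI, sin_PI2. ring.
Qed.

Lemma gph_period x : gph (x + 4) = gph x + PI.
Proof.
  unfold gph. replace (PI / 2 * (x + 4 + / 2)) with (PI / 2 * (x + / 2) + 2 * PI) by field.
  rewrite sin_plus, cos_2PI, sin_2PI. field.
Qed.

Lemma gph_period_n x k : gph (x + 4 * INR k) = gph x + INR k * PI.
Proof.
  induction k as [|k IH]; [simpl; replace (x + 4 * 0) with x by ring; ring|].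
  rewrite S_INR. replace (x + 4 * (INR k + 1)) with (x + 4 * INR k + 4) by ring.
  rewrite gph_period, IH. ring.
Qed.

(* The strand starting at position j of a quad of crossings, at alpha = be modulo
   PI, and (in [GZ]) its height at arccos x = u, after the rotation by PI about
   the y-axis that makes the first coordinate increase with u. *)
Definition GY (j : pos) (be : R) : R :=
  match j with p3 => cos (be + / 2) | p2 => - cos (be + / 2) | p4 => cos (be - / 2) | p1 => - cos (be - / 2) end.

Definition GZ (s phi : R) (j : pos) (be u : R) : R :=
  match j with
  | p3 => - (cos (u + PI / 4) + cos (be + s * u + phi))
  | p2 => - (cos (u + PI / 4) - cos (be + s * u + phi))
  | p4 => - (cos (u - PI / 4) + cos (be + s * u - phi))
  | p1 => - (cos (u - PI / 4) - cos (be + s * u - phi))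
  end.

Definition rv (j : pos) : pos := match j with p1 => p4 | p2 => p3 | p3 => p2 | p4 => p1 end.

Lemma cos_shift x : cos (x + PI) = - cos x.
Proof. apply neg_cos. Qed.

(** Adding PI to alpha reverses the four strands, exactly as a quad permutes the positions. This
    makes an induction over quads possible. *)
Lemma GY_shift j be : GY j (be + PI) = GY (rv j) be.
Proof.
  destruct j; simpl.
  - replace (be + PI - / 2) with (be - / 2 + PI) by ring. rewrite cos_shift; ring.
  - replace (be + PI + / 2) with (be + / 2 + PI) by ring. rewrite cos_shift; ring.
  - replace (be + PI + / 2) with (be + / 2 + PI) by ring. rewrite cos_shift; ring.
  - replace (be + PI - / 2) with (be - / 2 + PI) by ring. rewrite cos_shift; ring.
Qed.

Lemma GZ_shift s phi j be u : GZ s phi j (be + PI) u = GZ s phi (rv j) be u.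
Proof.
  destruct j; simpl.
  - replace (be + PI + s * u - phi) with (be + s * u - phi + PI) by ring. rewrite cos_shift; ring.
  - replace (be + PI + s * u + phi) with (be + s * u + phi + PI) by ring. rewrite cos_shift; ring.
  - replace (be + PI + s * u + phi) with (be + s * u + phi + PI) by ring. rewrite cos_shift; ring.
  - replace (be + PI + s * u - phi) with (be + s * u - phi + PI) by ring. rewrite cos_shift; ring.
Qed.

(* The abscissa at which strands i > j of a quad cross. *)
Definition crossing (i j : pos) : R :=
  match i, j with
  | p3, p2 => / 2
  | p4, p1 => 5 / 2
  | p4, p3 | p2, p1 => 7 / 2
  | _, _ => 3 / 2
  end.

Definition above (i j : pos) : Prop :=
  match i, j with p4, p3 | p4, p2 | p4, p1 | p3, p2 | p3, p1 | p2, p1 => True | _, _ => False end.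

Lemma above_total (P : pos -> pos -> Prop) : (forall i j, P i j -> P j i) ->
  (forall i j, above i j -> P i j) -> forall i j, i <> j -> P i j.
Proof. intros S H i j N. destruct i, j; try congruence; first [apply H; exact I | apply S, H; exact I]. Qed.

Lemma cos_half_pos : 0 < cos (/ 2).
Proof. pose proof PI_bounds. apply cos_gt_0; lra. Qed.
Lemma sin_half_pos : 0 < sin (/ 2).
Proof. pose proof PI_bounds. apply sin_gt_0; lra. Qed.

Lemma GY_diff i j be : above i j -> GY i be - GY j be =
  match i, j with
  | p3, p2 => 2 * cos (be + / 2)
  | p4, p1 => 2 * cos (be - / 2)
  | p4, p3 | p2, p1 => 2 * sin (/ 2) * sin be
  | _, _ => 2 * cos (/ 2) * cos be
  end.
Proof.
  destruct i, j; simpl; intros H; try contradiction; try ring; rewrite ?cos_plus, ?cos_minus; ring.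
Qed.

Definition sign_as (d e : R) : Prop := (0 < e -> 0 < d) /\ (e = 0 -> d = 0) /\ (e < 0 -> d < 0).

(** The purpose of [gph]: each pair of arcs changes order at the midpoint of the letter in which the
    plat strands cross, and in the same direction. *)
Lemma GY_sign i j x : above i j -> - / 2 < x <= 4 -> sign_as (GY i (gph x) - GY j (gph x)) (crossing i j - x).
Proof.
  intros A Hx. rewrite GY_diff by auto.
  pose proof PI_bounds. pose proof cos_half_pos. pose proof sin_half_pos.
  assert (0 < gph x) as L1 by (rewrite <- gph_tip; apply gph_lt; lra).
  assert (gph x < 3 * (PI / 2) - / 2) as L2 by (rewrite <- gph_5; apply gph_lt; lra).
  assert (forall m, x < m -> gph x < gph m) as Lt by (intros; now apply gph_lt).
  assert (forall m, m < x -> gph m < gph x) as Gt by (intros; now apply gph_lt).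
  pose proof (Lt (/ 2)) as a1; pose proof (Lt (3 / 2)) as a2; pose proof (Lt (5 / 2)) as a3; pose proof (Lt (7 / 2)) as a4.
  pose proof (Gt (/ 2)) as b1; pose proof (Gt (3 / 2)) as b2; pose proof (Gt (5 / 2)) as b3; pose proof (Gt (7 / 2)) as b4.
  rewrite ?gph_1, ?gph_2, ?gph_3, ?gph_4 in *.
  set (be := gph x) in *.
  assert (forall k d e, 0 < k -> sign_as d e -> sign_as (k * d) e) as Sc.
  { unfold sign_as; intros k d e Hk [S1 [S2 S3]]. repeat split; intros He.
    - apply Rmult_lt_0_compat; auto.
    - rewrite S2; auto; ring.
    - specialize (S3 He). nra. }
  destruct i, j; simpl in A; try contradiction; simpl; apply Sc; try nra; repeat split; intros He.
  all: try (apply cos_gt_0; lra).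
  all: try (apply cos_lt_0; lra).
  all: try (apply sin_gt_0; lra).
  all: try (apply sin_lt_0; lra).
  all: unfold be.
  - replace x with (7 / 2) by lra. rewrite gph_4. apply sin_PI.
  - replace x with (3 / 2) by lra. rewrite gph_2. apply cos_PI2.
  - replace x with (/ 2) by lra. rewrite gph_1. replace (PI / 2 - / 2 + / 2) with (PI / 2) by ring. apply cos_PI2.
  - replace x with (5 / 2) by lra. rewrite gph_3. replace (PI / 2 + / 2 - / 2) with (PI / 2) by ring. apply cos_PI2.
  - replace x with (3 / 2) by lra. rewrite gph_2. apply cos_PI2.
  - replace x with (7 / 2) by lra. rewrite gph_4. apply sin_PI.
Qed.

Lemma sep_sign d e d' e' z z' x : sign_as d x -> sign_as e x -> (x = 0 -> 0 < z * z') ->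
  d' = d -> e' = e -> sep d' e' z z'.
Proof.
  intros [D1 [D2 D3]] [E1 [E2 E3]] Hz -> ->. destruct (Rtotal_order x 0) as [H|[H|H]].
  - left. specialize (D3 H); specialize (E3 H). nra.
  - right; auto.
  - left. specialize (D1 H); specialize (E1 H). nra.
Qed.

Lemma sep_opp a b c d : sep a b c d -> sep (- a) (- b) (- c) (- d).
Proof. unfold sep. now rewrite !Rmult_opp_opp. Qed.

Lemma sin_lower x : 0 <= x <= 1 -> x / 2 <= sin x.
Proof.
  intros Hx. destruct (Req_dec x 0) as [->|N]; [rewrite sin_0; lra|].
  destruct (MVT_cor2 sin cos 0 x ltac:(lra) ltac:(intros; apply derivable_pt_lim_sin)) as [c [E Hc]].
  rewrite sin_0 in E. assert (/ 2 <= cos c); [|nra].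
  replace (/ 2) with (cos (PI / 3)) by (rewrite cos_PI3; field).
  pose proof PI_bounds. apply cos_decr_1; lra.
Qed.

(** * The arcs of the curve against the strands of the word *)

Lemma quads_S bv bw e1 e3 f1 f3 q n :
  quads bv bw e1 e3 f1 f3 q (S n) = quad bv bw e1 e3 f1 f3 q ++ quads bv bw e1 e3 f1 f3 (S q) n.
Proof. unfold quads. cbn [seq flat_map]. rewrite <- app_assoc. now rewrite Nat.add_succ_r. Qed.

Lemma len_quads bv bw e1 e3 f1 f3 q n : len (quads bv bw e1 e3 f1 f3 q n) = 4 * INR n + 1.
Proof.
  revert q; induction n as [|n IH]; intros q.
  - unfold len, quads; simpl; ring.
  - rewrite quads_S, len_app, IH, S_INR. unfold len, quad; simpl; ring.
Qed.

Ltac sign_crunch := unfold ystep; simpl; repeat split; intros; lra.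

Lemma quad_y_sign bv bw e1 e3 f1 f3 q i j x : above i j -> 0 <= x <= 4 ->
  sign_as (ypath (quad bv bw e1 e3 f1 f3 q) i x - ypath (quad bv bw e1 e3 f1 f3 q) j x) (crossing i j - x).
Proof.
  intros A Hx. unfold quad. cbn [ypath].
  destruct (Rle_dec x 1); [|destruct (Rle_dec (x - 1) 1); [|destruct (Rle_dec (x - 1 - 1) 1);
    [|destruct (Rle_dec (x - 1 - 1 - 1) 1); [|lra]]]];
  destruct i, j; simpl in A; try contradiction; sign_crunch.
Qed.

Lemma tent_half : tent (/ 2) = 1.
Proof. unfold tent. replace (2 * / 2 - 1) with 0 by field. rewrite Rabs_R0. ring. Qed.

Lemma quad_z bv bw e1 e3 f1 f3 q i j : above i j ->
  zpath (quad bv bw e1 e3 f1 f3 q) i (crossing i j) - zpath (quad bv bw e1 e3 f1 f3 q) j (crossing i j) =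
  -2 * match i, j with
       | p3, p2 => sg (bv q) | p4, p1 => sg (bw q) | p4, p2 => sg e3 | p3, p1 => sg e1
       | p4, p3 => sg f1 | _, _ => sg f3 end.
Proof.
  intros A. unfold quad. destruct i, j; simpl in A; try contradiction; cbn [crossing zpath];
  repeat match goal with |- context [Rle_dec ?a ?b] => destruct (Rle_dec a b); try lra end;
  unfold zstep; cbn [tgt zs];
  repeat match goal with |- context [tent ?a] => replace (tent a) with 1
    by (symmetry; transitivity (tent (/ 2)); [f_equal; field | apply tent_half]) end; ring.
Qed.

(* The signs of the height differences at the crossings alpha = PI/2 - 1/2,
   PI/2 + 1/2, PI/2 (two of them) and PI (two of them) modulo PI agree with the
   letters of [quads]. *)
Definition good_signs (s phi : R) (Q : nat) (bv bw : nat -> bool) (e1 e3 f1 f3 : bool) : Prop :=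
  let nn := 2 * INR Q + 1 in
  (s = 1 \/ s = -1) /\
  (forall q, (q <= Q)%nat -> sg (bv q) * sin (s * (2 * (PI / 2 - / 2 + INR q * PI) / nn) + phi - / 2) < 0) /\
  (forall q, (q < Q)%nat -> sg (bw q) * sin (s * (2 * (PI / 2 + / 2 + INR q * PI) / nn) - phi + / 2) < 0) /\
  sg e1 * (sin (PI / 4) + s * cos phi) < 0 /\ 0 < sg e3 * (sin (PI / 4) - s * cos phi) /\
  0 < sg f1 * (sin (PI / 4) - s * sin phi) /\ sg f3 * (sin (PI / 4) + s * sin phi) < 0.

(** The two high frequencies differ by 2s with s = 1 or s = -1, so sin (s u) = s sin u. At the
    simultaneous crossings sin u factors out and the sign is the same in every quad; only the two
    s2-crossings keep a phase that varies with u. *)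
Lemma GZ_diff s phi i j u : (s = 1 \/ s = -1) -> above i j ->
  let be := gph (crossing i j) in
  GZ s phi i be u - GZ s phi j be u =
  2 * match i, j with
      | p3, p2 => sin (s * u + phi - / 2)
      | p4, p1 => sin (s * u - phi + / 2)
      | p4, p2 => - (sin u * (sin (PI / 4) - s * cos phi))
      | p3, p1 => sin u * (sin (PI / 4) + s * cos phi)
      | p4, p3 => - (sin u * (sin (PI / 4) - s * sin phi))
      | _, _ => sin u * (sin (PI / 4) + s * sin phi)
      end.
Proof.
  intros Hs A.
  assert (sin (s * u) = s * sin u) as Es.
  { destruct Hs as [->| ->]; [rewrite !Rmult_1_l; auto|].
    replace (-1 * u) with (- u) by ring. rewrite sin_neg; ring. }
  destruct i, j; simpl in A; try contradiction; cbn [crossing GZ];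
    rewrite ?gph_1, ?gph_2, ?gph_3, ?gph_4.
  - replace (PI + s * u + phi) with ((s * u + phi) + PI) by ring.
    replace (PI + s * u - phi) with ((s * u - phi) + PI) by ring. rewrite !cos_shift.
    rewrite !cos_plus, !cos_minus, Es. ring.
  - replace (PI / 2 + s * u + phi) with (PI / 2 + (s * u + phi)) by ring.
    replace (PI / 2 + s * u - phi) with (PI / 2 + (s * u - phi)) by ring.
    rewrite !(cos_plus (PI / 2)), cos_PI2, sin_PI2, sin_plus, sin_minus, cos_plus, cos_minus, Es. ring.
  - replace (PI / 2 - / 2 + s * u + phi) with (PI / 2 + (s * u + phi - / 2)) by ring.
    rewrite !(cos_plus (PI / 2)), cos_PI2, sin_PI2. ring.
  - replace (PI / 2 + / 2 + s * u - phi) with (PI / 2 + (s * u - phi + / 2)) by ring.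
    rewrite !(cos_plus (PI / 2)), cos_PI2, sin_PI2. ring.
  - replace (PI / 2 + s * u + phi) with (PI / 2 + (s * u + phi)) by ring.
    replace (PI / 2 + s * u - phi) with (PI / 2 + (s * u - phi)) by ring.
    rewrite !(cos_plus (PI / 2)), cos_PI2, sin_PI2, sin_plus, sin_minus, cos_plus, cos_minus, Es. ring.
  - replace (PI + s * u + phi) with ((s * u + phi) + PI) by ring.
    replace (PI + s * u - phi) with ((s * u - phi) + PI) by ring. rewrite !cos_shift.
    rewrite !cos_plus, !cos_minus, Es. ring.
Qed.

Section Quads.
Variables (s phi : R) (Q : nat) (bv bw : nat -> bool) (e1 e3 f1 f3 : bool).
Hypothesis good : good_signs s phi Q bv bw e1 e3 f1 f3.
Let nn := 2 * INR Q + 1.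
Let W q n := quads bv bw e1 e3 f1 f3 q n.
Let uu q x := 2 * (gph x + INR q * PI) / nn.

Definition pair_sep (q n : nat) (i j : pos) (x : R) : Prop :=
  sep (GY i (gph x) - GY j (gph x)) (ypath (W q n) i x - ypath (W q n) j x)
      (GZ s phi i (gph x) (uu q x) - GZ s phi j (gph x) (uu q x)) (zpath (W q n) i x - zpath (W q n) j x).

(** The condition on [GZ] is guarded because the angle [uu] equals PI at the right tip exactly when
    q + n = Q. *)
Definition pair_tip (q n : nat) (i j : pos) : Prop :=
  let e := 4 * INR n + 3 / 2 in
  (forall x, 4 * INR n + 1 <= x <= e ->
    / 48 * Rabs (x - e) <= pm (GY i (gph x) - GY j (gph x)) (ypath (W q n) i x - ypath (W q n) j x)) /\
  GY i (gph e) - GY j (gph e) = 0 /\ ypath (W q n) i e - ypath (W q n) j e = 0 /\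
  ((q + n)%nat = Q -> GZ s phi i (gph e) (uu q e) - GZ s phi j (gph e) (uu q e) = 0) /\
  zpath (W q n) i e - zpath (W q n) j e = 0.

Notation quad_ := (quad bv bw e1 e3 f1 f3).
Notation quads_ := (quads bv bw e1 e3 f1 f3).

Lemma nn_pos : 0 < nn.
Proof. unfold nn. pose proof (pos_INR Q). lra. Qed.

Lemma uu_shift q x : uu q (x + 4) = uu (S q) x.
Proof. unfold uu. rewrite gph_period, S_INR. f_equal. ring. Qed.

Lemma pair_sep_shift q n i j x : 0 < x ->
  pair_sep (S q) n (rv i) (rv j) x -> pair_sep q (S n) i j (x + 4).
Proof.
  intros Hx H. unfold pair_sep in *. unfold W in *. rewrite quads_S.
  assert (len (quad_ q) = 4) as L by (unfold len, quad; simpl; ring).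
  destruct (path_app_r (quad_ q) (quads_ (S q) n) i (x + 4)) as [-> ->]; [lra|].
  destruct (path_app_r (quad_ q) (quads_ (S q) n) j (x + 4)) as [-> ->]; [lra|].
  rewrite L. replace (x + 4 - 4) with x by ring.
  rewrite uu_shift, gph_period, !GY_shift, !GZ_shift.
  replace (perm (quad_ q) i) with (rv i) by (destruct i; reflexivity).
  replace (perm (quad_ q) j) with (rv j) by (destruct j; reflexivity).
  exact H.
Qed.

Lemma pair_tip_shift q n i j : pair_tip (S q) n (rv i) (rv j) -> pair_tip q (S n) i j.
Proof.
  intros [H1 [H2 [H3 [H4 H5]]]]. unfold pair_tip, W in *. rewrite quads_S.
  assert (len (quad_ q) = 4) as L by (unfold len, quad; simpl; ring).
  pose proof (pos_INR n).
  assert (forall x k, 0 <= x ->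
    ypath (quad_ q ++ quads_ (S q) n) k (x + 4)
      = ypath (quads_ (S q) n) (rv k) x /\
    zpath (quad_ q ++ quads_ (S q) n) k (x + 4)
      = zpath (quads_ (S q) n) (rv k) x) as Sh.
  { intros x k Hx.
    destruct (path_app_r (quad_ q) (quads_ (S q) n) k (x + 4)) as [-> ->]; [lra|].
    rewrite L. replace (x + 4 - 4) with x by ring.
    replace (perm (quad_ q) k) with (rv k) by (destruct k; reflexivity). auto. }
  rewrite S_INR. cbv zeta.
  replace (4 * (INR n + 1) + 3 / 2) with (4 * INR n + 3 / 2 + 4) by ring.
  split; [|repeat split].
  - intros x Hx. specialize (H1 (x - 4) ltac:(lra)).
    destruct (Sh (x - 4) i ltac:(lra)) as [E1 _]. destruct (Sh (x - 4) j ltac:(lra)) as [E2 _].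
    replace (x - 4 + 4) with x in E1, E2 by ring. rewrite E1, E2.
    replace (gph x) with (gph (x - 4 + 4)) by (f_equal; ring). rewrite gph_period, !GY_shift.
    replace (x - (4 * INR n + 3 / 2 + 4)) with (x - 4 - (4 * INR n + 3 / 2)) by ring. exact H1.
  - rewrite gph_period, !GY_shift. exact H2.
  - destruct (Sh (4 * INR n + 3 / 2) i ltac:(lra)) as [-> _]. destruct (Sh (4 * INR n + 3 / 2) j ltac:(lra)) as [-> _].
    exact H3.
  - intros E. rewrite uu_shift, gph_period, !GZ_shift. apply H4. lia.
  - destruct (Sh (4 * INR n + 3 / 2) i ltac:(lra)) as [_ ->]. destruct (Sh (4 * INR n + 3 / 2) j ltac:(lra)) as [_ ->].
    exact H5.
Qed.

(** Strictly inside the range of arccos, so that sin u > 0 at the simultaneous crossings. *)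
Lemma uu_range q i j : (q < Q)%nat -> above i j -> 0 < uu q (crossing i j) < PI.
Proof.
  intros Hq A. pose proof PI_bounds. pose proof nn_pos. pose proof (pos_INR q).
  assert (0 < gph (crossing i j) <= PI).
  { rewrite <- gph_tip at 1. rewrite <- gph_4. split; [apply gph_lt|pose proof (gph_diff (crossing i j) (7 / 2))];
      destruct i, j; simpl in *; try contradiction; try lra. }
  assert (INR q + 1 <= INR Q) by (rewrite <- S_INR; apply le_INR; lia).
  unfold uu. split.
  - apply Rdiv_lt_0_compat; auto. nra.
  - apply (Rmult_lt_reg_r nn); auto. unfold Rdiv; rewrite Rmult_assoc, Rinv_l, Rmult_1_r by lra.
    unfold nn. nra.
Qed.

(** Off the crossing abscissa of the pair the two y-differences have the same sign; at it both
    vanish, and [good_signs] compares the heights. *)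
Lemma quad_sep q n i j x : (q + S n = Q)%nat -> i <> j -> 0 <= x <= 4 -> pair_sep q (S n) i j x.
Proof.
  intros HQ N Hx. revert i j N. apply above_total.
  { intros i j H. unfold pair_sep in *. rewrite <- (Ropp_minus_distr (GY i _)), <- (Ropp_minus_distr (ypath _ i _)),
      <- (Ropp_minus_distr (GZ _ _ i _ _)), <- (Ropp_minus_distr (zpath _ i _)). now apply sep_opp. }
  intros i j A. unfold pair_sep, W. rewrite quads_S.
  assert (len (quad_ q) = 4) as L by (unfold len, quad; simpl; ring).
  destruct (path_app_l (quad_ q) (quads_ (S q) n) i x) as [-> ->]; [lra|lra|].
  destruct (path_app_l (quad_ q) (quads_ (S q) n) j x) as [-> ->]; [lra|lra|].
  eapply (sep_sign _ _ _ _ _ _ (crossing i j - x)); [apply GY_sign; auto; lra | apply quad_y_sign; eauto | | reflexivity | reflexivity].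
  intros E. assert (x = crossing i j) as -> by lra. rewrite quad_z by auto.
  destruct good as [Hs [Gv [Gw [G1 [G2 [G3 G4]]]]]].
  rewrite GZ_diff by auto. pose proof (uu_range q i j ltac:(lia) A) as U.
  pose proof (sin_gt_0 _ (proj1 U) (proj2 U)) as SU.
  specialize (Gv q ltac:(lia)). specialize (Gw q ltac:(lia)).
  unfold uu in *. destruct i, j; simpl in A; try contradiction; cbn [crossing] in *;
    rewrite ?gph_1, ?gph_2, ?gph_3, ?gph_4 in *; fold nn in Gv, Gw; nra.
Qed.

Lemma last_y i x : 0 <= x -> forall q,
  (x <= 1 -> ypath (W q 0) i x = ystep (S2 (bv q)) i x) /\
  (1 <= x -> ypath (W q 0) i x = let k := tgt (S2 (bv q)) i in pcen k + (pval k - pcen k) * (1 - 2 * (x - 1))).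
Proof.
  intros Hx q. unfold W, quads. cbn [seq flat_map app]. rewrite Nat.add_0_r. cbn [ypath]. split; intros H.
  - destruct (Rle_dec x 1); [auto|lra].
  - destruct (Rle_dec x 1); auto. replace x with 1 by lra. unfold ystep. cbv zeta. ring.
Qed.

(** The pairs that the final s2-letter brings under a common right cap. *)
Definition tip_pair (i j : pos) : Prop :=
  match i, j with p4, p2 | p2, p4 | p3, p1 | p1, p3 => True | _, _ => False end.

Lemma last_y_sign i j x q : above i j -> 0 <= x <= 3 / 2 -> (x < 3 / 2 \/ ~ tip_pair i j) ->
  sign_as (ypath (W q 0) i x - ypath (W q 0) j x) (crossing i j - x).
Proof.
  intros A Hx Ht. destruct (last_y i x ltac:(lra) q) as [I1 I2]. destruct (last_y j x ltac:(lra) q) as [J1 J2].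
  destruct (Rle_dec x 1).
  - rewrite I1, J1 by lra. destruct i, j; simpl in A; try contradiction; sign_crunch.
  - rewrite I2, J2 by lra. destruct i, j; simpl in *; try contradiction; repeat split; intros;
      destruct Ht as [Ht|Ht]; try tauto; lra.
Qed.

Lemma last_sep q i j x : q = Q -> i <> j -> 0 <= x <= 3 / 2 -> (x < 3 / 2 \/ ~ tip_pair i j) -> pair_sep q 0 i j x.
Proof.
  intros -> N Hx. revert i j N.
  refine (above_total (fun i j => x < 3 / 2 \/ ~ tip_pair i j -> pair_sep Q 0 i j x) _ _).
  { intros i j H Ht. unfold pair_sep in *. rewrite <- (Ropp_minus_distr (GY i _)), <- (Ropp_minus_distr (ypath _ i _)),
      <- (Ropp_minus_distr (GZ _ _ i _ _)), <- (Ropp_minus_distr (zpath _ i _)). apply sep_opp, H.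
    destruct Ht as [?|Ht]; auto. right. intros F. apply Ht. destruct i, j; simpl in *; tauto. }
  intros i j A Ht. unfold pair_sep.
  eapply (sep_sign _ _ _ _ _ _ (crossing i j - x)); [apply GY_sign; auto; lra | apply last_y_sign; eauto | | reflexivity | reflexivity].
  intros E. assert (x = crossing i j) as -> by lra.
  destruct good as [Hs [Gv _]]. specialize (Gv Q (le_n Q)). rewrite GZ_diff by auto.
  destruct i, j; simpl in A; try contradiction; cbn [crossing] in *; try lra;
    try (destruct Ht as [Ht|Ht]; [lra|exfalso; apply Ht; exact I]).
  unfold W, quads. cbn [seq flat_map app]. rewrite Nat.add_0_r. cbn [zpath].
  destruct (Rle_dec (/ 2) 1); [|lra]. unfold zstep. rewrite tent_half. cbn [zs].
  unfold uu. rewrite gph_1. fold nn in Gv. nra.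
Qed.

Lemma last_tip q : forall i j, tip_pair i j -> pair_tip q 0 i j.
Proof.
  assert (forall i j, above i j -> tip_pair i j -> pair_tip q 0 i j) as G.
  { intros i j A T. unfold pair_tip. cbv zeta. simpl INR. rewrite !Rmult_0_r, !Rplus_0_l.
    assert (GY i (gph (3 / 2)) - GY j (gph (3 / 2)) = 0) as E1.
    { rewrite GY_diff, gph_2 by auto. destruct i, j; simpl in *; try contradiction; rewrite cos_PI2; ring. }
    split; [|split; [exact E1|split; [|split]]].
    - intros x Hx. rewrite Rabs_left1 by lra. apply pm_ge.
      + rewrite GY_diff by auto. pose proof PI_bounds.
        pose proof (gph_diff x (3 / 2) ltac:(lra)) as D. rewrite gph_2 in D.
        assert (cos (gph x) = sin (PI / 2 - gph x)) as Ec by (symmetry; apply sin_shift).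
        pose proof (sin_lower (PI / 2 - gph x) ltac:(lra)).
        assert (/ 2 <= cos (/ 2)).
        { replace (/ 2) with (cos (PI / 3)) at 1 by (rewrite cos_PI3; field). apply cos_decr_1; lra. }
        destruct i, j; simpl in *; try contradiction; rewrite Ec; nra.
      + destruct (last_y i x ltac:(lra) q) as [_ ->]; [|lra]. destruct (last_y j x ltac:(lra) q) as [_ ->]; [|lra].
        destruct i, j; simpl in *; try contradiction; lra.
    - destruct (last_y i (3 / 2) ltac:(lra) q) as [_ ->]; [|lra]. destruct (last_y j (3 / 2) ltac:(lra) q) as [_ ->]; [|lra].
      destruct i, j; simpl in *; try contradiction; lra.
    - intros E. assert (q = Q) as -> by lia.
      assert (uu Q (3 / 2) = PI) as U.
      { unfold uu. rewrite gph_2. pose proof nn_pos. unfold nn in *. field. lra. }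
      rewrite U. destruct good as [Hs _]. 
      assert (crossing i j = 3 / 2) as Ec by (destruct i, j; simpl in *; try contradiction; reflexivity).
      rewrite <- Ec, GZ_diff by auto. destruct i, j; simpl in *; try contradiction; rewrite sin_PI; ring.
    - unfold W, quads. cbn [seq flat_map app zpath]. destruct (Rle_dec (3 / 2) 1); lra. }
  intros i j T. destruct i, j; simpl in T; try contradiction; try (apply G; exact I);
  [specialize (G p3 p1 I I) | specialize (G p4 p2 I I)];
  destruct G as [G1 [G2 [G3 [G4 G5]]]]; unfold pair_tip; (split; [|repeat split]); try lra;
  try (intros x Hx; specialize (G1 x Hx); unfold pm in *;
       match goal with H : context [Rmin (- (?a - ?b)) (- (?c - ?d))] |- _ =>
         replace (- (a - b)) with (b - a) in H by ring; replace (- (c - d)) with (d - c) in H by ring end;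
       match goal with |- context [Rmin (- (?a - ?b)) (- (?c - ?d))] =>
         replace (- (a - b)) with (b - a) by ring; replace (- (c - d)) with (d - c) by ring end; lra);
  intros E; specialize (G4 E); lra.
Qed.

Lemma rv_inj i j : i <> j -> rv i <> rv j.
Proof. intros N E. apply N. destruct i, j; simpl in E; congruence. Qed.

Lemma quads_sep n q i j x : (q + n = Q)%nat -> i <> j -> 0 <= x < 4 * INR n + 3 / 2 -> pair_sep q n i j x.
Proof.
  revert q i j x; induction n as [|n IH]; intros q i j x HQ N Hx.
  - apply last_sep; simpl in Hx; auto; try lra; lia.
  - destruct (Rle_dec x 4); [apply quad_sep; auto; lra|].
    rewrite S_INR in Hx. replace x with (x - 4 + 4) by ring. apply pair_sep_shift; [lra|].
    apply IH; [lia | now apply rv_inj | lra].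
Qed.

Lemma quads_end n q i j : (q + n = Q)%nat -> i <> j ->
  pair_sep q n i j (4 * INR n + 3 / 2) \/ pair_tip q n i j.
Proof.
  revert q i j; induction n as [|n IH]; intros q i j HQ N.
  - destruct (classic (tip_pair i j)) as [T|T]; [right; now apply last_tip|left].
    simpl INR. apply last_sep; auto; try lra; lia.
  - destruct (IH (S q) (rv i) (rv j) ltac:(lia) (rv_inj i j N)) as [H|H].
    + left. rewrite S_INR. replace (4 * (INR n + 1) + 3 / 2) with (4 * INR n + 3 / 2 + 4) by ring.
      apply pair_sep_shift; auto. pose proof (pos_INR n); lra.
    + right. now apply pair_tip_shift.
Qed.
End Quads.

(** * The Fourier curve as a plat *)

Lemma pos_uniform (P : R -> pos -> Prop) : (forall M M' j, M <= M' -> P M j -> P M' j) ->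
  (forall j, exists M, P M j) -> exists M, forall j, P M j.
Proof.
  intros Mono H. destruct (H p1) as [M1 H1], (H p2) as [M2 H2], (H p3) as [M3 H3], (H p4) as [M4 H4].
  exists (Rmax (Rmax M1 M2) (Rmax M3 M4)).
  pose proof (Rmax_l M1 M2); pose proof (Rmax_r M1 M2); pose proof (Rmax_l M3 M4); pose proof (Rmax_r M3 M4);
  pose proof (Rmax_l (Rmax M1 M2) (Rmax M3 M4)); pose proof (Rmax_r (Rmax M1 M2) (Rmax M3 M4)).
  intros []; [apply (Mono M1) | apply (Mono M2) | apply (Mono M3) | apply (Mono M4)]; auto; lra.
Qed.

Lemma gph_lip x y : Rabs (gph x - gph y) <= 2 * Rabs (x - y).
Proof.
  destruct (Rle_dec x y) as [H|H].
  - pose proof (gph_diff x y H). rewrite (Rabs_left1 (x - y)), Rabs_left1 by lra. lra.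
  - pose proof (gph_diff y x ltac:(lra)). rewrite (Rabs_right (x - y)), Rabs_right by lra. lra.
Qed.

Lemma gph_mono x y : x <= y -> gph x <= gph y.
Proof. intros H. pose proof (gph_diff x y H). lra. Qed.

Lemma lip_sub a b L f g : lip a b L f -> lip a b L g -> lip a b (2 * L) (fun x => f x - g x).
Proof.
  intros F G. replace (2 * L) with (L + L) by ring.
  apply (lip_plus _ _ L L f (fun x => - g x)); auto using lip_opp.
Qed.

Lemma GY_lip j x y : Rabs (GY j (gph x) - GY j (gph y)) <= 2 * Rabs (x - y).
Proof.
  pose proof (gph_lip x y).
  assert (forall d, Rabs (cos (gph x + d) - cos (gph y + d)) <= 2 * Rabs (x - y)) as G.
  { intros d. eapply Rle_trans; [apply cos_lip|].
    replace (gph x + d - (gph y + d)) with (gph x - gph y) by ring. auto. }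
  destruct j; simpl; unfold Rminus in *; try apply G;
    match goal with |- Rabs (- ?a + - - ?b) <= _ => replace (- a + - - b) with (- (a + - b)) by ring end;
    rewrite Rabs_Ropp; apply G.
Qed.

Section Curve.
Variables (s phi : R) (Q : nat) (bv bw : nat -> bool) (e1 e3 f1 f3 : bool).
Hypothesis good : good_signs s phi Q bv bw e1 e3 f1 f3.
Let nn := 2 * INR Q + 1.
Let W := quads bv bw e1 e3 f1 f3 0 Q.

(** The solution u of alpha = nn u / 2 along [gph]; it runs from 0 at the left tips to PI at the
    right tips. *)
Definition angle (x : R) : R := 2 * gph x / nn.
Definition YF (j : pos) (x : R) : R := GY j (gph x).
Definition ZF (j : pos) (x : R) : R := GZ s phi j (gph x) (angle x).

Let b_end := 4 * INR Q + 3 / 2.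

Lemma nn_ge1 : 1 <= nn.
Proof. unfold nn. pose proof (pos_INR Q). lra. Qed.

Lemma angle_lip x y : Rabs (angle x - angle y) <= 4 * Rabs (x - y).
Proof.
  unfold angle. pose proof nn_ge1. pose proof (gph_lip x y). pose proof (Rabs_pos (gph x - gph y)).
  replace (2 * gph x / nn - 2 * gph y / nn) with (/ nn * (2 * (gph x - gph y))) by (field; lra).
  rewrite !Rabs_mult, (Rabs_right 2), (Rabs_right (/ nn)) by (try lra; left; apply Rinv_0_lt_compat; lra).
  assert (/ nn <= 1) by (rewrite <- Rinv_1; apply Rinv_le_contravar; lra).
  assert (0 < / nn) by (apply Rinv_0_lt_compat; lra). nra.
Qed.

Lemma ZF_lip j x y : Rabs (ZF j x - ZF j y) <= 10 * Rabs (x - y).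
Proof.
  assert (s = 1 \/ s = -1) as Hs by apply good.
  pose proof (gph_lip x y) as Lg. pose proof (angle_lip x y) as La.
  assert (forall d, Rabs (cos (angle x + d) - cos (angle y + d)) <= 4 * Rabs (x - y)) as G1.
  { intros d. eapply Rle_trans; [apply cos_lip|].
    replace (angle x + d - (angle y + d)) with (angle x - angle y) by ring. auto. }
  assert (forall d, Rabs (cos (gph x + s * angle x + d) - cos (gph y + s * angle y + d)) <= 6 * Rabs (x - y)) as G2.
  { intros d. eapply Rle_trans; [apply cos_lip|].
    replace (gph x + s * angle x + d - (gph y + s * angle y + d))
      with ((gph x - gph y) + s * (angle x - angle y)) by ring.
    eapply Rle_trans; [apply Rabs_triang|]. rewrite Rabs_mult.
    replace (Rabs s) with 1 by (destruct Hs as [->| ->]; [rewrite Rabs_R1|rewrite Rabs_left1]; lra). lra. }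
  unfold ZF. destruct j; simpl; unfold Rminus in *.
  - pose proof (G1 (- (PI / 4))) as g1. pose proof (G2 (- phi)) as g2. apply Rabs_le_inv in g1, g2. apply Rabs_le. lra.
  - pose proof (G1 (PI / 4)) as g1. pose proof (G2 phi) as g2. apply Rabs_le_inv in g1, g2. apply Rabs_le. lra.
  - pose proof (G1 (PI / 4)) as g1. pose proof (G2 phi) as g2. apply Rabs_le_inv in g1, g2. apply Rabs_le. lra.
  - pose proof (G1 (- (PI / 4))) as g1. pose proof (G2 (- phi)) as g2. apply Rabs_le_inv in g1, g2. apply Rabs_le. lra.
Qed.

Lemma len_W : len W = 4 * INR Q + 1.
Proof. apply len_quads. Qed.

Definition strands_sep (i j : pos) (x : R) : Prop :=
  sep (YF i x - YF j x) (ystrand W i x - ystrand W j x) (ZF i x - ZF j x) (zstrand W i x - zstrand W j x).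

Lemma pair_sep_strands i j x : 0 <= x -> pair_sep s phi Q bv bw e1 e3 f1 f3 0 Q i j x -> strands_sep i j x.
Proof.
  intros Hx H. unfold pair_sep, strands_sep, YF, ZF, angle in *. fold W nn in H.
  destruct (strand_pos W i x Hx) as [-> ->]. destruct (strand_pos W j x Hx) as [-> ->].
  simpl INR in H. rewrite Rmult_0_l, Rplus_0_r in H. exact H.
Qed.

Definition same_cap (i j : pos) : Prop :=
  match i, j with p4, p3 | p3, p4 | p2, p1 | p1, p2 => True | _, _ => False end.

Lemma left_sep i j x : i <> j -> - / 2 <= x <= 0 -> (- / 2 < x \/ ~ same_cap i j) -> strands_sep i j x.
Proof.
  intros N Hx. revert i j N.
  refine (above_total (fun i j => - / 2 < x \/ ~ same_cap i j -> strands_sep i j x) _ _).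
  { intros i j H Ht. unfold strands_sep in *. rewrite <- (Ropp_minus_distr (YF i _)), <- (Ropp_minus_distr (ystrand _ i _)),
      <- (Ropp_minus_distr (ZF i _)), <- (Ropp_minus_distr (zstrand _ i _)). apply sep_opp, H.
    destruct Ht as [?|Ht]; auto. right. intros F. apply Ht. destruct i, j; simpl in *; tauto. }
  intros i j A Ht. left. apply Rmult_lt_0_compat.
  - destruct (Rlt_dec (- / 2) x) as [H|H].
    + apply (GY_sign i j x A); [lra|]. destruct i, j; simpl in *; try contradiction; lra.
    + replace x with (- / 2) by lra. destruct Ht as [?|Ht]; [lra|].
      unfold YF. rewrite gph_tip, GY_diff by auto. pose proof cos_half_pos as C.
      destruct i, j; simpl in *; try contradiction; try tauto.
      * rewrite cos_0; lra.
      * rewrite Rplus_0_l; lra.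
      * replace (0 - / 2) with (- / 2) by ring. rewrite cos_neg; lra.
      * rewrite cos_0; lra.
  - unfold ystrand. destruct (Rle_dec x 0); [|lra].
    destruct i, j; simpl in *; try contradiction; destruct Ht as [?|?]; try tauto; lra.
Qed.

Lemma strands_sep_interior i j x : i <> j -> - / 2 < x < b_end -> strands_sep i j x.
Proof.
  intros N Hx. destruct (Rle_dec x 0).
  - apply left_sep; auto; lra.
  - apply pair_sep_strands; [lra|]. apply (quads_sep s phi Q); auto. unfold b_end in Hx; lra.
Qed.

Notation strand_star M a b i j := (star M a b (fun x => YF i x - YF j x) (fun x => ZF i x - ZF j x)
  (fun x => ystrand W i x - ystrand W j x) (fun x => zstrand W i x - zstrand W j x)).

(** The interval is cut at 0 and 4Q + 1, where the caps begin. In the middle all strands are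
    separated; over each cap region a pair is either separated up to the end or meets in a tip with
    linear opening. *)
Lemma pair_star i j : exists M, strand_star M (- / 2) b_end i j.
Proof.
  destruct (classic (i = j)) as [<-|N].
  { exists 0. intros r x _ _. rewrite !Rminus_diag, Rabs_R0. lra. }
  pose proof (pos_INR Q) as HQ. pose proof PI_bounds.
  assert (forall k, lip (- / 2) b_end 10 (YF k)) as LY.
  { intros k x y _ _. pose proof (GY_lip k x y). pose proof (Rabs_pos (x - y)). unfold YF; lra. }
  assert (forall k, lip (- / 2) b_end 10 (ZF k)) as LZ by (intros k x y _ _; apply ZF_lip).
  assert (forall k, lip (- / 2) b_end 10 (ystrand W k) /\ lip (- / 2) b_end 10 (zstrand W k)) as LW.
  { intros k. destruct (strand_lip W k) as [A1 A2]. rewrite len_W in *.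
    replace (4 * INR Q + 1 + / 2) with b_end in * by (unfold b_end; field).
    split; apply (lip_mono _ _ 2); auto; lra. }
  assert (forall a b, - / 2 <= a -> b <= b_end -> lip a b 20 (fun x => YF i x - YF j x) /\
    lip a b 20 (fun x => ZF i x - ZF j x) /\ lip a b 20 (fun x => ystrand W i x - ystrand W j x) /\
    lip a b 20 (fun x => zstrand W i x - zstrand W j x)) as LD.
  { intros a b Ha Hb. replace 20 with (2 * 10) by ring.
    repeat split; apply lip_sub; apply (lip_restrict (- / 2) b_end); auto; apply LW. }
  assert (exists M, strand_star M (- / 2) 0 i j) as [M1 S1].
  { destruct (LD (- / 2) 0) as [L1 [L2 [L3 L4]]]; [lra|unfold b_end; lra|].
    destruct (classic (same_cap i j)) as [C|C].
    - clear LY LZ LW LD.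
      (* The constant comes from the y-difference 2 sin (1/2) sin alpha: sin (1/2) >= 1/4, sin alpha
         >= alpha/2, and [gph] has slope at least 1/12. *)
      assert (forall i j, above i j -> same_cap i j -> forall x, - / 2 <= x <= 0 ->
        / 48 * Rabs (x - - / 2) <= YF i x - YF j x /\ / 48 * Rabs (x - - / 2) <= ystrand W i x - ystrand W j x) as G.
      { intros i' j' A C' x Hx. rewrite Rabs_right by lra. split.
        - unfold YF. rewrite GY_diff by auto. pose proof (gph_diff (- / 2) x ltac:(lra)) as D. rewrite gph_tip in D.
          pose proof (sin_lower (gph x) ltac:(lra)). pose proof (sin_lower (/ 2) ltac:(lra)).
          destruct i', j'; simpl in *; try contradiction; nra.
        - unfold ystrand. destruct (Rle_dec x 0); [|lra]. destruct i', j'; simpl in *; try contradiction; lra. }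
      apply (star_of_tip 20 _ _ (- / 2) (/ 48)); auto; try lra.
      + unfold YF. rewrite gph_tip. destruct i, j; simpl in *; try contradiction;
          rewrite ?Rplus_0_l, ?Rminus_0_l, ?cos_neg; ring.
      + unfold ystrand. destruct (Rle_dec (- / 2) 0); [|lra]. destruct i, j; simpl in *; try contradiction; lra.
      + unfold ZF, angle. rewrite gph_tip. replace (2 * 0 / nn) with 0 by (field; pose proof nn_ge1; lra).
        assert (cos (0 - PI / 4) = cos (0 + PI / 4)) as E1
          by (rewrite Rplus_0_l, Rminus_0_l; apply cos_neg).
        assert (cos (0 + s * 0 - phi) = cos (0 + s * 0 + phi)) as E2
          by (rewrite !Rmult_0_r, !Rplus_0_l, Rminus_0_l; apply cos_neg).
        destruct i, j; simpl in *; try contradiction; rewrite E1, E2; ring.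
      + unfold zstrand. destruct (Rle_dec (- / 2) 0); lra.
      + intros x Hx. destruct (classic (above i j)) as [A|A].
        * destruct (G i j A C x Hx). now apply pm_ge.
        * assert (above j i) as A' by (destruct i, j; simpl in *; tauto || congruence).
          assert (same_cap j i) as C' by (destruct i, j; simpl in *; tauto).
          destruct (G j i A' C' x Hx). apply pm_ge_opp; lra.
    - apply (star_of_sep 20); auto; try lra. intros x Hx. apply left_sep; auto. }
  assert (exists M, strand_star M 0 (4 * INR Q + 1) i j) as [M2 S2].
  { destruct (LD 0 (4 * INR Q + 1)) as [L1 [L2 [L3 L4]]]; [lra|unfold b_end; lra|].
    apply (star_of_sep 20); auto; try lra. intros x Hx. apply strands_sep_interior; auto. unfold b_end; lra. }
  assert (exists M, strand_star M (4 * INR Q + 1) b_end i j) as [M3 S3].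
  { destruct (LD (4 * INR Q + 1) b_end) as [L1 [L2 [L3 L4]]]; [lra|lra|].
    destruct (quads_end s phi Q bv bw e1 e3 f1 f3 good Q 0 i j eq_refl N) as [E|[T1 [T2 [T3 [T4 T5]]]]].
    - apply (star_of_sep 20); auto; try (unfold b_end; lra). intros x Hx.
      destruct (Req_dec x b_end) as [->|Nx].
      + apply pair_sep_strands; [unfold b_end; lra | exact E].
      + apply strands_sep_interior; auto; lra.
    - fold b_end W in T1, T2, T3, T4, T5. fold nn in T4.
      assert (0 <= b_end) as Hb by (unfold b_end; lra).
      apply (star_of_tip 20 _ _ b_end (/ 48)); auto; try lra.
      + unfold b_end; lra.
      + destruct (strand_pos W i b_end Hb) as [-> _]. destruct (strand_pos W j b_end Hb) as [-> _]. exact T3.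
      + specialize (T4 eq_refl). simpl INR in T4. rewrite Rmult_0_l, Rplus_0_r in T4. exact T4.
      + destruct (strand_pos W i b_end Hb) as [_ ->]. destruct (strand_pos W j b_end Hb) as [_ ->]. exact T5.
      + intros x Hx. assert (0 <= x) as Hx0 by lra.
        destruct (strand_pos W i x Hx0) as [-> _]. destruct (strand_pos W j x Hx0) as [-> _]. apply T1. exact Hx. }
  exists (Rmax M1 (Rmax M2 M3)). eapply star_glue; [exact S1|]. eapply star_glue; [exact S2 | exact S3].
Qed.

Lemma curve_plat : ambient_isotopic (graph (- / 2) b_end YF ZF) (plat W).
Proof.
  assert (len W + / 2 = b_end) as El by (rewrite len_W; unfold b_end; field).
  assert (exists M, forall i j, strand_star M (- / 2) b_end i j) as [M HM].
  { apply (pos_uniform (fun M i => forall j, strand_star M (- / 2) b_end i j)).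
    - intros M M' i HM H j. eapply star_mono; eauto.
    - intros i. apply pos_uniform; [|apply pair_star].
      intros M M' j HM H. eapply star_mono; eauto. }
  set (E := fun _ : R3 => False).
  apply (isotopic_iff (union E (graph (- / 2) b_end YF ZF)) _ (union E (graph (- / 2) b_end (ystrand W) (zstrand W)))).
  { intros p; unfold union, E; tauto. }
  { intros p; unfold union, E, plat. rewrite El. tauto. }
  apply (level_isotopic _ _ _ _ _ _ _ 10 (Rabs M)); try lra.
  - apply Rabs_pos.
  - intros k x y _ _. pose proof (GY_lip k x y). pose proof (Rabs_pos (x - y)). unfold YF; lra.
  - intros k x y _ _; apply ZF_lip.
  - intros k. apply (lip_mono _ _ 2); [lra|]. rewrite <- El. apply strand_lip.
  - intros k. apply (lip_mono _ _ 2); [lra|]. rewrite <- El. apply strand_lip.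
  - intros r i j x Hr Hx. pose proof (star_mono _ _ _ _ _ _ _ _ (Rle_abs M) (HM i j) r x Hr Hx) as S.
    cbv beta in S.
    replace (ystrand W i x - YF i x - (ystrand W j x - YF j x)) with (ystrand W i x - ystrand W j x - (YF i x - YF j x)) by ring.
    replace (zstrand W i x - ZF i x - (zstrand W j x - ZF j x)) with (zstrand W i x - zstrand W j x - (ZF i x - ZF j x)) by ring.
    replace (mix r (YF i x) (ystrand W i x) - mix r (YF j x) (ystrand W j x))
      with (mix r (YF i x - YF j x) (ystrand W i x - ystrand W j x)) by (unfold mix; ring).
    replace (mix r (ZF i x) (zstrand W i x) - mix r (ZF j x) (zstrand W j x))
      with (mix r (ZF i x - ZF j x) (zstrand W i x - zstrand W j x)) by (unfold mix; ring).
    exact S.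
  - intros p [].
Qed.

Lemma angle_mono x y : x <= y -> angle x <= angle y.
Proof.
  intros H. pose proof nn_ge1. pose proof (gph_mono x y H). unfold angle, Rdiv.
  apply Rmult_le_compat_r; [left; apply Rinv_0_lt_compat|]; lra.
Qed.
Lemma angle_lt x y : x < y -> angle x < angle y.
Proof.
  intros H. pose proof nn_ge1. pose proof (gph_lt x y H). unfold angle, Rdiv.
  apply Rmult_lt_compat_r; [apply Rinv_0_lt_compat|]; lra.
Qed.
Lemma angle_start : angle (- / 2) = 0.
Proof. unfold angle. rewrite gph_tip. field. pose proof nn_ge1; lra. Qed.
Lemma gph_end : gph b_end = PI / 2 + INR Q * PI.
Proof. unfold b_end. rewrite (Rplus_comm (4 * INR Q)), gph_period_n, gph_2. reflexivity. Qed.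
Lemma angle_end : angle b_end = PI.
Proof. unfold angle. rewrite gph_end. pose proof nn_ge1. unfold nn in *. field. lra. Qed.

Lemma angle_surj u : 0 <= u <= PI -> exists x, - / 2 <= x <= b_end /\ angle x = u.
Proof.
  intros Hu. pose proof (pos_INR Q).
  destruct (Req_dec u 0) as [->|N0]; [exists (- / 2); split; [unfold b_end; lra | apply angle_start]|].
  destruct (Req_dec u PI) as [->|N1]; [exists b_end; split; [unfold b_end; lra | apply angle_end]|].
  destruct (IVT (fun x => angle x - u) (- / 2) b_end) as [x [Hx E]].
  - apply (lip_continuity _ 4). intros x y. replace (angle x - u - (angle y - u)) with (angle x - angle y) by ring.
    apply angle_lip.
  - unfold b_end; lra.
  - rewrite angle_start; lra.
  - rewrite angle_end; lra.
  - exists x; split; auto. lra.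
Qed.

Definition arc_set (p : R3) : Prop := exists j u, 0 <= u <= PI /\
  p = (- cos u, GY j (nn * u / 2), GZ s phi j (nn * u / 2) u).

(** The plat abscissa is replaced by the first coordinate -cos u. Outside the interval of the plat
    the change of variable continues by translation, through the clamp [cl], so that it is an
    increasing map of the whole line at bounded distance from the identity. *)
Lemma arc_set_isotopic : ambient_isotopic (graph (- / 2) b_end YF ZF) arc_set.
Proof.
  pose proof (pos_INR Q). pose proof nn_ge1.
  set (cl := fun x => Rmax (- / 2) (Rmin x b_end)).
  assert (- / 2 <= b_end) as Hb by (unfold b_end; lra).
  assert (forall x, - / 2 <= cl x <= b_end) as Hc by (intros x; unfold cl; split_min_max).
  assert (forall x, - / 2 <= x <= b_end -> cl x = x) as Hcl by (intros x Hx; unfold cl; split_min_max).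
  assert (forall x y, Rabs (cl x - cl y) <= Rabs (x - y) /\ Rabs (x - cl x - (y - cl y)) <= Rabs (x - y)) as Lc.
  { intros x y. pose proof (Rle_abs (x - y)). pose proof (Rle_abs (- (x - y))). rewrite Rabs_Ropp in *.
    split; apply Rabs_le; unfold cl; split_min_max. }
  set (psi := fun x => - cos (angle (cl x)) + (x - cl x)).
  assert (forall x, 0 <= angle (cl x) <= PI) as Ra.
  { intros x. rewrite <- angle_start, <- angle_end. split; apply angle_mono; apply Hc. }
  apply (isotopic_iff (graph (- / 2) b_end YF ZF) _
    (fun p => exists q, graph (- / 2) b_end YF ZF q /\ p = (psi (px q), py q, pz q))).
  { reflexivity. }
  { assert (forall x, nn * angle x / 2 = gph x) as En by (intros x; unfold angle; field; lra).
    intros p; split.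
    - intros [q [[j [x [Hx ->]]] ->]]. exists j, (angle x). rewrite En.
      unfold px, py, pz, psi; cbn [fst snd]. rewrite Hcl, Rminus_diag, Rplus_0_r by auto. split; auto.
      rewrite <- (Hcl x Hx). apply Ra.
    - intros [j [u [Hu ->]]]. destruct (angle_surj u Hu) as [x [Hx <-]]. rewrite En.
      exists (x, YF j x, ZF j x). split; [exists j, x; auto|].
      unfold px, py, pz, psi; cbn [fst snd]. rewrite Hcl, Rminus_diag, Rplus_0_r by auto. reflexivity. }
  apply (x_reparam_isotopic psi (2 + b_end)).
  - intros x y Hxy. unfold psi.
    assert (cl x <= cl y /\ x - cl x <= y - cl y) as [C1 C2] by (unfold cl; split; split_min_max).
    destruct (Req_dec (cl x) (cl y)) as [E|N].
    + rewrite E in *. lra.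
    + pose proof (angle_lt (cl x) (cl y) ltac:(lra)).
      pose proof (cos_decreasing_1 (angle (cl x)) (angle (cl y))). pose proof (Ra x); pose proof (Ra y). lra.
  - apply (lip_continuity _ 5). intros x y. destruct (Lc x y) as [L1 L2]. unfold psi.
    replace (- cos (angle (cl x)) + (x - cl x) - (- cos (angle (cl y)) + (y - cl y)))
      with ((cos (angle (cl y)) - cos (angle (cl x))) + (x - cl x - (y - cl y))) by ring.
    eapply Rle_trans; [apply Rabs_triang|].
    pose proof (cos_lip (angle (cl y)) (angle (cl x))) as K1. pose proof (angle_lip (cl y) (cl x)) as K2.
    rewrite (Rabs_minus_sym (cl y)) in K2. lra.
  - intros x. unfold psi. replace (- cos (angle (cl x)) + (x - cl x) - x) with (- cos (angle (cl x)) - cl x) by ring.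
    pose proof (COS_bound (angle (cl x))). pose proof (Hc x). apply Rabs_le. unfold b_end in *; lra.
Qed.

(** The separation of strands that drives the isotopy also shows that the four arcs are disjoint
    over 0 < u < PI. *)
Lemma arc_injective i j u : 0 < u < PI ->
  GY i (nn * u / 2) = GY j (nn * u / 2) -> GZ s phi i (nn * u / 2) u = GZ s phi j (nn * u / 2) u -> i = j.
Proof.
  intros Hu HY HZ. destruct (classic (i = j)) as [|N]; auto. exfalso.
  destruct (angle_surj u ltac:(lra)) as [x [Hx E]]. pose proof nn_ge1.
  assert (nn * u / 2 = gph x) as En by (rewrite <- E; unfold angle; field; lra).
  rewrite En in *. rewrite <- E in HZ, Hu.
  assert (- / 2 < x < b_end) as Hx'.
  { split; apply Rnot_le_lt; intros F.
    - apply angle_mono in F. rewrite angle_start in F. lra.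
    - apply angle_mono in F. rewrite angle_end in F. lra. }
  destruct (strands_sep_interior i j x N Hx') as [S|S]; unfold YF, ZF in S.
  - rewrite HY in S. lra.
  - rewrite HZ in S. lra.
Qed.
End Curve.

(** * The closed curve cut into four arcs *)

Definition antiperiodic (m : R) : Prop := forall x, cos (x + m * PI) = - cos x.

Lemma antiperiodic_odd k : antiperiodic (2 * INR k + 1).
Proof.
  intros x. replace (x + (2 * INR k + 1) * PI) with (x + PI + 2 * INR k * PI) by ring.
  rewrite cos_period. apply cos_shift.
Qed.

Lemma antiperiodic_shift m s : s = 1 \/ s = -1 -> antiperiodic m -> antiperiodic (m + 2 * s).
Proof.
  intros Hs H x. pose proof (fun y => cos_period y 1) as P. simpl INR in P.
  destruct Hs as [->| ->].
  - rewrite <- H, <- (P (x + m * PI)). f_equal; ring.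
  - rewrite <- H, <- (P (x + (m + 2 * -1) * PI)). f_equal; ring.
Qed.

Lemma antiperiodic_double m x : antiperiodic m -> cos (x + m * (2 * PI)) = cos x.
Proof.
  intros H. replace (x + m * (2 * PI)) with (x + m * PI + m * PI) by ring. rewrite !H. ring.
Qed.

(* The arcs carry the names of the left end positions of the corresponding
   plat strands; u is arccos of the first coordinate. *)
Definition arc_time (j : pos) (u : R) : R :=
  match j with p3 => u / 2 | p2 => u / 2 + PI | p4 => 2 * PI - u / 2 | p1 => PI - u / 2 end.

(** The four times are those with cos 2t = cos u. Under t -> t + PI the terms of the odd frequencies
    nn and nn + 2s change sign, while those of frequency 2 do not. *)
Lemma fourier_arc s phi Q j u : s = 1 \/ s = -1 ->
  let nn := 2 * INR Q + 1 in
  fourier112 2 0 nn (1 / 2) 2 (PI / 4) (nn + 2 * s) phi 1 (arc_time j u) =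
  (cos u, GY j (nn * u / 2), - GZ s phi j (nn * u / 2) u).
Proof.
  intros Hs nn. pose proof (antiperiodic_odd Q) as Hn. fold nn in Hn.
  pose proof (antiperiodic_shift nn s Hs Hn) as Hm.
  assert (forall x, cos (x + 2 * PI) = cos x) as P.
  { intros x. pose proof (cos_period x 1) as H. simpl INR in H. now rewrite Rmult_1_r in H. }
  assert (forall a b, a = - b -> cos a = cos b) as Neg by (intros a b ->; apply cos_neg).
  unfold fourier112. destruct j; cbn [arc_time GY GZ].
  - replace (2 * (PI - u / 2) + 0) with (- u + 2 * PI) by field.
    replace (nn * (PI - u / 2) + 1 / 2) with (- (nn * u / 2 - / 2) + nn * PI) by field.
    replace (2 * (PI - u / 2) + PI / 4) with (- (u - PI / 4) + 2 * PI) by field.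
    replace ((nn + 2 * s) * (PI - u / 2) + phi) with (- (nn * u / 2 + s * u - phi) + (nn + 2 * s) * PI) by field.
    rewrite !P, Hn, Hm, !cos_neg. f_equal. ring.
  - replace (2 * (u / 2 + PI) + 0) with (u + 2 * PI) by field.
    replace (nn * (u / 2 + PI) + 1 / 2) with (nn * u / 2 + / 2 + nn * PI) by field.
    replace (2 * (u / 2 + PI) + PI / 4) with (u + PI / 4 + 2 * PI) by field.
    replace ((nn + 2 * s) * (u / 2 + PI) + phi) with (nn * u / 2 + s * u + phi + (nn + 2 * s) * PI) by field.
    rewrite !P, Hn, Hm. f_equal. ring.
  - replace (2 * (u / 2) + 0) with u by field.
    replace (nn * (u / 2) + 1 / 2) with (nn * u / 2 + / 2) by field.
    replace (2 * (u / 2) + PI / 4) with (u + PI / 4) by field.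
    replace ((nn + 2 * s) * (u / 2) + phi) with (nn * u / 2 + s * u + phi) by field.
    f_equal. ring.
  - replace (2 * (2 * PI - u / 2) + 0) with (- u + 2 * PI + 2 * PI) by field.
    replace (nn * (2 * PI - u / 2) + 1 / 2) with (- (nn * u / 2 - / 2) + nn * (2 * PI)) by field.
    replace (2 * (2 * PI - u / 2) + PI / 4) with (- (u - PI / 4) + 2 * PI + 2 * PI) by field.
    replace ((nn + 2 * s) * (2 * PI - u / 2) + phi) with (- (nn * u / 2 + s * u - phi) + (nn + 2 * s) * (2 * PI)) by field.
    rewrite !P, !antiperiodic_double, !cos_neg by auto. f_equal. ring.
Qed.

(* A fundamental domain for [arc_time]: the end points of the arcs are shared. *)
Definition arc_domain (j : pos) (u : R) : Prop :=
  match j with p3 => 0 <= u <= PI | p1 => 0 <= u < PI | p2 => 0 < u <= PI | p4 => 0 < u < PI end.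

Lemma arc_time_surj t : 0 <= t < 2 * PI -> exists j u, arc_domain j u /\ t = arc_time j u.
Proof.
  intros Ht. destruct (Rle_dec t (PI / 2)); [|destruct (Rle_dec t PI); [|destruct (Rle_dec t (3 * (PI / 2)))]].
  - exists p3, (2 * t). simpl. split; [lra | field].
  - exists p1, (2 * PI - 2 * t). simpl. split; [lra | field].
  - exists p2, (2 * t - 2 * PI). simpl. split; [lra | field].
  - exists p4, (4 * PI - 2 * t). simpl. split; [lra | field].
Qed.

Lemma cos_injective_0_PI x y : 0 <= x <= PI -> 0 <= y <= PI -> cos x = cos y -> x = y.
Proof.
  intros Hx Hy E. destruct (Rtotal_order x y) as [H|[H|H]]; auto.
  - apply cos_decreasing_1 in H; lra.
  - apply cos_decreasing_1 in H; lra.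
Qed.

Lemma fourier_isotopic s phi Q bv bw e1 e3 f1 f3 K :
  good_signs s phi Q bv bw e1 e3 f1 f3 ->
  ambient_isotopic (plat (quads bv bw e1 e3 f1 f3 0 Q)) K ->
  is_fourier_knot_of_type
    (fourier112 2 0 (2 * INR Q + 1) (1 / 2) 2 (PI / 4) (2 * INR Q + 1 + 2 * s) phi 1) K.
Proof.
  intros good HK. assert (s = 1 \/ s = -1) as Hs by apply good. pose proof PI_bounds as HPI.
  set (nn := 2 * INR Q + 1). set (c := fourier112 2 0 nn (1 / 2) 2 (PI / 4) (nn + 2 * s) phi 1).
  assert (forall j u, c (arc_time j u) = (cos u, GY j (nn * u / 2), - GZ s phi j (nn * u / 2) u)) as Hc
    by (intros; now apply fourier_arc).
  split.
  - intros t1 t2 H1 H2 E.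
    destruct (arc_time_surj t1 H1) as [i [u [Du ->]]]. destruct (arc_time_surj t2 H2) as [j [v [Dv ->]]].
    rewrite !Hc in E. injection E as Ex Ey Ez.
    assert (u = v) as <-.
    { apply cos_injective_0_PI; auto; [destruct i | destruct j]; simpl in *; lra. }
    destruct (classic (0 < u < PI)) as [Hu|Hu].
    + rewrite (arc_injective s phi Q bv bw e1 e3 f1 f3 good i j u Hu Ey ltac:(fold nn; lra)). reflexivity.
    (* At each end the arcs meet in pairs. The fundamental domain keeps one arc of each pair, and
       the two remaining points have opposite nonzero y-coordinates. *)
    + assert (u = 0 \/ u = PI) as [->| ->].
      { assert (0 <= u <= PI) by (destruct i; simpl in Du; lra).
        destruct (Req_dec u 0); auto. right. apply NNPP; intros F. apply Hu; lra. }
      * assert (cos (- / 2) = cos (/ 2)) as C by apply cos_neg. pose proof cos_half_pos.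
        destruct i, j; simpl in Du, Dv; auto; try lra; exfalso; simpl in Ey;
          rewrite Rmult_0_r in Ey; unfold Rdiv in Ey; rewrite Rmult_0_l, ?Rplus_0_l, ?Rminus_0_l in Ey; lra.
      * assert (cos (nn * PI / 2 + / 2) <> 0) as N.
        { replace (nn * PI / 2 + / 2) with (PI / 2 + / 2 + INR Q * PI) by (unfold nn; field).
          assert (forall k x, cos x <> 0 -> cos (x + INR k * PI) <> 0) as G.
          { induction k as [|k IH]; intros x Hx; [simpl; now rewrite Rmult_0_l, Rplus_0_r|].
            rewrite S_INR. replace (x + (INR k + 1) * PI) with (x + INR k * PI + PI) by ring.
            rewrite cos_shift. specialize (IH x Hx). lra. }
          apply G. apply Rlt_not_eq, cos_lt_0; lra. }
        destruct i, j; simpl in Du, Dv; auto; try lra; exfalso; simpl in Ey; lra.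
  - left. eapply isotopic_trans; [apply rot_isotopic|].
    eapply isotopic_trans; [|exact HK].
    eapply isotopic_trans; [|apply (curve_plat s phi Q _ _ _ _ _ _ good)].
    apply isotopic_sym.
    eapply isotopic_iff; [reflexivity| |apply (arc_set_isotopic s phi Q)].
    intros p. split.
    + intros [j [u [Hu ->]]]. exists (arc_time j u). split.
      * destruct j; simpl; lra.
      * fold nn. rewrite Hc. coords. f_equal. f_equal. ring.
    + intros [t [Ht E]].
      assert (exists j u, 0 <= u <= PI /\ t = arc_time j u) as [j [u [Hu ->]]].
      { destruct (Req_dec t (2 * PI)) as [->|N].
        - exists p4, 0. simpl. split; [lra | field].
        - destruct (arc_time_surj t ltac:(lra)) as [j [u [D ->]]]. exists j, u. split; auto.
          destruct j; simpl in D; lra. }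
      rewrite Hc in E. exists j, u. split; auto. fold nn. injection E as Ex Ey Ez.
      apply R3_ext; unfold px, py, pz in *; cbn [fst snd] in *; lra.
Qed.

(** * Signs of the heights for the two families *)

Lemma sin_gt_0' x : 0 < x < PI -> 0 < sin x.
Proof. intros H. now apply sin_gt_0. Qed.

Lemma sin_neg_arc x : - PI < x < 0 -> sin x < 0.
Proof.
  intros H. pose proof (sin_gt_0' (- x) ltac:(lra)) as S. rewrite sin_neg in S. lra.
Qed.

Lemma fraction_bound a b n : 0 < n -> a * n < b -> a < b / n.
Proof. intros Hn H. apply (Rmult_lt_reg_r n); auto. unfold Rdiv. rewrite Rmult_assoc, Rinv_l; lra. Qed.

Lemma bound_fraction a b n : 0 < n -> b < a * n -> b / n < a.
Proof. intros Hn H. apply (Rmult_lt_reg_r n); auto. unfold Rdiv. rewrite Rmult_assoc, Rinv_l; lra. Qed.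

(** The given phase is PI/2 + 1/2 + (PI - 1)/n. It reduces the arguments at the s2-crossings to PI/2
    - 2q PI/n and -PI/2 - 2(q + 1) PI/n, whose sines change sign as q and q + 1 pass n/4 = 2N + 3/4.
    The shift by one makes the two s2-letters equal in the quad q = 2N and opposite in all
    others. *)
Lemma signs_odd N : (1 <= N)%nat ->
  good_signs (-1) ((8 * INR N + 1 + (8 * INR N + 5) * PI) / (2 * (8 * INR N + 3))) (4 * N + 1)
    (fun q => negb (q <=? 2 * N)%nat) (fun q => q <? 2 * N)%nat false true true true.
Proof.
  intros HN. apply le_INR in HN. simpl in HN. pose proof PI_bounds as HPI.
  set (n := 8 * INR N + 3). assert (2 * INR (4 * N + 1) + 1 = n) as En.
  { rewrite plus_INR, mult_INR. unfold n; simpl; ring. }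
  set (phi := (8 * INR N + 1 + (8 * INR N + 5) * PI) / (2 * n)).
  assert (phi = PI / 2 + (/ 2 + (PI - 1) / n)) as Ephi by (unfold phi, n; field; lra).
  (* Places [phi] between PI/2 + 1/2 and 3 PI/4, which settles the signs at the simultaneous
     crossings. *)
  assert (0 < (PI - 1) / n < PI / 4 - / 2) as Hphi.
  { split; [apply fraction_bound; unfold n; lra | apply bound_fraction; unfold n; nra]. }
  assert (cos phi = - sin (/ 2 + (PI - 1) / n)) as Ec by (rewrite Ephi, cos_plus, cos_PI2, sin_PI2; ring).
  assert (sin phi = cos (/ 2 + (PI - 1) / n)) as Es by (rewrite Ephi, sin_plus, cos_PI2, sin_PI2; ring).
  assert (0 < sin (/ 2 + (PI - 1) / n)) by (apply sin_gt_0; lra).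
  assert (sin (/ 2 + (PI - 1) / n) < sin (PI / 4)) by (apply sin_increasing_1; lra).
  assert (sin (PI / 4) < cos (/ 2 + (PI - 1) / n)).
  { replace (sin (PI / 4)) with (cos (PI / 4)) by (rewrite cos_PI4, sin_PI4; auto). apply cos_decreasing_1; lra. }
  unfold good_signs. cbv zeta. rewrite En, Ec, Es. fold phi.
  split; [now right|]. split; [|split; [|simpl; repeat split; lra]].
  - intros q Hq. apply le_INR in Hq. rewrite plus_INR, mult_INR in Hq. simpl in Hq.
    replace (-1 * (2 * (PI / 2 - / 2 + INR q * PI) / n) + phi - / 2) with (PI / 2 - 2 * INR q * PI / n)
      by (rewrite Ephi; field; unfold n; lra).
    pose proof (pos_INR q).
    destruct (Nat.leb_spec q (2 * N)) as [L|G]; simpl.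
    + apply le_INR in L. rewrite mult_INR in L. simpl in L.
      assert (2 * INR q * PI / n < PI / 2) by (apply bound_fraction; unfold n; nra).
      assert (0 <= 2 * INR q * PI / n).
      { apply Rmult_le_pos; [nra | left; apply Rinv_0_lt_compat; unfold n; lra]. }
      pose proof (sin_gt_0' (PI / 2 - 2 * INR q * PI / n)). lra.
    + apply le_INR in G. rewrite S_INR, mult_INR in G. simpl in G.
      assert (PI / 2 < 2 * INR q * PI / n) by (apply fraction_bound; unfold n; nra).
      assert (2 * INR q * PI / n < 3 * (PI / 2)) by (apply bound_fraction; unfold n; nra).
      pose proof (sin_neg_arc (PI / 2 - 2 * INR q * PI / n)). lra.
  - intros q Hq. apply le_INR in Hq. rewrite S_INR, plus_INR, mult_INR in Hq. simpl in Hq.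
    set (w := 2 * (INR q + 1) * PI / n).
    replace (-1 * (2 * (PI / 2 + / 2 + INR q * PI) / n) - phi + / 2) with (- (PI / 2) - w)
      by (unfold w; rewrite Ephi; field; unfold n; lra).
    pose proof (pos_INR q).
    assert (0 < w) by (apply fraction_bound; unfold n; nra).
    destruct (Nat.ltb_spec q (2 * N)) as [L|G]; simpl.
    + apply le_INR in L. rewrite S_INR, mult_INR in L. simpl in L.
      assert (w < PI / 2) by (apply bound_fraction; unfold n; nra).
      pose proof (sin_neg_arc (- (PI / 2) - w)). lra.
    + apply le_INR in G. rewrite mult_INR in G. simpl in G.
      assert (PI / 2 < w) by (apply fraction_bound; unfold n; nra).
      assert (w < 3 * (PI / 2)) by (apply bound_fraction; unfold n; nra).
      pose proof (sin_gt_0' (- (PI / 2) - w + 2 * PI) ltac:(lra)) as S.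
      rewrite sin_plus, cos_2PI, sin_2PI in S. lra.
Qed.

(** The given phase is 1/2 - (3 PI/2 - 1)/n. The arguments at the s2-crossings become (2q - 1/2)
    PI/n and (2q + 5/2) PI/n; all lie in (0, PI) except the first one at q = 0, whence a single
    positive s2-letter. *)
Lemma signs_even N : (1 <= N)%nat ->
  good_signs 1 ((2 * INR N + 3 - 3 * PI) / (2 * (2 * INR N + 1))) N
    (fun q => q =? 0)%nat (fun _ => false) false false true false.
Proof.
  intros HN. apply le_INR in HN. simpl in HN. pose proof PI_bounds as HPI.
  set (n := 2 * INR N + 1). set (phi := (2 * INR N + 3 - 3 * PI) / (2 * n)).
  assert (phi = / 2 - (3 * (PI / 2) - 1) / n) as Ephi by (unfold phi, n; field; lra).
  (* Places [phi] between -PI/4 and 1/2, which settles the simultaneous crossings. For n = 3 the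
     upper bound amounts to PI < 10/3. *)
  assert (0 < (3 * (PI / 2) - 1) / n < PI / 4 + / 2) as Hphi.
  { split; [apply fraction_bound; unfold n; lra | apply bound_fraction; unfold n; nra]. }
  assert (sin phi < sin (PI / 4)) by (apply sin_increasing_1; lra).
  assert (- sin (PI / 4) < sin phi).
  { rewrite <- sin_neg. apply sin_increasing_1; lra. }
  assert (sin (PI / 4) < cos phi).
  { replace (sin (PI / 4)) with (cos (PI / 4)) by (rewrite cos_PI4, sin_PI4; auto).
    destruct (Rle_dec 0 phi); [apply cos_decreasing_1; lra|].
    rewrite <- (cos_neg phi). apply cos_decreasing_1; lra. }
  assert (0 < sin (PI / 4)) by (apply sin_gt_0; lra).
  unfold good_signs. cbv zeta. fold n phi.
  split; [now left|]. split; [|split; [|simpl; repeat split; lra]].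
  - intros q Hq. apply le_INR in Hq.
    set (w := (2 * INR q - / 2) * PI / n).
    replace (1 * (2 * (PI / 2 - / 2 + INR q * PI) / n) + phi - / 2) with w
      by (unfold w; rewrite Ephi; field; unfold n; lra).
    destruct (Nat.eqb_spec q 0) as [->|G]; simpl.
    + assert (w < 0) by (apply bound_fraction; simpl; unfold n; nra).
      assert (- PI < w) by (apply fraction_bound; simpl; unfold n; nra).
      pose proof (sin_neg_arc w). lra.
    + assert (1 <= INR q) by (change 1 with (INR 1); apply le_INR; lia).
      assert (w < PI) by (apply bound_fraction; unfold n; nra).
      assert (0 < w) by (apply fraction_bound; unfold n; nra).
      pose proof (sin_gt_0' w). lra.
  - intros q Hq. apply le_INR in Hq. rewrite S_INR in Hq. pose proof (pos_INR q).
    set (w := (2 * INR q + 5 / 2) * PI / n).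
    replace (1 * (2 * (PI / 2 + / 2 + INR q * PI) / n) - phi + / 2) with w
      by (unfold w; rewrite Ephi; field; unfold n; lra).
    assert (w < PI) by (apply bound_fraction; unfold n; nra).
    assert (0 < w) by (apply fraction_bound; unfold n; nra).
    pose proof (sin_gt_0' w). simpl. lra.
Qed.

Theorem theorem6 :
  (forall n : nat, (1 <= n)%nat ->
     let N := INR n in
     is_fourier_knot_of_type
       (fourier112 2 0 (8 * N + 3) (1 / 2) 2 (PI / 4) (8 * N + 1)
          ((8 * N + 1 + (8 * N + 5) * PI) / (2 * (8 * N + 3))) 1)
       (TwistKnot (4 * n + 1)))
  /\
  (forall n : nat, (1 <= n)%nat ->
     let N := INR n in
     is_fourier_knot_of_type
       (fourier112 2 0 (2 * N + 1) (1 / 2) 2 (PI / 4) (2 * N + 3)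
          ((2 * N + 3 - 3 * PI) / (2 * (2 * N + 1))) 1)
       (TwistKnot (2 * n))).
Proof.
  split; intros n Hn N.
  - replace (8 * N + 1) with (2 * INR (4 * n + 1) + 1 + 2 * -1) at 1
      by (rewrite plus_INR, mult_INR; unfold N; simpl; ring).
    replace (8 * N + 3) with (2 * INR (4 * n + 1) + 1) at 1
      by (rewrite plus_INR, mult_INR; unfold N; simpl; ring).
    eapply fourier_isotopic; [exact (signs_odd n Hn)|].
    eapply isotopic_trans; [apply word_odd | apply isotopic_sym, TwistKnot_plat].
  - replace (2 * N + 3) with (2 * INR n + 1 + 2 * 1) at 1 by (unfold N; ring).
    eapply fourier_isotopic; [exact (signs_even n Hn)|].
    eapply isotopic_trans; [now apply word_even | apply isotopic_sym, TwistKnot_plat].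
Qed.
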